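(* Assume that $X$ is of Pareto-type with index $\alpha\in(1,2)$, or $\alpha=1$ with $\mu_1<\infty$, i.e. $1-F(x)\sim x^{-\alpha}\ell(x)$ as $x\to\infty$ with $\ell$ slowly varying, and that the counting process $\{N(t);\,t\geq 0\}$ $\mathcal{D}$-averages in time to the random variable $\Lambda$. Define $(a_t)_{t>0}$ by $\lim_{t\to\infty}t\,a_t^{-\alpha}\ell(a_t)=1$. Then $$\frac{\sqrt{N(t)}}{a_t}\,\widehat{\mathrm{CoVar}(X)}\stackrel{\mathcal{D}}{\longrightarrow}\frac{1}{\mu_1}\,\sqrt{U_\alpha}\quad\text{as } t\rightarrow\infty,$$ where the distribution of $U_\alpha$ is determined by $\mathbb{E}\{e^{-rU_\alpha}\}=\mathbb{E}\{e^{-r^{\alpha/2}\Gamma(1-\alpha/2)\,\Lambda}\}$, $r\geq 0$; and also $$\frac{t}{a_t}\,\frac{\widehat{\mathrm{CoVar}(X)}}{\sqrt{N(t)}}\stackrel{\mathcal{D}}{\longrightarrow}\frac{1}{\mu_1}\,\frac{\sqrt{U_\alpha}}{\Lambda}\quad\text{as } t\rightarrow\infty,$$ where the joint distribution of the random vector $(U_\alpha,\mu_1\Lambda)^\prime$ is determined by $$\mathbb{E}\left\{e^{-rU_\alpha-s\mu_1\Lambda}\right\}=\mathbb{E}\left\{e^{-r^{\alpha/2}\Gamma(1-\alpha/2)\,\Lambda}\right\},\quad r>0,\ s\geq 0.$$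
   Context: $X$ is a positive random variable with distribution function $F$ and $\mu_\beta:=\mathbb{E}X^\beta\le\infty$; $X_1,X_2,\ldots$ are i.i.d. copies of $X$; $\{N(t);\,t\geq 0\}$ is a counting process (nonnegative integer-valued, nondecreasing in $t$) independent of the $X_i$'s. The sample coefficient of variation based on $X_1,\ldots,X_{N(t)}$ is $\widehat{\mathrm{CoVar}(X)}:=S/\overline X$, where $\overline X:=\frac{1}{N(t)}\sum_{i=1}^{N(t)}X_i$ and $S\ge0$ with $S^2:=\frac{1}{N(t)}\sum_{i=1}^{N(t)}(X_i-\overline X)^2$; on $\{N(t)=0\}$ it, and its quotient by $\sqrt{N(t)}$, are set to $0$. $X$ (or $F$) is of Pareto-type with index $\alpha>0$ if $1-F(x)\sim x^{-\alpha}\ell(x)$ as $x\to\infty$ for a slowly varying function $\ell$. The counting process $\mathcal{D}$-averages in time to $\Lambda$ if $N(t)/t\stackrel{\mathcal{D}}{\longrightarrow}\Lambda$ (convergence in distribution) as $t\to\infty$, where $\mathbb{P}[\Lambda>0]=1$. $\Gamma$ is the gamma function.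
   Formalization: The displayed joint transform is inconsistent as printed (no s on the right); its right side is corrected to E exp(-r^{α/2}Γ(1-α/2)Λ - sμ_1Λ). It is also assumed that a_t → ∞, since the defining limit alone does not force this when ℓ is only constrained near infinity. *)

(* Defs.v *)
From HB Require Import structures.
From mathcomp Require Import all_boot all_order all_algebra.
From mathcomp Require Import all_classical all_reals all_analysis.

Set Implicit Arguments.
Unset Strict Implicit.
Unset Printing Implicit Defensive.

Import Order.TTheory GRing.Theory Num.Theory.
Import numFieldNormedType.Exports.

Local Open Scope classical_set_scope.
Local Open Scope ring_scope.

(* Restricted to measurable sets: a measure is unspecified on the other ones. *)
Definition same_law (R : realType) (d1 d2 d : measure_display)
    (T1 : measurableType d1) (T2 : measurableType d2) (S : measurableType d)
    (P1 : probability T1 R) (P2 : probability T2 R)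
    (X1 : T1 -> S) (X2 : T2 -> S) : Prop :=
  forall A : set S, measurable A -> P1 (X1 @^-1` A) = P2 (X2 @^-1` A).

Definition mutually_independent (R : realType) (d d' : measure_display)
    (T : measurableType d) (S : measurableType d') (P : probability T R)
    (I : eqType) (X : I -> T -> S) : Prop :=
  forall (J : seq I) (A : I -> set S), uniq J -> (forall i, measurable (A i)) ->
    P (\big[setI/setT]_(i <- J) (X i @^-1` A i)) =
    (\prod_(i <- J) P (X i @^-1` A i))%E.

(* The sigma-algebra on the sample space generated by the X i, i in D. *)
Definition generated_sigma_algebra (d d' : measure_display)
    (T : measurableType d) (S : measurableType d')
    (I : Type) (D : set I) (X : I -> T -> S) : set (set T) :=
  <<s \bigcup_(i in D) preimage_set_system setT (X i) measurable >>.

Definition independent_systems (R : realType) (d : measure_display)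
    (T : measurableType d) (P : probability T R) (G H : set (set T)) : Prop :=
  forall A B : set T, G A -> H B -> P (A `&` B) = (P A * P B)%E.

(* Time is [0, +oo[; the values of N at negative times are irrelevant. *)
Definition counting_process (R : realType) (d : measure_display)
    (T : measurableType d) (N : R -> T -> nat) : Prop :=
  (forall t, 0 <= t -> measurable_fun setT (N t)) /\
  (forall w s t, 0 <= s -> s <= t -> (N s w <= N t w)%N).

(* Convergence of the distribution functions at every continuity point of the
   limiting one; the limit may live on another probability space. *)
Definition cvg_in_law (R : realType) (d d' : measure_display)
    (T : measurableType d) (T' : measurableType d')
    (P : probability T R) (Y : R -> T -> R)
    (Q : probability T' R) (Z : T' -> R) : Prop :=
  forall x : R, {for x, continuous (fun y : R => Q [set w | Z w <= y])} ->
    P [set w | Y t w <= x] @[t --> +oo] --> Q [set w | Z w <= x].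

Definition averages_in_time (R : realType) (d d' : measure_display)
    (T : measurableType d) (T' : measurableType d')
    (P : probability T R) (N : R -> T -> nat)
    (Q : probability T' R) (Lambda : T' -> R) : Prop :=
  Q [set w | 0 < Lambda w] = 1%E /\
  cvg_in_law P (fun t w => (N t w)%:R / t) Q Lambda.

(* A slowly varying function only needs to be positive and measurable on a
   neighbourhood of +oo. *)
Definition slowly_varying (R : realType) (ell : R -> R) : Prop :=
  (exists A : R, (forall x, A <= x -> 0 < ell x) /\
                 measurable_fun `[A, +oo[ ell) /\
  (forall c : R, 0 < c -> ell (c * x) / ell x @[x --> +oo] --> (1 : R)).

Definition pareto_type (R : realType) (d : measure_display)
    (T : measurableType d) (P : probability T R) (X : {RV P >-> R})
    (alpha : R) (ell : R -> R) : Prop :=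
  slowly_varying ell /\
  (1 - fine (cdf X x)) / (x `^ (- alpha) * ell x) @[x --> +oo] --> (1 : R).

Definition Gamma (R : realType) (z : R) : R :=
  \int[lebesgue_measure]_(x in `]0, +oo[) (x `^ (z - 1) * expR (- x)).

Section sample.
Variables (R : realType) (x : nat -> R) (n : nat).

(* The sample is x 0, ..., x n.-1. *)
Definition sample_mean : R := (\sum_(i < n) x i) / n%:R.

Definition sample_variance : R :=
  (\sum_(i < n) (x i - sample_mean) ^+ 2) / n%:R.

(* For n = 0 this is 0, and so is its quotient by Num.sqrt n%:R, because
   y / 0 = 0 when y = 0. *)
Definition sample_CoVar : R := Num.sqrt sample_variance / sample_mean.

End sample.

Definition has_U_transform (R : realType) (d d' : measure_display)
    (T : measurableType d) (T' : measurableType d') (alpha : R)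
    (P : probability T R) (Lambda : T -> R)
    (Q : probability T' R) (U : T' -> R) : Prop :=
  forall r : R, 0 <= r ->
    ('E_Q [(fun w => expR (- (r * U w)))%R] =
    'E_P [(fun w =>
      expR (- (r `^ (alpha / 2) * Gamma (1 - alpha / 2) * Lambda w)))%R])%E.

(* The joint Laplace transform of (U, V), with V in the role of mu1 * Lambda.
   The term s * mu1 * Lambda on the right is needed: letting r tend to 0 must
   return the Laplace transform of mu1 * Lambda. *)
Definition has_joint_transform (R : realType) (d d' : measure_display)
    (T : measurableType d) (T' : measurableType d') (alpha mu1 : R)
    (P : probability T R) (Lambda : T -> R)
    (Q : probability T' R) (U V : T' -> R) : Prop :=
  forall r s : R, 0 < r -> 0 <= s ->
    ('E_Q [(fun w => expR (- (r * U w) - s * V w))%R] =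
    'E_P [(fun w =>
      expR (- (r `^ (alpha / 2) * Gamma (1 - alpha / 2) * Lambda w)
            - s * (mu1 * Lambda w)))%R])%E.

(* Main.v *)
Require Import Defs.
From HB Require Import structures.
From mathcomp Require Import all_boot all_order all_algebra.
From mathcomp Require Import all_classical all_reals all_analysis.
From mathcomp Require Import measurable_realfun ring lra.

Set Implicit Arguments.
Unset Strict Implicit.
Unset Printing Implicit Defensive.

Import Order.TTheory GRing.Theory Num.Theory.
Import numFieldNormedType.Exports.

Local Open Scope classical_set_scope.
Local Open Scope ring_scope.

(** Write [beta] for half the tail index and [c] for [Gamma (1 - beta)].  The
    squares of the observations have a regularly varying tail of index
    [beta < 1], hence an infinite mean: the sum of the squares is of larger order
    than the number of observations.  Since
    [sample_CoVar] is [sqrt (sum of squares / n - mean ^ 2) / mean], one has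

      [sqrt n / a t * CoVar =
         sqrt (sum of squares / a t ^ 2 - (n / t) * (t / a t ^ 2) * mean ^ 2) / mean]

    ([CoVar_scaled]).  Here [t / a t ^ 2] tends to zero ([norming_sqr]), the mean
    tends to [mu1] ([weak_lln]) and the first term has a limit in law: if [n / t]
    is close to [lam], its Laplace transform at [r] is the [n]-th power of a number
    [q] with [t * (1 - q)] close to [r `^ beta * c] ([laplace_sqr_norming]), hence
    close to [exp (- lam * r `^ beta * c)] ([laplace_sqsum_cvg]).  This is the
    transform of [lam `^ (1 / beta) * S], where [S] is a one-sided stable variable
    whose existence follows from the same computation ([stable_law]).

    For a random number of observations, one conditions on [N t = n], by
    independence: a bounded test function of the statistic has a conditional
    expectation that depends on [(t, n)] only and converges to a function of [lam]
    along all [(t, n)] with [t] large and [n / t] close to [lam]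
    ([fixed_size_cvg]).  As [N t / t] converges in law to [Lambda], the
    expectations converge to those of that function at [Lambda]
    ([random_size_cvg]).  The limit therefore lives on the product of the space of
    [Lambda] and that of an independent [S], with [L = Lambda] and
    [U = Lambda `^ (1 / beta) * S], and Fubini's theorem gives the transforms
    ([mixture_transform]).  The second convergence is the first one with the
    continuous factor [t / N t], whose limit is [1 / Lambda].

    The passages to the limit in law rely on the Weierstrass theorem: a continuous
    function that vanishes far away is, on the half-line, uniformly close to a
    polynomial in [exp (- x)], so that its expectations are governed by the Laplace
    transform at the integers ([laplace_cvg]).  This also gives the uniqueness
    claims, once a bound on the transforms has shown that the variables are almost
    surely nonnegative ([joint_transform_unique]).  *)

(** * Weierstrass approximation *)

Section weierstrass.
Variable R : realType.
Implicit Types (phi psi : nat -> R) (f : R -> R) (x y e : R).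

(** The Bernstein operator, as the expectation of [phi] at a binomial variable
    built one coin flip at a time: with this recursion every moment identity is a
    short induction. *)
Fixpoint bernstein n phi : {poly R} :=
  if n is n'.+1 then
    'X * bernstein n' (fun k => phi k.+1) + (1 - 'X) * bernstein n' phi
  else (phi 0%N)%:P.

Lemma hornerbernsteinS n phi x :
  (bernstein n.+1 phi).[x] =
  x * (bernstein n (fun k => phi k.+1)).[x] + (1 - x) * (bernstein n phi).[x].
Proof. by rewrite /= !hornerE. Qed.

Lemma bernstein_le n phi psi x : 0 <= x <= 1 ->
  (forall k, (k <= n)%N -> phi k <= psi k) ->
  (bernstein n phi).[x] <= (bernstein n psi).[x].
Proof.
move=> /andP[x0 x1]; elim: n phi psi => [|n IH] phi psi le_phi.
  by rewrite /= !hornerE le_phi.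
rewrite !hornerbernsteinS lerD// ler_wpM2l// ?subr_ge0//; apply: IH => k kn.
- exact: le_phi.
- by apply: le_phi; exact: leqW.
Qed.

Lemma bernsteinD n phi psi x :
  (bernstein n (fun k => phi k + psi k)).[x] =
  (bernstein n phi).[x] + (bernstein n psi).[x].
Proof.
elim: n phi psi => [|n IH] phi psi; first by rewrite /= !hornerE.
rewrite !hornerbernsteinS !IH; ring.
Qed.

Lemma bernsteinZ n c phi x :
  (bernstein n (fun k => c * phi k)).[x] = c * (bernstein n phi).[x].
Proof.
elim: n phi => [|n IH] phi; first by rewrite /= !hornerE.
rewrite !hornerbernsteinS !IH; ring.
Qed.

Lemma bernstein_cst n c x : (bernstein n (fun=> c)).[x] = c.
Proof.
elim: n => [|n IH]; first by rewrite /= !hornerE.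
by rewrite !hornerbernsteinS !IH; ring.
Qed.

(** The variance of the binomial law; the shift [s] makes the induction go
    through. *)
Lemma bernstein_sqr n s x :
  (bernstein n (fun k => (k%:R + s) ^+ 2)).[x] =
  (n%:R * x + s) ^+ 2 + n%:R * x * (1 - x).
Proof.
elim: n s => [|n IH] s; first by rewrite /= !hornerE; ring.
rewrite hornerbernsteinS IH.
have -> : (fun k : nat => (k.+1%:R + s) ^+ 2) =
          (fun k : nat => (k%:R + (1 + s)) ^+ 2).
  by apply/funext => k; rewrite -natr1 addrA.
rewrite IH -natr1; ring.
Qed.

Lemma continuous_unif01 f e : continuous f -> 0 < e ->
  exists2 dl : R, 0 < dl & forall x y, 0 <= x <= 1 -> `|x - y| < dl ->
    `|f x - f y| <= e.
Proof.
move=> cf e0.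
pose Q (dl x : R) := forall y, `|x - y| < dl -> `|f x - f y| <= e.
have : \forall dl \near 0^'+, `[0, 1]%classic `<=` Q dl.
  have /compact_near_coveringP := @segment_compact R 0 1.
  apply => x _.
  have /cvgrPdist_le/(_ (e / 2)) := cf x.
  rewrite divr_gt0// => /(_ isT) /nbhs_ballP[r /= r0 fr].
  exists (ball x (r / 2), [set dl | dl < r / 2]); first split.
  - by apply: nbhsx_ballx; rewrite divr_gt0.
  - by apply: nbhs_right_lt; rewrite divr_gt0.
  move=> [x' dl] [/= xx' dlr] y x'y.
  rewrite (le_trans (ler_distD (f x) _ _))// [e]splitr lerD//.
    rewrite distrC; apply: fr; apply: le_ball xx'.
    by rewrite ler_pdivrMr// ler_pMr// ler1n.
  apply: fr; rewrite /ball /= (le_lt_trans (ler_distD x' _ _))// [r]splitr.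
  by rewrite ltrD// (lt_trans x'y).
move=> H; near (0 : R)^'+ => dl; exists dl; first by near: dl; exact: nbhs_right_gt.
move=> x y x01; exact: (near H dl).
Unshelve. all: by end_near. Qed.

(** Away from the diagonal, the uniform continuity modulus is replaced by the
    Chebyshev bound [2 M (x - y)^2 / dl^2], which the Bernstein operator
    integrates exactly. *)
Lemma weierstrass f e : continuous f -> 0 < e ->
  exists p : {poly R}, forall x, 0 <= x <= 1 -> `|f x - p.[x]| <= e.
Proof.
move=> cf e0.
have [dl dl0 fdl] := continuous_unif01 cf (divr_gt0 e0 (ltr0n _ 2)).
have [M M0 fM] : exists2 M : R, 0 < M & forall x : R, 0 <= x <= 1 -> `|f x| <= M.
  have [|c _ cP] := @EVT_max R (fun x => `|f x|) 0 1 ler01.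
    by apply: continuous_subspaceT => x; apply: (continuous_comp (cf x));
       exact: norm_continuous.
  exists (`|f c| + 1); first by rewrite ltr_wpDl.
  move=> x x01; rewrite (le_trans (cP x _))// ?in_itv// lerDl//.
pose K := 2 * M / dl ^+ 2.
have K0 : 0 < K by rewrite divr_gt0 ?mulr_gt0 ?exprn_gt0.
have key x y : 0 <= x <= 1 -> 0 <= y <= 1 ->
    `|f x - f y| <= e / 2 + K * (y - x) ^+ 2.
  move=> x01 y01; have [xy|xy] := ltP `|x - y| dl.
    by rewrite (le_trans (fdl _ _ x01 xy))// lerDl mulr_ge0 ?sqr_ge0 ?ltW.
  rewrite (le_trans (ler_normB _ _))//.
  have h : 2 * M <= K * (y - x) ^+ 2.
    rewrite /K mulrAC ler_pdivlMr ?exprn_gt0// ler_wpM2l//; first by rewrite mulr_ge0// ltW.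
    by rewrite -(real_normK (num_real (y - x))) lerXn2r ?nnegrE ?(ltW dl0)// distrC.
  have := fM _ x01; have := fM _ y01; lra.
have [n n0 nK] : exists2 n, (0 < n)%N & K / n%:R <= e / 2.
  exists (Num.truncn (K / (e / 2))).+1 => //.
  rewrite ler_pdivrMr// mulrC -ler_pdivrMr ?divr_gt0// ltW// truncnS_gt//.
exists (bernstein n (fun k => f (k%:R / n%:R))) => x x01.
have nR0 : n%:R != 0 :> R by rewrite pnatr_eq0 -lt0n.
have kn01 k : (k <= n)%N -> 0 <= (k%:R / n%:R : R) <= 1.
  by move=> kn; rewrite divr_ge0//= ler_pdivrMr ?ltr0n// mul1r ler_nat.
have bound : (bernstein n (fun k => e / 2 + K * (k%:R / n%:R - x) ^+ 2)).[x]
    <= e.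
  rewrite bernsteinD bernstein_cst bernsteinZ.
  have -> : (fun k : nat => (k%:R / n%:R - x) ^+ 2) =
      (fun k : nat => (n%:R ^- 2) * (k%:R + - (n%:R * x)) ^+ 2).
    by apply/funext => k; field.
  rewrite bernsteinZ bernstein_sqr subrr expr0n/= add0r.
  have -> : K * (n%:R ^- 2 * (n%:R * x * (1 - x))) = K / n%:R * (x * (1 - x)).
    by field.
  rewrite [leRHS]splitr lerD2l (le_trans _ nK)// ler_piMr//.
    by rewrite divr_ge0// ltW.
  by case/andP: x01 => ? ?; nra.
pose Q k := e / 2 + K * (k%:R / n%:R - x) ^+ 2.
rewrite distrC ler_distl; apply/andP; split.
- apply: (@le_trans _ _ (bernstein n (fun k => f x + -1 * Q k)).[x]).
    by rewrite bernsteinD bernstein_cst bernsteinZ; move: bound; rewrite /Q; lra.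
  apply: bernstein_le => // k /kn01 k01.
  by have := key _ _ x01 k01; rewrite ler_distl /Q => /andP[_]; lra.
- apply: (@le_trans _ _ (bernstein n (fun k => f x + Q k)).[x]).
    apply: bernstein_le => // k /kn01 k01.
    by have := key _ _ x01 k01; rewrite ler_distl /Q => /andP[+ _]; lra.
  by rewrite bernsteinD bernstein_cst; move: bound; rewrite /Q; lra.
Unshelve. all: by end_near. Qed.

End weierstrass.

(** * Expectations of bounded random variables *)

(** Boundedness, unlike integrability, passes to products and compositions: it
    is the side condition under which the real-valued expectation below is
    manipulated. *)
Definition bmf (R : realType) d (T : measurableType d) (f : T -> R) :=
  measurable_fun setT f /\ exists M : R, forall x, `|f x| <= M.

Definition Ex (R : realType) d (T : measurableType d) (P : probability T R)
  (f : T -> R) : R := \int[P]_x f x.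

Section bmf.
Context {R : realType} d {T : measurableType d}.
Implicit Types f g : T -> R.

Lemma bmf_le f (M : R) : measurable_fun setT f -> (forall x, `|f x| <= M) ->
  bmf f.
Proof. by move=> mf fM; split=> //; exists M. Qed.

Lemma bmf01 f : measurable_fun setT f -> (forall x, 0 <= f x <= 1) -> bmf f.
Proof.
move=> mf f01; apply: (@bmf_le _ 1) => // x.
by have /andP[f0 f1] := f01 x; rewrite ger0_norm.
Qed.

Lemma bmf_cst (c : R) : bmf ((fun=> c) : T -> R).
Proof. by apply: (@bmf_le _ `|c|). Qed.

Lemma bmfD f g : bmf f -> bmf g -> bmf (fun x => f x + g x).
Proof.
move=> [mf [A fA]] [mg [B gB]]; apply: (@bmf_le _ (A + B)).
  exact: measurable_funD.
by move=> x; rewrite (le_trans (ler_normD _ _))// lerD.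
Qed.

Lemma bmfM f g : bmf f -> bmf g -> bmf (fun x => f x * g x).
Proof.
move=> [mf [A fA]] [mg [B gB]]; apply: (@bmf_le _ (A * B)).
  exact: measurable_funM.
by move=> x; rewrite normrM ler_pM.
Qed.

Lemma bmfN f : bmf f -> bmf (fun x => - f x).
Proof.
move=> [mf [A fA]]; apply: (@bmf_le _ A); first exact: measurableT_comp.
by move=> x; rewrite normrN.
Qed.

Lemma bmfB f g : bmf f -> bmf g -> bmf (fun x => f x - g x).
Proof. by move=> bf bg; apply: bmfD => //; exact: bmfN. Qed.

Lemma bmfZ (c : R) f : bmf f -> bmf (fun x => c * f x).
Proof. by move=> bf; apply: bmfM => //; exact: bmf_cst. Qed.

Lemma bmf_norm f : bmf f -> bmf (fun x => `|f x|).
Proof.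
move=> [mf [A fA]]; apply: (@bmf_le _ A); first exact: measurableT_comp.
by move=> x; rewrite normr_id.
Qed.

Lemma bmf_sum (I : Type) (s : seq I) (F : I -> T -> R) :
  (forall i, bmf (F i)) -> bmf (fun x => \sum_(i <- s) F i x).
Proof.
move=> bF; elim: s => [|i s IH].
  by under eq_fun do rewrite big_nil; exact: bmf_cst.
by under eq_fun do rewrite big_cons; exact: bmfD.
Qed.

Lemma bmf_prod (I : Type) (s : seq I) (F : I -> T -> R) :
  (forall i, bmf (F i)) -> bmf (fun x => \prod_(i <- s) F i x).
Proof.
move=> bF; elim: s => [|i s IH].
  by under eq_fun do rewrite big_nil; exact: bmf_cst.
by under eq_fun do rewrite big_cons; exact: bmfM.
Qed.

Lemma bmf_indic (A : set T) : measurable A -> bmf (\1_A : T -> R).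
Proof.
move=> mA; apply: bmf01; first exact: measurable_indic.
by move=> x; rewrite indicE ler0n lern1 leq_b1.
Qed.

Lemma bmf_comp d' (S : measurableType d') (h : S -> R) (Y : T -> S) :
  bmf h -> measurable_fun setT Y -> bmf (fun x => h (Y x)).
Proof.
move=> [mh [M hM]] mY; apply: (@bmf_le _ M) => //.
exact: measurableT_comp.
Qed.

Lemma bmf_expRN (Y : T -> R) : measurable_fun setT Y -> (forall w, 0 <= Y w) ->
  bmf (fun w => expR (- Y w)).
Proof.
move=> mY Y0; apply: bmf01.
  by apply: measurableT_comp => //; exact: measurableT_comp.
by move=> w; rewrite expR_ge0/= expR_le1 oppr_le0.
Qed.

End bmf.

Section Ex.
Context {R : realType} d {T : measurableType d} (P : probability T R).
Implicit Types f g : T -> R.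

Lemma bmf_integrable f : bmf f -> P.-integrable setT (EFin \o f).
Proof.
move=> [mf [M fM]]; apply: measurable_bounded_integrable => //.
  by rewrite (le_lt_trans (probability_le1 _ _))// ltry.
exists M; split; first exact: num_real.
by move=> y My x _; exact: le_trans (fM x) (ltW My).
Qed.

Lemma EFin_Ex f : bmf f -> (Ex P f)%:E = (\int[P]_x (f x)%:E)%E.
Proof.
by move=> bf; rewrite /Ex /Rintegral fineK// integrable_fin_num// bmf_integrable.
Qed.

Lemma eq_Ex f g : f =1 g -> Ex P f = Ex P g.
Proof. by move=> /funext ->. Qed.

Lemma Ex_mul1 f : Ex P (fun w => 1 * f w) = Ex P f.
Proof. by apply: eq_Ex => w; rewrite mul1r. Qed.

Lemma Ex_cst (c : R) : Ex P (fun=> c) = c.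
Proof. rewrite /Ex Rintegral_cst//.
have -> : fine (P setT) = 1 by rewrite probability_setT.
by rewrite mulr1. Qed.

Lemma ExD f g : bmf f -> bmf g -> Ex P (fun x => f x + g x) = Ex P f + Ex P g.
Proof. by move=> bf bg; apply: RintegralD => //; exact: bmf_integrable. Qed.

Lemma ExB f g : bmf f -> bmf g -> Ex P (fun x => f x - g x) = Ex P f - Ex P g.
Proof. by move=> bf bg; apply: RintegralB => //; exact: bmf_integrable. Qed.

Lemma ExZ (c : R) f : bmf f -> Ex P (fun x => c * f x) = c * Ex P f.
Proof. by move=> bf; apply: RintegralZl => //; exact: bmf_integrable. Qed.

Lemma Ex_sum (I : Type) (s : seq I) (F : I -> T -> R) :
  (forall i, bmf (F i)) ->
  Ex P (fun x => \sum_(i <- s) F i x) = \sum_(i <- s) Ex P (F i).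
Proof.
move=> bF; elim: s => [|i s IH].
  by under eq_Ex do rewrite big_nil; rewrite Ex_cst big_nil.
under eq_Ex do rewrite big_cons.
by rewrite ExD ?IH ?big_cons//; exact: bmf_sum.
Qed.

Lemma Ex_le f g : bmf f -> bmf g -> (forall x, f x <= g x) ->
  Ex P f <= Ex P g.
Proof. by move=> bf bg fg; apply: le_Rintegral => //; exact: bmf_integrable. Qed.

Lemma Ex_ge0 f : (forall x, 0 <= f x) -> 0 <= Ex P f.
Proof. by move=> f0; exact: Rintegral_ge0. Qed.

Lemma Ex_norm f : bmf f -> `|Ex P f| <= Ex P (fun x => `|f x|).
Proof. by move=> bf; apply: le_normr_Rintegral => //; exact: bmf_integrable. Qed.

Lemma Ex_dist f g h : bmf f -> bmf g -> bmf h ->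
  (forall x, `|f x - g x| <= h x) -> `|Ex P f - Ex P g| <= Ex P h.
Proof.
move=> bf bg bh fgh; rewrite -ExB// (le_trans (Ex_norm (bmfB bf bg)))//.
by apply: Ex_le => //; apply: bmf_norm; exact: bmfB.
Qed.

Lemma Ex_dist_cst f g (e : R) : bmf f -> bmf g ->
  (forall x, `|f x - g x| <= e) -> `|Ex P f - Ex P g| <= e.
Proof.
by move=> bf bg fge; rewrite -[leRHS]Ex_cst; apply: Ex_dist => //; exact: bmf_cst.
Qed.

Lemma Ex_indic (A : set T) : measurable A -> Ex P (\1_A) = fine (P A).
Proof. by move=> mA; rewrite /Ex /Rintegral integral_indic// setIT. Qed.

Lemma Ex_indic_comp d' (S : measurableType d') (Y : T -> S) (A : set S) :
  measurable_fun setT Y -> measurable A ->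
  Ex P (fun w => \1_A (Y w)) = fine (P (Y @^-1` A)).
Proof.
move=> mY mA; rewrite -Ex_indic; last by rewrite -[X in measurable X]setTI; exact: mY.
by apply: eq_Ex => w; rewrite !indicE; congr (nat_of_bool _)%:R; apply/idP/idP; rewrite !inE.
Qed.

Lemma fine_P01 (A : set T) : measurable A -> 0 <= fine (P A) <= 1.
Proof.
move=> mA; rewrite fine_ge0//= -lee_fin fineK ?probability_le1//.
exact: fin_num_measure.
Qed.

Lemma fine_P_le (A B : set T) : measurable A -> measurable B -> A `<=` B ->
  fine (P A) <= fine (P B).
Proof.
by move=> mA mB AB; rewrite fine_le ?fin_num_measure// le_measure// inE.
Qed.

Lemma Ex_as f g : bmf f -> bmf g -> {ae P, forall x, f x = g x} ->
  Ex P f = Ex P g.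
Proof.
move=> bf bg fg; congr fine; apply: ae_eq_integral => //.
- by apply/measurable_EFinP; case: bf.
- by apply/measurable_EFinP; case: bg.
- by apply: filterS fg => x fgx _ /=; rewrite fgx.
Qed.

Lemma Ex_cvg (f_ : nat -> T -> R) f (M : R) :
  (forall n, measurable_fun setT (f_ n)) -> measurable_fun setT f ->
  (forall n x, `|f_ n x| <= M) -> {ae P, forall x, f_ n x @[n --> \oo] --> f x} ->
  Ex P (f_ n) @[n --> \oo] --> Ex P f.
Proof.
move=> mf_ mf fM f_f.
have [||||| ifo _ cvg_int] := @dominated_convergence _ T R P setT measurableT
  (fun n => EFin \o f_ n) (EFin \o f) (EFin \o cst M).
- by move=> n; exact/measurable_EFinP.
- exact/measurable_EFinP.
- apply: filterS f_f => x f_fx _; apply: cvg_EFin => //; exact: nearW.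
- exact: bmf_integrable (bmf_cst M).
- by apply: aeW => x n _ /=; rewrite lee_fin.
by apply: fine_cvg; rewrite fineK//; exact: integrable_fin_num.
Qed.

End Ex.

(** ** Bounded functions as limits of staircases *)

Section staircase.
Variable R : realType.

(** The rounding of [y] down to a multiple of [1 / (m + 1)], written as a sum of
    indicators of superlevel sets. *)
Definition staircase m (y : R) : R :=
  m.+1%:R^-1 * \sum_(k < m.+1) (k.+1%:R <= m.+1%:R * y)%R%:R.

Lemma staircase_dist m (y : R) : 0 <= y <= 1 ->
  `|staircase m y - y| <= m.+1%:R^-1.
Proof.
move=> /andP[y0 y1].
have m0 : 0 < m.+1%:R :> R by rewrite ltr0n.
suff H n (z : R) : 0 <= z <= n%:R ->
    z - 1 <= \sum_(k < n) (k.+1%:R <= z)%R%:R <= z.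
  have /H/andP[h1 h2] : 0 <= m.+1%:R * y <= m.+1%:R.
    by rewrite mulr_ge0//= ler_piMr.
  have e : y = m.+1%:R^-1 * (m.+1%:R * y) by rewrite mulKf ?gt_eqF.
  rewrite /staircase [X in _ - X]e -mulrBr normrM gtr0_norm ?invr_gt0//.
  rewrite ler_piMr// ?invr_ge0// ler_norml; apply/andP; split; lra.
elim: n z => [|n IH] z /andP[z0 zn].
  by rewrite big_ord0; apply/andP; split; lra.
rewrite big_ord_recr/=; have [nz|zn'] := leP n.+1%:R z.
  have -> : z = n.+1%:R by apply/eqP; rewrite eq_le zn.
  rewrite (eq_bigr (fun=> 1)); last first.
    by move=> i _; rewrite ler_nat ltnS ltnW// ltn_ord.
  by rewrite sumr_const card_ord -natr1 (_ : true%:R = 1)//; apply/andP; split; lra.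
rewrite addr0; have [zn2|nz] := leP z n%:R; first by apply: IH; rewrite z0.
rewrite (eq_bigr (fun=> 1)); last first.
  move=> i _; rewrite (_ : (_ <= _) = true)//; apply/idP.
  by rewrite (le_trans _ (ltW nz))// ler_nat.
rewrite sumr_const card_ord; move: zn'; rewrite -natr1 => zn'.
by apply/andP; split; lra.
Qed.

End staircase.

(** Two weighted laws that agree on measurable sets give the same integral to
    every function into the unit interval: approximate it uniformly by staircases. *)
Lemma eq_Ex_weighted (R : realType) d1 d2 d (T1 : measurableType d1)
    (T2 : measurableType d2) (S : measurableType d)
    (P1 : probability T1 R) (P2 : probability T2 R)
    (G1 : T1 -> R) (G2 : T2 -> R) (Y1 : T1 -> S) (Y2 : T2 -> S) (h : S -> R) :
  bmf G1 -> bmf G2 -> measurable_fun setT Y1 -> measurable_fun setT Y2 ->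
  measurable_fun setT h -> (forall y, 0 <= h y <= 1) ->
  (forall A, measurable A -> Ex P1 (fun w => G1 w * \1_A (Y1 w)) =
                             Ex P2 (fun w => G2 w * \1_A (Y2 w))) ->
  Ex P1 (fun w => G1 w * h (Y1 w)) = Ex P2 (fun w => G2 w * h (Y2 w)).
Proof.
move=> bG1 bG2 mY1 mY2 mh h01 eqA; have bh := bmf01 mh h01.
pose A m k := [set y | k.+1%:R <= m.+1%:R * h y] : set S.
have mA m k : measurable (A m k).
  rewrite /A -[X in measurable X]setTI.
  have /(_ measurableT [set true]) : measurable_fun setT
      (fun y => k.+1%:R <= m.+1%:R * h y).
    by apply: measurable_fun_ler => //; exact: measurable_funM.
  rewrite (_ : _ @^-1` _ = [set y | k.+1%:R <= m.+1%:R * h y]); last first.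
    by apply/seteqP; split.
  by apply.
have stE m y : staircase m (h y) = m.+1%:R^-1 * \sum_(k < m.+1) \1_(A m k) y.
  congr (_ * _); apply: eq_bigr => k _; rewrite indicE; congr (nat_of_bool _)%:R.
  by apply/idP/idP; rewrite inE.
have bst m : bmf (fun y => staircase m (h y)).
  under eq_fun do rewrite stE.
  by apply: bmfZ; apply: bmf_sum => k; exact: bmf_indic.
have [B1 GB1] := bG1.2; have [B2 GB2] := bG2.2.
have est d' (T' : measurableType d') (P' : probability T' R)
    (G : T' -> R) (Y : T' -> S) (B : R) m : bmf G -> measurable_fun setT Y ->
    (forall w, `|G w| <= B) ->
    `|Ex P' (fun w => G w * staircase m (h (Y w))) -
      Ex P' (fun w => G w * h (Y w))| <= B * m.+1%:R^-1.
  move=> bG mY GB; apply: Ex_dist_cst.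
  - by apply: bmfM => //; exact: (@bmf_comp _ _ _ _ _ _ Y (bst m)).
  - by apply: bmfM => //; exact: bmf_comp.
  - by move=> w; rewrite -mulrBr normrM ler_pM// staircase_dist.
have eqst m : Ex P1 (fun w => G1 w * staircase m (h (Y1 w))) =
              Ex P2 (fun w => G2 w * staircase m (h (Y2 w))).
  have expand d' (T' : measurableType d') (P' : probability T' R)
      (G : T' -> R) (Y : T' -> S) : bmf G -> measurable_fun setT Y ->
      Ex P' (fun w => G w * staircase m (h (Y w))) =
      m.+1%:R^-1 * \sum_(k < m.+1) Ex P' (fun w => G w * \1_(A m k) (Y w)).
    move=> bG mY.
    have b1 k : bmf (fun w => G w * \1_(A m k) (Y w) : R).
      by apply: bmfM => //; apply: bmf_comp => //; exact: bmf_indic.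
    rewrite -Ex_sum// -ExZ; last exact: bmf_sum.
    by apply: eq_Ex => w; rewrite stE -mulr_sumr; ring.
  by rewrite !expand//; congr (_ * _); apply: eq_bigr => k _; exact: eqA.
apply/eqP; rewrite -subr_eq0 -normr_le0; apply/ler_addgt0Pr => e e0; rewrite add0r.
have B0 : 0 < `|B1| + `|B2| + 1 by rewrite ltr_wpDl// addr_ge0.
pose m := Num.truncn ((`|B1| + `|B2| + 1) / e).
have em : (`|B1| + `|B2| + 1) * m.+1%:R^-1 <= e.
  by rewrite ler_pdivrMr// mulrC -ler_pdivrMr// ltW// truncnS_gt.
have := est _ _ P1 _ _ _ m bG1 mY1 GB1.
have := est _ _ P2 _ _ _ m bG2 mY2 GB2.
rewrite eqst => h2 h1; rewrite (le_trans _ em)//.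
rewrite (le_trans (ler_distD (Ex P2 (fun w => G2 w * staircase m (h (Y2 w)))) _ _))//.
rewrite distrC (le_trans (lerD h1 h2))// -mulrDl ler_pM2r ?invr_gt0//.
have := ler_norm B1; have := ler_norm B2; lra.
Qed.

Lemma eq_Ex_law (R : realType) d1 d2 d (T1 : measurableType d1)
    (T2 : measurableType d2) (S : measurableType d)
    (P1 : probability T1 R) (P2 : probability T2 R)
    (Y1 : T1 -> S) (Y2 : T2 -> S) (h : S -> R) :
  measurable_fun setT Y1 -> measurable_fun setT Y2 ->
  measurable_fun setT h -> (forall y, 0 <= h y <= 1) -> same_law P1 P2 Y1 Y2 ->
  Ex P1 (fun w => h (Y1 w)) = Ex P2 (fun w => h (Y2 w)).
Proof.
move=> mY1 mY2 mh h01 sl; have bh := bmf01 mh h01.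
have := @eq_Ex_weighted R _ _ _ _ _ _ P1 P2 (fun=> 1) (fun=> 1) Y1 Y2 h
  (bmf_cst 1) (bmf_cst 1) mY1 mY2 mh h01.
rewrite !Ex_mul1; apply => A mA.
by rewrite !Ex_mul1 !Ex_indic_comp// sl.
Qed.

(** * Laplace transforms and convergence in law *)

Definition laplace (R : realType) d (T : measurableType d)
  (P : probability T R) (Y : T -> R) (r : R) : R :=
  Ex P (fun w => expR (- (r * Y w))).

(** The functions that the Laplace transform of a nonnegative variable
    controls: on [[0, +oo[] they are continuous functions of [expR (- v)]. *)
Definition eventually0 (R : realType) (g : R -> R) :=
  continuous g /\ exists M : R, forall v, M <= v -> g v = 0.

Section laplace.
Context {R : realType}.

Lemma bmf_laplace d (T : measurableType d) (Y : T -> R) (r : R) : 0 <= r ->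
  measurable_fun setT Y -> (forall w, 0 <= Y w) ->
  bmf (fun w => expR (- (r * Y w))).
Proof.
move=> r0 mY Y0; apply: (@bmf_expRN _ _ _ (fun w => r * Y w)).
  exact: measurable_funM.
by move=> w; exact: mulr_ge0.
Qed.

Lemma eventually0_bounded (g : R -> R) : eventually0 g ->
  exists M : R, forall v, 0 <= v -> `|g v| <= M.
Proof.
move=> [cg [M gM]]; have M0 : 0 <= `|M| by [].
have [|c _ cP] := @EVT_max R (fun x => `|g x|) 0 `|M| M0.
  apply: continuous_subspaceT => x; apply: (continuous_comp (cg x)).
  exact: norm_continuous.
exists `|g c| => v v0; have [vM|vM] := leP v `|M|.
  by apply: cP; rewrite in_itv/= v0.
by rewrite gM ?normr0// (le_trans (ler_norm _) (ltW vM)).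
Qed.

Lemma bmf_eventually0 d (T : measurableType d) (g : R -> R) (Y : T -> R) :
  eventually0 g -> measurable_fun setT Y -> (forall w, 0 <= Y w) ->
  bmf (fun w => g (Y w)).
Proof.
move=> eg mY Y0; have [M gM] := eventually0_bounded eg.
apply: (@bmf_le _ _ _ _ M); last by move=> w; exact: gM.
by apply: measurableT_comp => //; apply: continuous_measurable_fun; case: eg.
Qed.

(** Composing with [- ln] turns [g] into a continuous function on the unit
    interval; truncating the logarithm at [M] loses nothing, as [g] vanishes
    beyond [M]. *)
Lemma eventually0_approx (g : R -> R) (e : R) : eventually0 g -> 0 < e ->
  exists p : {poly R}, forall v, 0 <= v -> `|g v - p.[expR (- v)]| <= e.
Proof.
move=> [cg [M gM]] e0.
pose h x := g (- ln (Num.max x (expR (- M)))).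
have ch : continuous h.
  move=> x; apply: continuous_comp; last exact: cg.
  apply: (@continuous_comp _ _ _ _ (@GRing.opp R)); last exact: opp_continuous.
  apply: (@continuous_comp _ _ _ (fun x : R => Num.max x (expR (- M)))).
    by apply: continuous_max; [exact: cvg_id|exact: cvg_cst].
  by apply: continuous_ln; rewrite lt_max expR_gt0 orbT.
have [p hp] := weierstrass ch e0.
exists p => v v0; have := hp (expR (- v)).
rewrite expR_ge0 expR_le1 oppr_le0 => /(_ v0).
suff -> : h (expR (- v)) = g v by [].
rewrite /h; have [vM|Mv] := leP v M.
  by rewrite max_l ?ler_expR ?lerN2// expRK opprK.
by rewrite max_r ?ler_expR ?lerN2 ?(ltW Mv)// expRK opprK !gM// ltW.
Qed.

Lemma bmf_horner_expR d (T : measurableType d) (Y : T -> R) (p : {poly R}) :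
  measurable_fun setT Y -> (forall w, 0 <= Y w) ->
  bmf (fun w => p.[expR (- Y w)]).
Proof.
move=> mY Y0; under eq_fun do rewrite horner_coef.
apply: bmf_sum => k; apply: bmfZ.
under eq_fun do rewrite -expRM_natl mulrN.
exact: bmf_laplace.
Qed.

Lemma Ex_horner_expR d (T : measurableType d) (P : probability T R)
    (G Y : T -> R) (p : {poly R}) :
  bmf G -> measurable_fun setT Y -> (forall w, 0 <= Y w) ->
  Ex P (fun w => G w * p.[expR (- Y w)]) =
  \sum_(k < size p) p`_k * Ex P (fun w => G w * expR (- (k%:R * Y w))).
Proof.
move=> bG mY Y0.
have bk k : bmf (fun w => G w * expR (- (k%:R * Y w))).
  by apply: bmfM => //; exact: bmf_laplace.
rewrite (@eq_Ex _ _ _ P _ (fun w => \sum_(k < size p)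
    (p`_k * (G w * expR (- (k%:R * Y w)))))); last first.
  move=> w; rewrite horner_coef mulr_sumr; apply: eq_bigr => k _.
  by rewrite mulrCA -expRM_natl mulrN.
rewrite Ex_sum; last by move=> k; exact: bmfZ.
by apply: eq_bigr => k _; rewrite ExZ.
Qed.

(** The same polynomial works for all laws and all weights at once. *)
Lemma eventually0_weighted_approx (g : R -> R) (e : R) :
  eventually0 g -> 0 < e ->
  exists p : {poly R}, forall d (T : measurableType d) (P : probability T R)
    (G Y : T -> R), measurable_fun setT G -> (forall w, 0 <= G w <= 1) ->
    measurable_fun setT Y -> (forall w, 0 <= Y w) ->
  `|Ex P (fun w => G w * g (Y w)) -
    \sum_(k < size p) p`_k * Ex P (fun w => G w * expR (- (k%:R * Y w)))| <= e.
Proof.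
move=> eg e0; have [p gp] := eventually0_approx eg e0.
exists p => d T P G Y mG G01 mY Y0; have bG := bmf01 mG G01.
rewrite -Ex_horner_expR//; apply: Ex_dist_cst.
- by apply: bmfM => //; exact: bmf_eventually0.
- by apply: bmfM => //; exact: bmf_horner_expR.
- move=> w; have /andP[g0 g1] := G01 w.
  by rewrite -mulrBr normrM (ger0_norm g0) -[leRHS]mul1r ler_pM// gp.
Qed.

Lemma eventually0_laplace_approx (g : R -> R) (e : R) :
  eventually0 g -> 0 < e ->
  exists p : {poly R}, forall d (T : measurableType d) (P : probability T R)
    (Y : T -> R), measurable_fun setT Y -> (forall w, 0 <= Y w) ->
  `|Ex P (fun w => g (Y w)) - \sum_(k < size p) p`_k * laplace P Y k%:R| <= e.
Proof.
move=> eg e0; have [p gp] := eventually0_weighted_approx eg e0.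
exists p => d T P Y mY Y0; have := gp _ _ P (fun=> 1) Y.
rewrite Ex_mul1 (eq_bigr (fun k : 'I__ => p`_k * laplace P Y k%:R)).
  by apply => // w; rewrite ler01 lexx.
by move=> k _; rewrite Ex_mul1.
Qed.

Section cvg.
Context {I : Type} {F : set_system I} {FF : ProperFilter F}.
Context d {T : measurableType d} (P : probability T R) (Y : I -> T -> R).
Hypothesis mY : \forall i \near F,
  measurable_fun setT (Y i) /\ (forall w, 0 <= Y i w).

Lemma cvg_laplace_sum (p : {poly R}) (l : nat -> R) :
  (forall k : nat, laplace P (Y i) k%:R @[i --> F] --> l k) ->
  \sum_(k < size p) p`_k * laplace P (Y i) k%:R @[i --> F] -->
  \sum_(k < size p) p`_k * l k.
Proof.
move=> h; elim: (size p) => [|n IH].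
  by under eq_fun do rewrite big_ord0; rewrite big_ord0; exact: cvg_cst.
under eq_fun do rewrite big_ord_recr; rewrite big_ord_recr.
by apply: cvgD => //; apply: cvgM => //; exact: cvg_cst.
Qed.

(** Convergence of the transforms suffices even when no limit law is at hand,
    which is what the construction of a limit law starts from. *)
Lemma laplace_is_cvg (g : R -> R) (l : nat -> R) : eventually0 g ->
  (forall k : nat, laplace P (Y i) k%:R @[i --> F] --> l k) ->
  cvg (Ex P (fun w => g (Y i w)) @[i --> F]).
Proof.
move=> eg h; apply/cauchy_cvgP/cauchy_exP => e e0.
have e20 : 0 < e / 2 by rewrite divr_gt0.
have [p gp] := eventually0_laplace_approx eg e20.
exists (\sum_(k < size p) p`_k * l k).
have /cvgrPdist_lt/(_ _ e20) := @cvg_laplace_sum p l h.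
apply: filterS2 mY => i [mYi Yi0] hi.
rewrite /ball/= (le_lt_trans
  (ler_distD (\sum_(k < size p) p`_k * laplace P (Y i) k%:R) _ _))//.
by rewrite [ltRHS]splitr ltr_leD// distrC gp.
Qed.

Lemma laplace_cvg d' (T' : measurableType d') (Q : probability T' R)
    (Z : T' -> R) (g : R -> R) :
  eventually0 g -> measurable_fun setT Z -> (forall w, 0 <= Z w) ->
  (forall k : nat, laplace P (Y i) k%:R @[i --> F] --> laplace Q Z k%:R) ->
  Ex P (fun w => g (Y i w)) @[i --> F] --> Ex Q (fun w => g (Z w)).
Proof.
move=> eg mZ Z0 h; apply/cvgrPdist_le => e e0.
have e30 : 0 < e / 3 by rewrite divr_gt0.
have [p gp] := eventually0_laplace_approx eg e30.
have /cvgrPdist_le/(_ _ e30) := @cvg_laplace_sum p _ h.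
apply: filterS2 mY => i [mYi Yi0] hi.
have := gp _ _ P _ mYi Yi0; have := gp _ _ Q _ mZ Z0.
move: hi; rewrite !ler_norml => /andP[? ?] /andP[? ?] /andP[? ?].
apply/andP; split; lra.
Qed.

End cvg.
End laplace.

(** * The tail formula *)

Section tail_formula.
Context {R : realType}.
Local Notation mu := (@lebesgue_measure R).

Definition tailP d (T : measurableType d) (P : probability T R) (Y : T -> R)
  (z : R) : R := fine (P [set w | z < Y w]).

Lemma measurable_gt_set d (T : measurableType d) (Y : T -> R) (z : R) :
  measurable_fun setT Y -> measurable [set w | z < Y w].
Proof.
move=> mY; have := mY measurableT `]z, +oo[%classic (measurable_itv _).
by rewrite setTI; congr measurable; apply/seteqP; split => w /=;
  rewrite in_itv/= andbT.
Qed.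

Lemma measurable_le_set d (T : measurableType d) (Y : T -> R) (z : R) :
  measurable_fun setT Y -> measurable [set w | Y w <= z].
Proof.
move=> mY; have := mY measurableT `]-oo, z]%classic (measurable_itv _).
by rewrite setTI; congr measurable; apply/seteqP; split => w /=;
  rewrite in_itv.
Qed.

Lemma measurable_dist_lt d (T : measurableType d) (Y : T -> R) (y e : R) :
  measurable_fun setT Y -> measurable [set w | `|Y w - y| < e].
Proof.
move=> mY; have := measurable_gt_set (- e) (Y := fun w => - `|Y w - y|).
rewrite (_ : [set w | _] = [set w | `|Y w - y| < e]); last first.
  by apply/seteqP; split => w /=; rewrite ltrN2.
by apply; do 2 apply: measurableT_comp => //; exact: measurable_funB.
Qed.

Lemma tailP_ge0_le1 d (T : measurableType d) (P : probability T R) (Y : T -> R)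
  (z : R) : measurable_fun setT Y -> 0 <= tailP P Y z <= 1.
Proof. by move=> mY; apply: fine_P01; exact: measurable_gt_set. Qed.

Lemma tailP_nincr d (T : measurableType d) (P : probability T R) (Y : T -> R)
  (y z : R) : measurable_fun setT Y -> y <= z -> tailP P Y z <= tailP P Y y.
Proof.
move=> mY yz; apply: fine_P_le; [exact: measurable_gt_set..|].
by move=> w /= ; exact: le_lt_trans.
Qed.

Lemma tailPE d (T : measurableType d) (P : probability T R) (Y : T -> R)
  (z : R) : measurable_fun setT Y ->
  tailP P Y z = 1 - fine (P [set w | Y w <= z]).
Proof.
move=> mY; have mle := measurable_le_set z mY.
rewrite /tailP (_ : [set w | z < Y w] = ~` [set w | Y w <= z]); last first.
  by apply/seteqP; split => w /=; rewrite ltNge => /negP.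
by rewrite probability_setC// fineB// fin_num_measure.
Qed.

Lemma measurable_tailP d (T : measurableType d) (P : probability T R)
  (Y : T -> R) (D : set R) : measurable D -> measurable_fun setT Y ->
  measurable_fun D (tailP P Y).
Proof.
move=> mD mY; apply: measurable_funTS.
apply: (eq_measurable_fun (fun z => - - tailP P Y z)); first by move=> x; rewrite opprK.
apply: measurableT_comp => //; apply: nondecreasing_measurable => // x y xy.
by rewrite lerN2 tailP_nincr.
Qed.

Lemma integral_expRN_lt (y : R) : 0 <= y ->
  (\int[mu]_(z in `]0%R, +oo[) (expR (- z) * (z < y)%R%:R)%:E =
   (1 - expR (- y))%:E)%E.
Proof.
rewrite le_eqVlt => /predU1P[<-|y0].
  rewrite oppr0 expR0 subrr; apply: integral0_eq => z /=.
  by rewrite in_itv/= andbT => z0; rewrite ltNge ltW//= mulr0.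
transitivity (\int[mu]_(z in `]0%R, y[) (expR (- z))%:E)%E.
  rewrite [RHS](_ : _ = \int[mu]_(z in `]0%R, +oo[ `&` `]-oo, y[) (expR (- z))%:E)%E.
    rewrite integral_mkcondr; apply: eq_integral => z _; rewrite patchE.
    by rewrite mem_setE in_itv/=; case: ltP => _; rewrite ?mulr1// mulr0.
  by congr (integral _ _ _); apply/seteqP; split => z /=;
    rewrite !in_itv/= andbT => /andP.
have mexp : measurable_fun setT (fun z : R => (expR (- z))%:E).
  by apply/measurable_EFinP/measurableT_comp => //; exact: measurableT_comp.
rewrite integral_itv_bndo_bndc; last exact: measurable_funTS.
rewrite integral_itv_obnd_cbnd; last exact: measurable_funTS.
have := exponential_prob_itv0c 1 y0.
rewrite mulN1r EFinB => <-; apply: eq_integral => z.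
rewrite inE/= in_itv/= => /andP[z0 _].
by rewrite exponential_pdfE// mul1r mulN1r.
Qed.

(** Fubini: [1 - expR (- Y)] is the integral of [expR (- z)] over [[0, Y[]. *)
Lemma laplace_tail d (T : measurableType d) (P : probability T R) (Y : T -> R) :
  measurable_fun setT Y -> (forall w, 0 <= Y w) ->
  ((1 - laplace P Y 1)%:E =
   \int[mu]_(z in `]0%R, +oo[) (expR (- z) * tailP P Y z)%:E)%E.
Proof.
move=> mY Y0.
have bY : bmf (fun w => expR (- (1 * Y w))) by exact: bmf_laplace.
have -> : 1 - laplace P Y 1 = Ex P (fun w => 1 - expR (- (1 * Y w))).
  by rewrite ExB ?Ex_cst//; exact: bmf_cst.
rewrite EFin_Ex; last by apply: bmfB => //; exact: bmf_cst.
under eq_integral do rewrite mul1r -integral_expRN_lt// integral_mkcond.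
pose f (p : T * R) : \bar R := if (0 < p.2) && (p.2 < Y p.1) then (expR (- p.2))%:E else 0%E.
have f0 p : (0 <= f p)%E by rewrite /f; case: ifP => // _; rewrite lee_fin expR_ge0.
have mf : measurable_fun setT f.
  apply: measurable_fun_ifT => //.
    apply: measurable_and; first exact: measurable_fun_ltr.
    by apply: measurable_fun_ltr => //; exact: measurableT_comp.
  apply/measurable_EFinP/measurableT_comp => //; exact: measurableT_comp.
transitivity (\int[P]_w \int[mu]_z f (w, z))%E.
  apply: eq_integral => w _; apply: eq_integral => z _; rewrite patchE /f/=.
  rewrite mem_setE in_itv/= andbT; case: ltP => //= _.
  by case: ltP => _; rewrite ?mulr1// mulr0.
rewrite fubini_tonelli//= [RHS]integral_mkcond.
apply: eq_integral => z _; rewrite patchE mem_setE in_itv/= andbT /f/=.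
case: ltP => z0 /=; last by rewrite integral0.
rewrite EFinM /tailP fineK; last first.
  by apply: fin_num_measure; exact: measurable_gt_set.
rewrite -[X in (_ * P X)%E]setIT -integral_indic//; last exact: measurable_gt_set.
rewrite -ge0_integralZl_EFin// ?expR_ge0//; last first.
  by apply/measurable_EFinP/measurable_indic/measurable_gt_set.
apply: eq_integral => w _; rewrite indicE; case: ltP => zY.
  by rewrite mem_set//= mule1.
by rewrite memNset/= ?mule0//; apply/negP; rewrite -leNgt.
Qed.

Lemma integrable_expRN :
  mu.-integrable (`]0%R, +oo[ : set R) (EFin \o (fun z : R => expR (- z))).
Proof.
have h : mu.-integrable (`]0%R, +oo[ : set R) (EFin \o exponential_pdf 1).
  by apply: integrableS (@integrable_exponential_pdf R 1 ltr01).
apply: eq_integrable h => // z; rewrite inE/= in_itv/= andbT => /ltW z0.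
by rewrite exponential_pdfE// mul1r mulN1r.
Qed.

(** The events [Z <= z - 1 / (m + 1)] increase to [Z < z], which has the
    probability of [Z <= z] when [z] is not an atom. *)
Lemma cdf_left d (T : measurableType d) (Q : probability T R) (Z : T -> R)
    (z e : R) : measurable_fun setT Z -> Q (Z @^-1` [set z]) = 0%E -> 0 < e ->
  exists m : nat, fine (Q [set w | Z w <= z]) - e <=
    fine (Q [set w | Z w <= z - m.+1%:R^-1]).
Proof.
move=> mZ Qz e0; pose A m := [set w | Z w <= z - m.+1%:R^-1].
have mA m : measurable (A m) by exact: measurable_le_set.
have mz : measurable (Z @^-1` [set z]) by rewrite -[X in measurable X]setTI; exact: mZ.
have cA : Q (A m) @[m --> \oo] --> Q (\bigcup_m A m).
  apply: nondecreasing_cvg_mu => //; first exact: bigcup_measurable.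
  apply/nondecreasing_seqP => m; apply/subsetPset => w; rewrite /A /=.
  by move=> /le_trans; apply; rewrite lerB// lef_pV2 ?posrE// ler_nat.
have UA : \bigcup_m A m = [set w | Z w < z].
  apply/seteqP; split => w; rewrite /A /=.
    by move=> [m _] /= /le_lt_trans; apply; rewrite ltrBlDr ltrDl invr_gt0.
  move=> xz; exists (Num.truncn (z - Z w)^-1) => //=.
  rewrite lerBrDl -lerBrDr invf_ple ?posrE ?subr_gt0//.
  by rewrite ltW// truncnS_gt.
have Qlt : Q [set w | Z w < z] = Q [set w | Z w <= z].
  have -> : [set w | Z w <= z] = [set w | Z w < z] `|` (Z @^-1` [set z]).
    apply/seteqP; split => w /=; rewrite le_eqVlt.
      by move=> /predU1P[->|h]; [right|left].
    by move=> [->|->]; rewrite ?eqxx ?orbT.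
  rewrite measureU//; last 2 first.
  - by rewrite -UA; exact: bigcup_measurable.
  - by apply/seteqP; split => // w [/= + wz]; rewrite wz ltxx.
  by rewrite -[LHS]adde0; congr (_ + _)%E; rewrite -Qz.
have mle := measurable_le_set z mZ.
move: cA; rewrite UA Qlt -[X in _ --> X]fineK ?fin_num_measure//.
move=> /fine_cvg /cvgrPdist_le/(_ _ e0)[m _ /(_ m (leqnn m))] /=.
rewrite ler_norml => /andP[_ h]; exists m.
by rewrite lerBlDr -lerBlDl.
Qed.

Lemma cdf_right d (T : measurableType d) (Q : probability T R) (Z : T -> R)
    (z e : R) : measurable_fun setT Z -> 0 < e ->
  exists m : nat, fine (Q [set w | Z w <= z + m.+1%:R^-1]) <=
    fine (Q [set w | Z w <= z]) + e.
Proof.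
move=> mZ e0; pose A m := [set w | Z w <= z + m.+1%:R^-1].
have mA m : measurable (A m) by exact: measurable_le_set.
have IA : \bigcap_m A m = [set w | Z w <= z].
  apply/seteqP; split => w; rewrite /A /=; last first.
    by move=> /le_trans h m _ /=; apply: h; rewrite lerDl.
  move=> h; rewrite leNgt; apply/negP => zw.
  have := h (Num.truncn (Z w - z)^-1) I; rewrite /= leNgt => /negP; apply.
  rewrite -ltrBrDl invf_plt ?posrE ?subr_gt0//.
  by rewrite truncnS_gt.
have cA : Q (A m) @[m --> \oo] --> Q [set w | Z w <= z].
  rewrite -IA; apply: nonincreasing_cvg_mu => //.
  - by rewrite (le_lt_trans (probability_le1 _ _))// ltry.
  - by rewrite IA; exact: measurable_le_set.
  - apply/nonincreasing_seqP => m; apply/subsetPset => w; rewrite /A /=.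
    by move=> /le_trans; apply; rewrite lerD2l lef_pV2 ?posrE// ler_nat.
have mle := measurable_le_set z mZ.
move: cA; rewrite -[X in _ --> X]fineK ?fin_num_measure//.
move=> /fine_cvg /cvgrPdist_le/(_ _ e0)[m _ /(_ m (leqnn m))] /=.
rewrite ler_norml => /andP[h _]; exists m.
by rewrite -lerBlDl; move: h; rewrite lerNl opprB.
Qed.

Lemma cdf_continuous d (T : measurableType d) (Q : probability T R) (Z : T -> R)
    (z : R) : measurable_fun setT Z -> Q (Z @^-1` [set z]) = 0%E ->
  {for z, continuous (fun y : R => Q [set w | Z w <= y])}.
Proof.
move=> mZ Qz; have mle y := measurable_le_set y mZ.
have fin y : Q [set w | Z w <= y] \is a fin_num by exact: fin_num_measure.
suff h : fine (Q [set w | Z w <= y]) @[y --> z] --> fine (Q [set w | Z w <= z]).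
  have {}h := cvg_EFin (nearW _ fin) h.
  by rewrite fineK in h => //; exact: h.
apply/cvgrPdist_le => e e0.
have [m hm] := cdf_left mZ Qz e0; have [k hk] := cdf_right Q z mZ e0.
near=> y; have my : z - m.+1%:R^-1 <= y.
  by near: y; apply: lt_le_nbhsr; rewrite ltrBlDr ltrDl invr_gt0.
have yk : y <= z + k.+1%:R^-1.
  by near: y; apply: lt_le_nbhsl; rewrite ltrDl invr_gt0.
have h1 : fine (Q [set w | Z w <= z - m.+1%:R^-1]) <= fine (Q [set w | Z w <= y]).
  by apply: fine_P_le => // w /= h; exact: le_trans h my.
have h2 : fine (Q [set w | Z w <= y]) <= fine (Q [set w | Z w <= z + k.+1%:R^-1]).
  by apply: fine_P_le => // w /= h; exact: le_trans h yk.
rewrite ler_norml /=; apply/andP; split; lra.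
Unshelve. all: by end_near. Qed.

(** Convergence of the distribution functions off the countable set of atoms of
    the limit suffices, since the tail formula integrates against Lebesgue
    measure. *)
Lemma cdf_cvg_laplace1 d (T : measurableType d) (P : probability T R)
    d' (T' : measurableType d') (Q : probability T' R)
    (Y : nat -> T -> R) (Z : {RV Q >-> R}) :
  (forall n, measurable_fun setT (Y n)) -> (forall n w, 0 <= Y n w) ->
  (forall w, 0 <= Z w) ->
  (forall z, 0 < z -> Q (Z @^-1` [set z]) = 0%E ->
     tailP P (Y n) z @[n --> \oo] --> tailP Q Z z) ->
  laplace P (Y n) 1 @[n --> \oo] --> laplace Q Z 1.
Proof.
move=> mY Y0 Z0 YZ; have mZ : measurable_fun setT Z by [].
suff : 1 - laplace P (Y n) 1 @[n --> \oo] --> 1 - laplace Q Z 1.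
  have subK (x : R) : x = 1 - (1 - x) by rewrite opprB addrC subrK.
  move=> h; rewrite [X in _ --> X]subK.
  by under eq_fun do rewrite [laplace _ _ _]subK; apply: cvgB => //; exact: cvg_cst.
have mexp : measurable_fun (`]0%R, +oo[ : set R) (fun z : R => expR (- z)).
  by apply: measurable_funTS; apply: measurableT_comp => //; exact: measurableT_comp.
have [||||| _ _] := @dominated_convergence _ _ R mu (`]0%R, +oo[ : set R)
  (measurable_itv _) (fun n z => (expR (- z) * tailP P (Y n) z)%:E)
  (fun z => (expR (- z) * tailP Q Z z)%:E) (EFin \o (fun z : R => expR (- z))).
- move=> n; apply/measurable_EFinP/measurable_funM => //.
  exact: measurable_tailP.
- by apply/measurable_EFinP/measurable_funM => //; exact: measurable_tailP.
- exists [set z | 0 < pmf Z z]; split.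
  + by apply: countable_measurable => //; exact: pmf_gt0_countable.
  + by apply: countable_lebesgue_measure0; exact: pmf_gt0_countable.
  move=> z; apply: contra_notP => /negP; rewrite -leNgt => pz.
  rewrite /= in_itv/= andbT => z0.
  apply: cvg_EFin; first exact: nearW.
  apply: cvgM; first exact: cvg_cst.
  apply: YZ => //; apply/eqP; rewrite eq_le measure_ge0 andbT.
  by rewrite -[leLHS]fineK// fin_num_measure.
- exact: integrable_expRN.
- apply: aeW => z n _; rewrite lee_fin.
  have /andP[t0 t1] := tailP_ge0_le1 P z (mY n).
  by rewrite ger0_norm ?mulr_ge0 ?expR_ge0// ler_piMr ?expR_ge0.
rewrite -laplace_tail//.
under eq_fun do rewrite -laplace_tail//.
by move=> /fine_cvg.
Qed.

(** The parameter [r] is absorbed by rescaling the variables. *)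
Lemma cdf_cvg_laplace d (T : measurableType d) (P : probability T R)
    d' (T' : measurableType d') (Q : probability T' R)
    (Y : nat -> T -> R) (Z : {RV Q >-> R}) (r : R) : 0 <= r ->
  (forall n, measurable_fun setT (Y n)) -> (forall n w, 0 <= Y n w) ->
  (forall w, 0 <= Z w) ->
  (forall z, 0 < z -> Q (Z @^-1` [set z]) = 0%E ->
     tailP P (Y n) z @[n --> \oo] --> tailP Q Z z) ->
  laplace P (Y n) r @[n --> \oo] --> laplace Q Z r.
Proof.
rewrite le_eqVlt => /predU1P[<-|r0] mY Y0 Z0 YZ.
  have L0 d0 (T0 : measurableType d0) (P0 : probability T0 R) (V : T0 -> R) :
      laplace P0 V 0 = 1.
    rewrite /laplace -[RHS](Ex_cst P0); apply: eq_Ex => w.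
    by rewrite mul0r oppr0 expR0.
  by under eq_fun do rewrite L0; rewrite L0; exact: cvg_cst.
have mrZ : measurable_fun setT (fun w => r * Z w) by exact: measurable_funM.
pose rZ : {RV Q >-> R} := HB.pack (fun w => r * Z w) (isMeasurableFun.Build _ _ _ _ _ mrZ).
have L1 d0 (T0 : measurableType d0) (P0 : probability T0 R) (V : T0 -> R) :
    laplace P0 V r = laplace P0 (fun w => r * V w) 1.
  by apply: eq_Ex => w; rewrite mul1r.
have tr d0 (T0 : measurableType d0) (P0 : probability T0 R) (V : T0 -> R) z :
    tailP P0 (fun w => r * V w) z = tailP P0 V (z / r).
  by congr (fine (P0 _)); apply/seteqP; split => w /=; rewrite ltr_pdivrMr// mulrC.
rewrite L1; under eq_fun do rewrite L1.
apply: (@cdf_cvg_laplace1 _ _ _ _ _ _ _ rZ).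
- by move=> n; exact: measurable_funM.
- by move=> n w; rewrite mulr_ge0// ltW.
- by move=> w; rewrite /= mulr_ge0// ltW.
move=> z z0 Qz; rewrite tr; under eq_fun do rewrite tr.
apply: YZ; first by rewrite divr_gt0.
rewrite -Qz; congr (Q _); apply/seteqP; split => w /=.
  by move=> ->; rewrite mulrC divfK// gt_eqF.
by move=> <-; rewrite mulrAC divff ?mul1r// gt_eqF.
Qed.

End tail_formula.

(** * A mapping theorem *)

Section mapping.
Context {R : realType}.

(** An approximation, increasing with [n], of the indicator of [a < y] by
    continuous functions with compact support. *)
Definition trapezoid (a : R) n (y : R) : R :=
  Num.max 0 (Num.min 1 (Num.min ((y - a) * n.+1%:R - 1) (n%:R - y))).

Lemma trapezoid01 a n y : 0 <= trapezoid a n y <= 1.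
Proof. by rewrite /trapezoid le_max lexx/= ge_max ler01/= ge_min lexx. Qed.

Lemma trapezoid_low a n y : (y - a) * n.+1%:R <= 1 -> trapezoid a n y = 0.
Proof.
move=> h; apply/max_idPl; rewrite ge_min; apply/orP; right.
by rewrite ge_min subr_le0 h.
Qed.

Lemma trapezoid_high a n y : n%:R <= y -> trapezoid a n y = 0.
Proof.
move=> h; apply/max_idPl; rewrite ge_min; apply/orP; right.
by rewrite ge_min [X in _ || X]subr_le0 h orbT.
Qed.

Lemma continuous_trapezoid a n : continuous (trapezoid a n).
Proof.
move=> y; apply: (@continuous_max _ _ (fun=> 0) (fun y => Num.min 1
  (Num.min ((y - a) * n.+1%:R - 1) (n%:R - y)))); first exact: cvg_cst.
apply: (@continuous_min _ _ (fun=> 1)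
  (fun y => Num.min ((y - a) * n.+1%:R - 1) (n%:R - y))); first exact: cvg_cst.
apply: (@continuous_min _ _ (fun y => (y - a) * n.+1%:R - 1)
  (fun y => n%:R - y)).
  apply: cvgB; last exact: cvg_cst.
  by apply: cvgM; [apply: cvgB => //; exact: cvg_cst|exact: cvg_cst].
by apply: cvgB => //; exact: cvg_cst.
Qed.

Lemma eventually0_trapezoid a n : eventually0 (trapezoid a n).
Proof.
split; first exact: continuous_trapezoid.
by exists n%:R => y; exact: trapezoid_high.
Qed.

Lemma trapezoid_cvg a y : a < y -> trapezoid a n y @[n --> \oo] --> (1 : R).
Proof.
move=> ay; apply/cvgrPdist_le => e e0; near=> n.
suff -> : trapezoid a n y = 1 by rewrite subrr normr0 ltW.
rewrite /trapezoid [Num.min 1 _]min_l ?max_r//.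
have ya : 0 < y - a by rewrite subr_gt0.
rewrite le_min lerBrDr -ler_pdivrMl// mulrC lerBrDr; apply/andP; split.
  rewrite -natr1 (@le_trans _ _ n%:R)// ?lerDl//.
  by near: n; exact: nbhs_infty_ger.
by near: n; exact: nbhs_infty_ger.
Unshelve. all: by end_near. Qed.

Lemma continuous_trapezoidM a n (psi : R -> R) :
  (forall y, a < y -> {for y, continuous psi}) ->
  continuous (fun y => trapezoid a n y * psi y).
Proof.
move=> cpsi y; have [ay|ya] := ltP a y.
  by apply: cvgM; [exact: continuous_trapezoid|exact: cpsi].
have n0 : 0 < n.+1%:R :> R by rewrite ltr0n.
have near0 : \forall z \near y, trapezoid a n z * psi z = 0.
  have : \forall z \near y, z < a + n.+1%:R^-1.
    by apply: lt_nbhsl; rewrite ltr_pwDr// invr_gt0.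
  apply: filterS => z za; rewrite trapezoid_low ?mul0r//.
  by rewrite -ler_pdivlMr// mul1r lerBlDl ltW.
rewrite /continuous_at (nbhs_singleton near0).
by apply: cvg_near_cst; exact: near0.
Qed.

Lemma fine_P_setI1 d (T : measurableType d) (P : probability T R)
    (B E : set T) : measurable B -> measurable E -> P B = 1%E ->
  fine (P (B `&` E)) = fine (P E).
Proof.
move=> mB mE PB1; apply/eqP; rewrite eq_le fine_P_le//=; last exact: measurableI.
have mBC := measurableC mB.
have PBC : P (~` B) = 0%E.
  have := probability_setC P mB; rewrite PB1 -[(1 - 1)%E]/((1 - 1)%:E) subrr; exact.
rewrite fine_le ?fin_num_measure//; first exact: measurableI.
apply: (@le_trans _ _ (P ((B `&` E) `|` ~` B))).
  apply: le_measure; rewrite ?inE//.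
    by apply: measurableU => //; exact: measurableI.
  by move=> w Ew; have [Bw|Bw] := pselect (B w); [left|right].
rewrite (le_trans (measureU2 _ _ _))//; first exact: measurableI.
by rewrite -[leRHS]adde0 leeD2l// le_eqVlt; apply/orP; left; apply/eqP.
Qed.

(** If [Y i] converges in law to [Z] and [W i] to the constant [w0], then [G i]
    converges in mean to [psi Z] as soon as [G i] is close to [psi y] whenever
    [Y i] is close to [y] and [W i] to [w0].  Compactness makes this uniform in
    [y], for [y] in the support of a trapezoid; the levels are all above [a],
    like the values of [Z]. *)
Lemma mapping_cvg {I : Type} {F : set_system I} {FF : ProperFilter F}
    d (T : measurableType d) (P : probability T R) (Y G : I -> T -> R)
    d' (T' : measurableType d') (Q : probability T' R) (Z : T' -> R)
    (psi : R -> R) (a : R)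
    (W : I -> T -> R) (w0 : R) (B : set T) :
  (\forall i \near F, measurable_fun setT (Y i) /\ (forall w, 0 <= Y i w)) ->
  measurable_fun setT Z -> (forall w, 0 <= Z w) ->
  {ae Q, forall w, a < Z w} ->
  (forall g : R -> R, eventually0 g ->
    Ex P (fun w => g (Y i w)) @[i --> F] --> Ex Q (fun w => g (Z w))) ->
  (\forall i \near F, measurable_fun setT (G i) /\ (forall w, 0 <= G i w <= 1)) ->
  measurable_fun setT (fun w => psi (Z w)) -> (forall y, 0 <= psi y <= 1) ->
  (forall y, a < y -> {for y, continuous psi}) ->
  measurable B -> P B = 1%E -> (\forall i \near F, measurable_fun setT (W i)) ->
  (forall eta : R, 0 < eta ->
    fine (P [set w | `|W i w - w0| < eta]) @[i --> F] --> (1 : R)) ->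
  (forall e y : R, 0 < e -> a < y ->
    \forall y' \near y & j \near filter_prod (nbhs w0) F,
      forall w, B w -> W j.2 w = j.1 -> Y j.2 w = y' ->
      `|G j.2 w - psi y'| <= e) ->
  Ex P (G i) @[i --> F] --> Ex Q (fun w => psi (Z w)).
Proof.
move=> mY mZ Z0 aZ YZ mG mpsi psi01 cpsi mB PB1 mW cW closeG.
have bpsi : bmf (fun w => psi (Z w)) by exact: bmf01.
have bchi n : bmf (fun w => trapezoid a n (Z w)).
  by apply: bmf_eventually0 => //; exact: eventually0_trapezoid.
apply/cvgrPdist_le => e e0; have e60 : 0 < e / 6 by rewrite divr_gt0.
have [n chin] : exists n, 1 - e / 6 <= Ex Q (fun w => trapezoid a n (Z w)).
  have : Ex Q (fun w => trapezoid a n (Z w)) @[n --> \oo] --> (1 : R).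
    rewrite -[X in _ --> X](Ex_cst Q (1 : R)); apply: (@Ex_cvg _ _ _ _ _ _ 1).
    - by move=> n; case: (bchi n).
    - exact: measurable_cst.
    - move=> n w; have /andP[c0 c1] := trapezoid01 a n (Z w).
      by rewrite ger0_norm.
    - by apply: filterS aZ => w; exact: trapezoid_cvg.
  move=> /cvgrPdist_le/(_ _ e60)[n _ /(_ n (leqnn n))/=].
  by rewrite ler_distl -lerBlDr => /andP[_ ?]; exists n.
(* localize to a compact subset of the levels above [a], at a cost of [e / 6] *)
pose chi := trapezoid a n; pose g y := chi y * psi y.
have eg : eventually0 g.
  split; first exact: continuous_trapezoidM.
  by exists n%:R => y ny; rewrite /g /chi trapezoid_high// mul0r.
have n0 : 0 < n.+1%:R :> R by rewrite ltr0n.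
pose K := `[a + n.+1%:R^-1, n%:R]%classic : set R.
have GK : \forall j \near filter_prod (nbhs w0) F, K `<=` [set y' | forall w,
    B w -> W j.2 w = j.1 -> Y j.2 w = y' -> `|G j.2 w - psi y'| <= e / 6].
  have /compact_near_coveringP := @segment_compact R (a + n.+1%:R^-1) n%:R.
  apply => y; rewrite /= in_itv/= => /andP[ay _].
  by apply: closeG => //; rewrite (lt_le_trans _ ay)// ltrDl invr_gt0.
(* one neighbourhood of [w0] serves for all levels in the compact set *)
have [[U1 U2] [/= /nbhs_ballP[eta /= eta0 etaU] FU2] UK] := GK.
(* off this event, of probability close to 1, the integrands are only known to
   lie in the unit interval *)
pose A i := B `&` [set w | `|W i w - w0| < eta].
have /cvgrPdist_le/(_ _ e60) PA := cW _ eta0.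
have /cvgrPdist_le/(_ _ e60) cg := YZ _ eg.
have /cvgrPdist_le/(_ _ e60) cchi := YZ _ (eventually0_trapezoid a n).
near=> i.
have [mYi Yi0] : measurable_fun setT (Y i) /\ (forall w, 0 <= Y i w) by near: i.
have [mGi Gi01] : measurable_fun setT (G i) /\ (forall w, 0 <= G i w <= 1).
  by near: i.
have mWi : measurable_fun setT (W i) by near: i.
have mAi : measurable (A i) by apply: measurableI => //; exact: measurable_dist_lt.
have GKi : K `<=` [set y' | forall w, A i w -> Y i w = y' ->
    `|G i w - psi y'| <= e / 6].
  have FU2i : U2 i by near: i.
  move=> y Ky w [Bw Wi] Yi; apply: (UK (W i w, i)) => //=; split => //=.
  by apply: etaU; rewrite /ball/= distrC.
have bG : bmf (G i) by exact: bmf01.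
have bgY : bmf (fun w => g (Y i w)) by exact: bmf_eventually0.
have bgZ : bmf (fun w => g (Z w)) by exact: bmf_eventually0.
have bchiY : bmf (fun w => chi (Y i w)).
  by apply: bmf_eventually0 => //; exact: eventually0_trapezoid.
have bchiZ : bmf (fun w => chi (Z w)) := bchi n.
have b1 d0 (T0 : measurableType d0) : bmf ((fun=> 1) : T0 -> R) by exact: bmf_cst.
have bA : bmf (\1_(~` A i) : T -> R) by apply: bmf_indic; exact: measurableC.
have h1 : `|Ex Q (fun w => psi (Z w)) - Ex Q (fun w => g (Z w))| <=
    1 - Ex Q (fun w => chi (Z w)).
  have -> : 1 - Ex Q (fun w => chi (Z w)) = Ex Q (fun w => 1 - chi (Z w)).
    by rewrite ExB ?Ex_cst//; exact: bmf_cst.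
  apply: Ex_dist => //; first exact: bmfB.
  move=> w; rewrite /g -[X in `|X - _|]mul1r -mulrBl normrM.
  have /andP[c0 c1] := trapezoid01 a n (Z w); have /andP[p0 p1] := psi01 (Z w).
  by rewrite !ger0_norm ?subr_ge0// ler_piMr// subr_ge0.
have h2 : `|Ex P (G i) - Ex P (fun w => g (Y i w))| <=
    e / 6 + fine (P (~` A i)) + (1 - Ex P (fun w => chi (Y i w))).
  have -> : e / 6 + fine (P (~` A i)) + (1 - Ex P (fun w => chi (Y i w))) =
      Ex P (fun w => e / 6 + \1_(~` A i) w + (1 - chi (Y i w))).
    rewrite -(@Ex_cst _ _ _ P (e / 6)) -Ex_indic; last exact: measurableC.
    rewrite -(@ExD _ _ _ _ (fun=> e / 6))//; last exact: bmf_cst.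
    rewrite -[X in X - Ex P (fun w => chi _)](Ex_cst P) -ExB// -ExD ?Ex_cst//.
      by apply: bmfD => //; exact: bmf_cst.
    exact: bmfB.
  apply: Ex_dist => //.
    by apply: bmfD; [apply: bmfD => //; exact: bmf_cst|exact: bmfB].
  move=> w; have /andP[G0 G1] := Gi01 w; have /andP[p0 p1] := psi01 (Y i w).
  have /andP[c0 c1] := trapezoid01 a n (Y i w).
  have /andP[g0 g1] : 0 <= g (Y i w) <= 1.
    by rewrite mulr_ge0//= mulr_ile1.
  have e6 := ltW e60.
  rewrite indicE; have [wA|wA] := pselect (A i w); last first.
    rewrite mem_set// ler_norml (_ : true%:R = 1 :> R)//.
    by rewrite /chi; apply/andP; split; lra.
  rewrite memNset; last by move=> /(_ wA).
  rewrite addr0; have [YK|YK] := pselect (K (Y i w)); last first.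
    have -> : chi (Y i w) = 0.
      move/negP : YK; rewrite /K /= in_itv/= negb_and -!ltNge => /orP[h|h].
        rewrite /chi trapezoid_low// -ler_pdivlMr// mul1r lerBlDl ltW//.
      by rewrite /chi trapezoid_high// ltW.
    by rewrite ler_norml; apply/andP; split; lra.
  have := GKi _ YK _ wA erefl; rewrite !ler_norml => /andP[? ?].
  have d0 : 0 <= psi (Y i w) - g (Y i w).
    by rewrite /g -[X in X - _]mul1r -mulrBl mulr_ge0// subr_ge0.
  have d1 : psi (Y i w) - g (Y i w) <= 1 - chi (Y i w).
    by rewrite /g -[X in X - _]mul1r -mulrBl ler_piMr// subr_ge0.
  by apply/andP; split; move: c1; rewrite -/chi; lra.
have h3 : `|Ex Q (fun w => g (Z w)) - Ex P (fun w => g (Y i w))| <= e / 6.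
  by near: i.
have h4 : `|Ex Q (fun w => chi (Z w)) - Ex P (fun w => chi (Y i w))| <= e / 6.
  by near: i.
have h5 : `|1 - fine (P (A i))| <= e / 6.
  by rewrite fine_P_setI1//; [near: i|exact: measurable_dist_lt].
have h6 : fine (P (~` A i)) = 1 - fine (P (A i)).
  by rewrite probability_setC// fineB// fin_num_measure.
move: h1 h2 h3 h4 h5; rewrite h6 /chi !ler_norml.
move=> /andP[? ?] /andP[? ?] /andP[? ?] /andP[? ?] /andP[? ?].
by apply/andP; split; lra.
Unshelve. all: by end_near. Qed.

End mapping.

(** * Independence *)

Section independence.
Context {R : realType} d {T : measurableType d} (P : probability T R).

Lemma Ex_prod_indic (I : eqType) (X : I -> T -> R) (J : seq I)
    (A : I -> set R) :
  mutually_independent P X -> (forall i, measurable_fun setT (X i)) ->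
  (forall i, measurable (A i)) -> uniq J ->
  Ex P (fun w => \prod_(i <- J) \1_(A i) (X i w)) =
  \prod_(i <- J) Ex P (fun w => \1_(A i) (X i w)).
Proof.
move=> indX mX mA uJ.
have mXA i : measurable (X i @^-1` A i) by rewrite -[X in measurable X]setTI; exact: mX.
have prodE w : \prod_(i <- J) \1_(A i) (X i w) =
    \1_(\big[setI/setT]_(i <- J) (X i @^-1` A i)) w :> R.
  elim: (J) => [|i s IH]; first by rewrite !big_nil indicT.
  by rewrite !big_cons IH indicI.
rewrite (eq_Ex P prodE) Ex_indic; last exact: bigsetI_measurable.
rewrite indX// (eq_bigr (fun i => (Ex P (fun w => \1_(A i) (X i w)))%:E)).
  by rewrite prodEFin.
by move=> i _; rewrite Ex_indic_comp// fineK// fin_num_measure.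
Qed.

(** Indicators are replaced by [h] one factor at a time: with the other factors
    frozen, both sides are finite measures in the remaining set. *)
Lemma Ex_prod (I : eqType) (X : I -> T -> R) (J : seq I) (h : R -> R) :
  mutually_independent P X -> (forall i, measurable_fun setT (X i)) ->
  measurable_fun setT h -> (forall y, 0 <= h y <= 1) -> uniq J ->
  Ex P (fun w => \prod_(i <- J) h (X i w)) =
  \prod_(i <- J) Ex P (fun w => h (X i w)).
Proof.
move=> indX mX mh h01 uJ; have bh := bmf01 mh h01.
have bhX i : bmf (fun w => h (X i w)) by exact: bmf_comp.
suff H (J1 J2 : seq I) (A : I -> set R) : uniq (J1 ++ J2) ->
    (forall i, measurable (A i)) ->
    Ex P (fun w => (\prod_(i <- J1) h (X i w)) *
                   \prod_(i <- J2) \1_(A i) (X i w)) =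
    (\prod_(i <- J1) Ex P (fun w => h (X i w))) *
    \prod_(i <- J2) Ex P (fun w => \1_(A i) (X i w)).
  have := H J [::] (fun=> setT); rewrite cats0 big_nil mulr1 => <- //.
  by apply: eq_Ex => w; rewrite big_nil mulr1.
elim: J1 J2 A => [|i J1 IH] J2 A /=.
  move=> uJ2 mA; rewrite big_nil mul1r -(Ex_prod_indic indX)//.
  by apply: eq_Ex => w; rewrite big_nil mul1r.
move=> /andP[iJ uJ12] mA.
have iJ2 : i \notin J2 by move: iJ; rewrite mem_cat => /norP[].
have b1 (B : I -> set R) : (forall i, measurable (B i)) ->
    forall k, bmf (fun w => \1_(B k) (X k w) : R).
  by move=> mB k; apply: bmf_comp => //; exact: bmf_indic.
pose G w := (\prod_(k <- J1) h (X k w)) * \prod_(k <- J2) \1_(A k) (X k w).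
pose c := (\prod_(k <- J1) Ex P (fun w => h (X k w))) *
    \prod_(k <- J2) Ex P (fun w => \1_(A k) (X k w)).
have bG : bmf G.
  by apply: bmfM; apply: bmf_prod => // k; exact: b1.
transitivity (Ex P (fun w => G w * h (X i w))).
  by apply: eq_Ex => w; rewrite big_cons /G; ring.
rewrite (@eq_Ex_weighted _ _ _ _ _ _ _ P P G (fun=> c) (X i) (X i) h)//.
- by rewrite ExZ// big_cons /c; ring.
- exact: bmf_cst.
move=> B mB; pose A' k := if k == i then B else A k.
have mA' k : measurable (A' k) by rewrite /A'; case: ifP.
have := IH (i :: J2) A'.
rewrite -cat1s uniq_catCA /= iJ uJ12 => /(_ isT mA').
have A'i : A' i = B by rewrite /A' eqxx.
have A'J2 k : k \in J2 -> A' k = A k.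
  by move=> kJ; rewrite /A'; case: eqP => // ki; rewrite -ki kJ in iJ2.
rewrite big_cons A'i ExZ; last exact: bmf_comp (bmf_indic mB) (mX i).
have -> : \prod_(k <- J2) Ex P (fun w => \1_(A' k) (X k w)) =
    \prod_(k <- J2) Ex P (fun w => \1_(A k) (X k w)).
  by apply: eq_big_seq => k kJ /=; rewrite A'J2.
have eJ2 w : \prod_(k <- J2) \1_(A' k) (X k w) =
    \prod_(k <- J2) \1_(A k) (X k w) :> R.
  by apply: eq_big_seq => k kJ /=; rewrite A'J2.
move=> e; rewrite /c mulrAC -mulrA -e; apply: eq_Ex => w.
by rewrite big_cons A'i eJ2 /G; ring.
Qed.

(** The space is cut into the countably many events [N = n]. *)
Lemma prob_random_index (N : T -> nat) (B : nat -> set T) :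
  measurable_fun setT N -> (forall n, measurable (B n)) ->
  (forall n, P (N @^-1` [set n] `&` B n) = (P (N @^-1` [set n]) * P (B n))%E) ->
  measurable [set w | B (N w) w] /\
  fine (P [set w | B (N w) w]) = Ex P (fun w => fine (P (B (N w)))).
Proof.
move=> mN mB indNB.
have mNn n : measurable (N @^-1` [set n]).
  by rewrite -[X in measurable X]setTI; exact: mN.
have E : [set w | B (N w) w] = \bigcup_n (N @^-1` [set n] `&` B n).
  apply/seteqP; split => w /=; first by move=> Bw; exists (N w).
  by move=> [n _ [/= -> ]].
have mNB n : measurable (N @^-1` [set n] `&` B n) by exact: measurableI.
split; first by rewrite E; exact: bigcup_measurable.
have K01 n : 0 <= fine (P (B n)) <= 1 by exact: fine_P01.
have mK : measurable_fun setT (fun w => fine (P (B (N w)))).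
  by apply: (@measurableT_comp _ _ _ _ _ _ (fun n => fine (P (B n)))).
have dN : trivIset setT (fun n => N @^-1` [set n]).
  by apply/trivIsetP => i j _ _ ij; apply/seteqP; split => // w [/= -> /eqP]; rewrite (negbTE ij).
congr fine; rewrite E measure_semi_bigcup//; last 2 first.
- apply/trivIsetP => i j _ _ ij; apply/seteqP; split => // w [[/= -> _] [/eqP]].
  by rewrite (negbTE ij).
- by apply: bigcup_measurable.
have -> : [set: T] = \bigcup_n (N @^-1` [set n]).
  by apply/seteqP; split => // w _; exists (N w).
rewrite ge0_integral_bigcup//; last 2 first.
- by apply/measurable_EFinP; exact: measurable_funTS.
- by move=> w _; rewrite lee_fin; case/andP: (K01 (N w)).
apply: eq_eseriesr => n _; rewrite [LHS](indNB n).
rewrite (eq_integral (fun=> (fine (P (B n)))%:E)); last first.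
  by move=> w; rewrite inE/= => ->.
by rewrite integral_cst// fineK ?fin_num_measure// muleC.
Qed.

End independence.

Lemma measurable_inv (R : realType) : measurable_fun setT (@GRing.inv R).
Proof.
have -> : [set: R] = [set 0] `|` ~` [set 0] by rewrite setUv.
apply/measurable_funU => //; first exact: measurableC.
split; first exact: measurable_fun_set1.
apply: open_continuous_measurable_fun.
  by apply: closed_openC; exact: closed_eq.
by move=> x; rewrite inE => /= /eqP x0; exact: inv_continuous.
Qed.

Lemma measurable_sample_CoVar (R : realType) d (T : measurableType d)
    (X : nat -> T -> R) n : (forall i, measurable_fun setT (X i)) ->
  measurable_fun setT (fun w => sample_CoVar (fun i => X i w) n).
Proof.
move=> mX; rewrite /sample_CoVar /sample_variance.
have msum (F : nat -> T -> R) : (forall i, measurable_fun setT (F i)) ->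
    measurable_fun setT (fun w => \sum_(i < n) F i w).
  by move=> mF; exact: measurable_sum.
have mmean : measurable_fun setT (fun w => sample_mean (fun i => X i w) n).
  by apply: measurable_funM => //; exact: msum.
apply: measurable_funM; last by apply: measurableT_comp => //; exact: measurable_inv.
apply: measurableT_comp.
  by apply: continuous_measurable_fun; exact: sqrt_continuous.
apply: measurable_funM => //.
apply: (msum (fun i w => (X i w - sample_mean (fun i => X i w) n) ^+ 2)) => i.
by apply: measurable_funX; exact: measurable_funB.
Qed.

(** The statistic is measurable for the sigma-algebra generated by the
    observations alone, to which the independence hypothesis applies. *)
Lemma indep_CoVar (R : realType) d (T : measurableType d) (P : probability T R)
    (X : nat -> T -> R) (N : R -> T -> nat) (t : R) (n : nat) (B : set R) :
  independent_systems P (generated_sigma_algebra [set t : R | 0 <= t] N)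
    (generated_sigma_algebra [set: nat] X) ->
  0 <= t -> measurable B ->
  P (N t @^-1` [set n] `&` (fun w => sample_CoVar (fun i => X i w) n) @^-1` B) =
  (P (N t @^-1` [set n]) *
   P ((fun w => sample_CoVar (fun i => X i w) n) @^-1` B))%E.
Proof.
move=> ind t0 mB; apply: ind.
  apply: sub_sigma_algebra; exists t => //=.
  by exists [set n] => //; rewrite setTI.
pose G := \bigcup_(i in [set: nat]) preimage_set_system setT (X i) measurable.
have mX i : measurable_fun (setT : set (g_sigma_algebraType G)) (X i).
  move=> _ A mA; apply: sub_sigma_algebra; exists i => //; exists A => //.
have := @measurable_sample_CoVar R _ (g_sigma_algebraType G) X n mX.
by move=> /(_ measurableT B mB); rewrite setTI.
Qed.

(** * Regularly varying tails *)

Lemma cvg_powRN_pinfty (R : realType) (q : R) : 0 < q ->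
  x `^ (- q) @[x --> +oo] --> (0 : R).
Proof.
move=> q0; apply/cvgrPdist_le => e e0; near=> x.
have x0 : e `^ (- q^-1) <= x.
  by near: x; apply: nbhs_pinfty_ge; exact: num_real.
have xp : 0 < x by rewrite (lt_le_trans _ x0)// powR_gt0.
rewrite sub0r normrN ger0_norm ?powR_ge0// powRN.
rewrite invf_ple ?posrE ?powR_gt0//.
have -> : e^-1 = (e `^ (- q^-1)) `^ q.
  by rewrite -powRrM mulNr mulVf ?gt_eqF// powR_inv1// ltW.
by apply: ge0_ler_powR; rewrite ?nnegrE ?powR_ge0 ?(ltW q0) ?(ltW xp).
Unshelve. all: by end_near. Qed.

Section regular_variation.
Context {R : realType}.
Variables (G : R -> R) (alpha : R).
Hypothesis G01 : forall x, 0 <= G x <= 1.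
Hypothesis Gnincr : forall x y, x <= y -> G y <= G x.
Hypothesis Gpos : \forall x \near +oo, 0 < G x.
Hypothesis Grv : forall c : R, 0 < c -> G (c * x) / G x @[x --> +oo] --> c `^ (- alpha).
Hypothesis alpha0 : 0 < alpha.

Lemma two_powR_gt1 (p : R) : 0 < p -> 1 < 2 `^ p :> R.
Proof.
by move=> p0; rewrite /powR pnatr_eq0/= expR_gt1 mulr_gt0// ln_gt0// ltr1n.
Qed.

Lemma powR_inv (y p : R) : 0 <= y -> y^-1 `^ p = y `^ (- p).
Proof. by move=> y0; rewrite -powR_inv1// -powRrM mulN1r. Qed.

Lemma ltr_powR2 (p q : R) : p < q -> 2 `^ p < 2 `^ q :> R.
Proof.
move=> pq; rewrite -[q](subrK p) powRD; last by apply/implyP => _; rewrite pnatr_eq0.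
by rewrite ltr_pMl ?powR_gt0// two_powR_gt1// subr_gt0.
Qed.

Lemma near_ge (Q : R -> Prop) : (\forall x \near +oo, Q x) ->
  exists2 x0 : R, 1 <= x0 & forall x, x0 <= x -> Q x.
Proof.
move=> [M [_ MQ]]; exists (Num.max 1 (M + 1)); first by rewrite le_max lexx.
move=> x; rewrite ge_max => /andP[_ Mx]; apply: MQ.
by rewrite (lt_le_trans _ Mx)// ltrDl.
Qed.

Lemma tail_doubling_ge (p : R) : alpha < p ->
  exists2 x0 : R, 1 <= x0 & forall x, x0 <= x ->
    0 < G x /\ G x <= 2 `^ p * G (2 * x).
Proof.
move=> ap; apply: near_ge.
have h2 : 2 `^ (- p) < 2 `^ (- alpha) :> R by rewrite ltr_powR2// ltrN2.
have : \forall x \near +oo, 2 `^ (- p) <= G (2 * x) / G x.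
  by apply: cvgr_ge h2; exact: Grv.
apply: filterS2 Gpos => x Gx h; split => //.
by move: h; rewrite ler_pdivlMr// powRN mulrC ler_pdivrMr ?powR_gt0// mulrC.
Qed.

Lemma tail_doubling_le (p : R) : p < alpha ->
  exists2 x0 : R, 1 <= x0 & forall x, x0 <= x -> G (2 * x) <= 2 `^ (- p) * G x.
Proof.
move=> pa; apply: near_ge.
have h2 : 2 `^ (- alpha) < 2 `^ (- p) :> R by rewrite ltr_powR2// ltrN2.
have : \forall x \near +oo, G (2 * x) / G x <= 2 `^ (- p).
  by apply: cvgr_le h2; exact: Grv.
by apply: filterS2 Gpos => x Gx h; rewrite -ler_pdivrMr.
Qed.

(** For a monotone tail, regular variation along the powers of 2 already gives
    the comparison with a power at all scales [y]: double [x * y] until it comes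
    close to [x], at most [k] times, and use monotonicity for the last fraction of
    a step. *)
Lemma tail_scale_down (p x0 : R) : 0 <= p -> 1 <= x0 ->
  (forall x, x0 <= x -> 0 < G x /\ G x <= 2 `^ p * G (2 * x)) ->
  forall k x y, x0 <= x -> 2 ^- k <= y <= 1 -> x0 <= x * y ->
  G (x * y) <= (2 / y) `^ p * G x.
Proof.
move=> p0 x01 dbl; elim=> [|k IH] x y x0x /andP[ky y1] x0y.
  have -> : y = 1 by apply/eqP; rewrite eq_le y1/=; move: ky; rewrite expr0 invr1.
  rewrite mulr1 divr1 ler_peMl//; first by case/andP: (G01 x).
  rewrite -[leLHS](powRr0 2); apply: ler_powR => //; by rewrite ler1n.
have y0 : 0 < y by rewrite (lt_le_trans _ ky)// invr_gt0 exprn_gt0.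
have [_ h] := dbl _ x0y; rewrite (le_trans h)//.
have [y2|y2] := leP (2^-1) y.
  rewrite ler_pM ?powR_ge0//; first by case/andP: (G01 (2 * (x * y))).
    apply: ge0_ler_powR => //; rewrite ?nnegrE ?divr_ge0 ?(ltW y0)//.
    by rewrite ler_pdivlMr// ler_piMr.
  apply: Gnincr; rewrite mulrCA ler_peMr//; last by rewrite -ler_pdivrMl// mulr1.
  by rewrite (le_trans _ x0x)// (le_trans _ x01).
have -> : 2 * (x * y) = x * (2 * y) by ring.
have -> : (2 / y) `^ p = 2 `^ p * (2 / (2 * y)) `^ p.
  rewrite -powRM ?divr_ge0 ?mulr_ge0 ?(ltW y0)//; congr (_ `^ _).
  by field; rewrite gt_eqF.
rewrite -mulrA ler_pM2l ?powR_gt0//; apply: IH => //.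
  apply/andP; split; last by rewrite -ler_pdivlMl// mulr1 ltW.
  by rewrite -ler_pdivrMl// -invfM -exprS.
by rewrite (le_trans x0y)// ler_pM2l ?ler_peMl ?(ltW y0) ?ler1n// (lt_le_trans _ x0x)// (lt_le_trans _ x01).
Qed.

(** Potter's bound, extended to all positive [y] by the boundedness of [G]. *)
Lemma tail_potter (p : R) : alpha < p ->
  exists x0 K : R, [/\ 1 <= x0, 0 < K &
    forall x y, x0 <= x -> 0 < y -> G (x * y) <= K * (1 + y `^ (- p)) * G x].
Proof.
move=> ap; have p0 : 0 < p := lt_trans alpha0 ap.
have [x0 x01 dbl] := tail_doubling_ge ap.
have x00 : 0 < x0 := lt_le_trans ltr01 x01.
have scale x y : x0 <= x -> 0 < y <= 1 -> x0 <= x * y ->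
    G (x * y) <= (2 / y) `^ p * G x.
  move=> x0x /andP[y0 y1] x0y.
  have [k ky] : exists k, 2 ^- k <= y.
    exists (Num.truncn y^-1).+1; rewrite invf_ple ?posrE ?exprn_gt0//.
    rewrite (le_trans (ltW (truncnS_gt _)))//.
    by rewrite -natrX ler_nat ltnW// ltn_expl.
  by apply: (@tail_scale_down p x0 (ltW p0) x01 dbl k) => //; rewrite ky.
have Gx0 : 0 < G x0 by have [] := dbl _ (lexx x0).
have [_ Gx01] := andP (G01 x0).
pose K := 2 `^ p / G x0.
have K2 : 2 `^ p <= K by rewrite ler_pdivlMr// ler_piMr// powR_ge0.
have K0 : 0 < K by rewrite divr_gt0 ?powR_gt0.
exists x0, K; split => // x y x0x y0.
have /andP[Gx Gx1] := G01 x.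
have x_gt0 : 0 < x := lt_le_trans x00 x0x.
have [y1|y1] := leP 1 y.
  rewrite (@le_trans _ _ (G x))//; first by apply: Gnincr; rewrite ler_peMr// ltW.
  rewrite ler_peMl// (@le_trans _ _ (K * 1))//; last first.
    by rewrite ler_wpM2l// ?(ltW K0)// lerDl powR_ge0.
  by rewrite mulr1 (le_trans _ K2)// ltW// two_powR_gt1.
suff h : G (x * y) <= K * y `^ (- p) * G x.
  rewrite (le_trans h)// ler_wpM2r// ler_wpM2l ?(ltW K0)// lerDr//.
have yp : (2 / y) `^ p = 2 `^ p * y `^ (- p).
  by rewrite powRM ?invr_ge0 ?(ltW y0)// powR_inv ?(ltW y0).
have [x0y|yx0] := leP x0 (x * y).
  rewrite (le_trans (scale _ _ x0x _ x0y)) ?y0 ?(ltW y1)//.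
  by rewrite yp ler_wpM2r// ler_wpM2r// powR_ge0.
(* below the threshold, the tail at [x0] itself gives the lower bound on [G x] *)
have xx0 : x * (x0 / x) = x0 by rewrite mulrC divfK// gt_eqF.
have := scale x (x0 / x) x0x; rewrite xx0 lexx.
rewrite divr_gt0// ler_pdivrMr// mul1r x0x => /(_ isT isT) h.
have /andP[_ Gxy1] := G01 (x * y); rewrite (le_trans Gxy1)//.
have -> : K * y `^ (- p) * G x = (2 / y) `^ p * G x / G x0.
  by rewrite yp /K; field; rewrite gt_eqF.
rewrite ler_pdivlMr// mul1r (le_trans h)// ler_wpM2r//.
apply: ge0_ler_powR; rewrite ?nnegrE ?(ltW p0)//.
- by rewrite !divr_ge0// ltW.
- by rewrite divr_ge0// ltW.
rewrite ler_pM2l// lef_pV2 ?posrE ?divr_gt0//.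
by rewrite ler_pdivlMr// mulrC ltW.
Qed.

(** Potter's bound read backwards, from [x] down to a fixed point [x2]. *)
Lemma tail_power_lower (p : R) : alpha < p ->
  exists x0 k : R, [/\ 1 <= x0, 0 < k & forall x, x0 <= x -> k * x `^ (- p) <= G x].
Proof.
move=> ap; have p0 : 0 < p := lt_trans alpha0 ap.
have [x0 [K [x01 K0 pot]]] := tail_potter ap.
have [x1 x11 Gx1] := near_ge Gpos.
pose x2 := Num.max x0 x1.
have x2x0 : x0 <= x2 by rewrite le_max lexx.
have x20 : 0 < x2 by rewrite (lt_le_trans ltr01)// (le_trans x01).
have Gx2 : 0 < G x2 by apply: Gx1; rewrite le_max lexx orbT.
exists x2, (G x2 / (K * 2 * x2 `^ (- p))); split.
- exact: le_trans x01 x2x0.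
- by rewrite divr_gt0// ?mulr_gt0// powR_gt0.
move=> x x2x; have x_gt0 : 0 < x := lt_le_trans x20 x2x.
have := pot x (x2 / x) (le_trans x2x0 x2x); rewrite divr_gt0// => /(_ isT).
have -> : x * (x2 / x) = x2 by rewrite mulrC divfK// gt_eqF.
have -> : (x2 / x) `^ (- p) = x2 `^ (- p) * x `^ p.
  rewrite powRM ?invr_ge0 ?(ltW x20) ?(ltW x_gt0)//; congr (_ * _).
  by rewrite powR_inv ?(ltW x_gt0)// opprK.
have uv1 : 1 <= x2 `^ (- p) * x `^ p.
  rewrite powRN mulrC ler_pdivlMr ?powR_gt0// mul1r.
  by apply: ge0_ler_powR; rewrite ?nnegrE ?(ltW p0) ?(ltW x20) ?(ltW x_gt0).
have u0 : 0 < x2 `^ (- p) by rewrite powR_gt0.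
have v0 : 0 < x `^ p by rewrite powR_gt0.
rewrite [x `^ (- p)]powRN; move: uv1 u0 v0.
set u := x2 `^ (- p); set v := x `^ p => uv1 u0 v0 h.
have /andP[Gx _] := G01 x.
rewrite mulrAC ler_pdivrMr ?mulr_gt0// ler_pdivrMr// (le_trans h)//.
have -> : G x * (K * 2 * u) * v = K * (2 * (u * v)) * G x by ring.
by rewrite ler_wpM2r// ler_wpM2l ?(ltW K0)//; lra.
Qed.

Lemma tail_geometric (p : R) : p < alpha ->
  exists2 x0 : R, 1 <= x0 & forall k : nat,
    G (2 ^+ k * x0) <= (2 `^ (- p)) ^+ k.
Proof.
move=> pa; have [x0 x01 dbl] := tail_doubling_le pa.
exists x0 => //; elim=> [|k IH].
  by rewrite mul1r expr0; case/andP: (G01 x0).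
rewrite !exprS -mulrA (le_trans (dbl _ _))//.
  by rewrite ler_peMl ?(le_trans _ x01)// exprn_ege1// ler1n.
by rewrite ler_pM2l// powR_gt0.
Qed.

(** The norming [a], for which [G (a t)] is asymptotically [1 / t]. *)
Section norming.
Variable a : R -> R.
Hypothesis a_oo : a t @[t --> +oo] --> +oo.
Hypothesis Ga : t * G (a t) @[t --> +oo] --> (1 : R).

Lemma norming_scale (c : R) : 0 < c ->
  t * G (c * a t) @[t --> +oo] --> c `^ (- alpha).
Proof.
move=> c0; rewrite -[X in _ --> X]mul1r.
apply: (@cvg_trans _ ((t * G (a t)) * (G (c * a t) / G (a t)) @[t --> +oo])).
  apply: near_eq_cvg; have : \forall t \near +oo, 0 < G (a t) by exact: a_oo Gpos.
  apply: filterS => t /= Gat.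
  by field; rewrite gt_eqF.
by apply: cvgM => //; exact: (cvg_comp _ _ a_oo (Grv c0)).
Qed.

(** The tail at [a t] is of order [1 / t] and at least of order [a t `^ (- p)]
    with [p < 2], so that [t] is at most of order [a t `^ p]. *)
Lemma norming_sqr : alpha < 2 -> t / a t ^+ 2 @[t --> +oo] --> (0 : R).
Proof.
move=> a2; pose p := (alpha + 2) / 2.
have ap : alpha < p by rewrite /p; lra.
have p2 : p < 2 by rewrite /p; lra.
have [x0 [k [x01 k0 low]]] := tail_power_lower ap.
have q0 : 0 < 2 - p by rewrite subr_gt0.
apply: (@squeeze_cvgr _ _ _ _ (fun=> 0) (fun t => 2 / k * a t `^ (- (2 - p)))).
- have : \forall t \near +oo, x0 <= a t by exact: a_oo (nbhs_pinfty_ge (num_real x0)).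
  have : \forall t \near +oo, t * G (a t) <= 2 by apply: cvgr_le Ga _ _; rewrite ltr1n.
  have : \forall t \near +oo, (0 : R) <= t by apply: nbhs_pinfty_ge; exact: num_real.
  apply: filterS3 => t t0 tG x0a; have h := low _ x0a.
  have at0 : 0 < a t by rewrite (lt_le_trans _ x0a)// (lt_le_trans _ x01).
  rewrite divr_ge0 ?sqr_ge0//= ler_pdivrMr ?exprn_gt0//.
  have -> : a t ^+ 2 = a t `^ 2 by rewrite -(powR_mulrn 2 (ltW at0)).
  have e : a t `^ (- (2 - p)) * a t `^ 2 = a t `^ p.
    rewrite -powRD; last by apply/implyP => _; rewrite gt_eqF.
    by congr (_ `^ _); ring.
  rewrite -[leRHS]mulrA e mulrAC ler_pdivlMr// mulrC -ler_pdivrMr ?powR_gt0// -powRN.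
  by rewrite (le_trans _ tG)// mulrAC mulrC ler_wpM2l.
- exact: cvg_cst.
- rewrite -[X in _ --> X](mulr0 (2 / k)); apply: cvgM; first exact: cvg_cst.
  by exact: (cvg_comp _ _ a_oo (cvg_powRN_pinfty q0)).
Qed.

End norming.
End regular_variation.

(** * Laplace transforms near the origin *)

Section singular_integral.
Context {R : realType}.
Local Notation mu := (@lebesgue_measure R).
Implicit Types b : R.

Lemma integral_powRN_itv b (e : R) : 0 < b < 1 -> 0 < e < 1 ->
  (\int[mu]_(z in `[e, 1%R]) (z `^ (- b))%:E <= ((1 - b)^-1)%:E)%E.
Proof.
move=> /andP[b0 b1] /andP[e0 e1].
have b1' : 0 < 1 - b by rewrite subr_gt0.
pose F (z : R) : R := (1 - b)^-1 * z `^ (1 - b).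
have cpow (c z : R) : 0 < z -> {for z, continuous (fun z : R => z `^ c)}.
  move=> z0; apply: differentiable_continuous; apply/derivable1_diffP.
  by apply: derivable_powR; rewrite in_itv/= andbT.
have dF (z : R) : 0 < z -> is_derive z 1 F (z `^ (- b)).
  move=> z0; apply: is_derive_eq.
    by apply: is_deriveZ; exact: is_derive1_powR.
  rewrite -[_ *: _]/((1 - b)^-1 * ((1 - b) * z `^ (1 - b - 1))) mulKf ?gt_eqF//.
  by congr (_ `^ _); ring.
rewrite (@continuous_FTC2 _ _ F)//.
- rewrite -EFinB lee_fin /F powR1 mulr1 lerBlDr lerDl.
  by rewrite mulr_ge0 ?powR_ge0// invr_ge0 ltW.
- apply: continuous_in_subspaceT => z; rewrite inE/= in_itv/= => /andP[ez _].
  by apply: cpow; exact: lt_le_trans ez.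
- have cF (z : R) : 0 < z -> {for z, continuous F}.
    by move=> z0; apply: cvgM; [exact: cvg_cst|exact: cpow].
  split.
  + move=> z; rewrite in_itv/= => /andP[ez _].
    by have [] := dF z (lt_trans e0 ez).
  + by apply: cvg_at_right_filter; exact: cF.
  + by apply: cvg_at_left_filter; exact: cF.
- move=> z; rewrite in_itv/= => /andP[ez _].
  by rewrite derive1E; have [_ ->] := dF z (lt_trans e0 ez).
Qed.

Lemma integral_powRN b : 0 < b < 1 ->
  (\int[mu]_(z in `]0%R, 1%R]) (z `^ (- b))%:E <= ((1 - b)^-1)%:E)%E.
Proof.
move=> b01; pose A n : set R := `[n.+2%:R^-1, 1]%classic.
have mpow D : measurable D -> measurable_fun D (fun z : R => (z `^ (- b))%:E).
  by move=> mD; apply/measurable_EFinP; apply: measurable_funTS; exact: measurable_powR.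
have -> : `]0%R, 1%R]%classic = \bigcup_n A n.
  apply/seteqP; split => z; rewrite /A /= in_itv/=.
    move=> /andP[z0 z1]; exists (Num.truncn z^-1) => //=.
    rewrite in_itv/= z1 andbT invf_ple ?posrE// (le_trans (ltW (truncnS_gt _)))//.
    by rewrite ler_nat.
  by move=> [n _ /=]; rewrite in_itv/= => /andP[+ ->]; rewrite andbT; exact: lt_le_trans.
have cvgA : (\int[mu]_(x in A i) (x `^ (- b))%:E @[i --> \oo] -->
    \int[mu]_(x in \bigcup_i A i) (x `^ (- b))%:E)%E.
  apply: ge0_nondecreasing_set_cvg_integral => //.
  - apply/nondecreasing_seqP => n; apply/subsetPset => z; rewrite /A/= !in_itv/=.
    move=> /andP[h ->]; rewrite andbT (le_trans _ h)// lef_pV2 ?posrE//.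
    by rewrite ler_nat.
  - by move=> n; exact: measurable_itv.
  - by move=> n; apply: mpow; exact: measurable_itv.
  - by move=> n z _; rewrite lee_fin powR_ge0.
rewrite -(cvg_lim _ cvgA)//; apply: lime_le; first by apply/cvg_ex; eexists; exact: cvgA.
apply: nearW => n; apply: integral_powRN_itv => //.
by rewrite invr_gt0 ltr0n/= invf_lt1// ltr1n.
Qed.

Lemma integrable_powRN_expRN b : 0 < b < 1 ->
  mu.-integrable (`]0%R, +oo[ : set R)
    (EFin \o (fun z : R => expR (- z) * (1 + z `^ (- b)))).
Proof.
move=> b01; pose D : set R := `]0%R, +oo[%classic.
have mD : measurable (D : set (measurableTypeR R)) by exact: measurable_itv.
have mexp : measurable_fun setT (fun z : R => expR (- z)).
  by apply: measurableT_comp => //; exact: measurableT_comp.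
have mpow : measurable_fun setT (fun z : R => z `^ (- b)) by exact: measurable_powR.
have i1 : mu.-integrable D (EFin \o (fun z : R => expR (- z) * 2)).
  have h := integrableZl mD 2 (@integrable_expRN R).
  by apply: eq_integrable h => // z _; rewrite /= -EFinM mulrC.
have i2 : mu.-integrable D (EFin \o (fun z : R => z `^ (- b) * \1_(`]0, 1]%classic) z)).
  apply/integrableP; split.
    apply/measurable_EFinP; apply: measurable_funTS.
    by apply: measurable_funM => //; exact: measurable_indic.
  apply: (@le_lt_trans _ _ (\int[mu]_(z in `]0%R, 1%R]) (z `^ (- b))%:E)%E); last first.
    by rewrite (le_lt_trans (integral_powRN b01))// ltry.
  rewrite [leRHS]integral_mkcond/= [leLHS]integral_mkcond/=.
  apply: ge0_le_integral => //.
  - by move=> z _; apply: erestrict_ge0 => // y _; rewrite lee_fin normr_ge0.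
  - apply: (iffLR (measurable_restrictT _ mD)); apply: measurable_funTS.
    apply/measurable_EFinP; apply: measurableT_comp => //.
    by apply: measurable_funM => //; exact: measurable_indic.
  - apply: (iffLR (measurable_restrictT _ (measurable_itv _))).
    by apply: measurable_funTS; exact/measurable_EFinP.
  move=> z _; rewrite !patchE; case: ifPn => zD.
    rewrite indicE; case: (boolP (z \in _)) => zI.
      by rewrite mulr1 ger0_norm ?powR_ge0.
    by rewrite mulr0 normr0.
  by case: ifPn => // _; rewrite lee_fin powR_ge0.
have i12 := integrableD mD i1 i2.
apply: (le_integrable mD) i12.
  apply: measurable_funTS; apply/measurable_EFinP; apply: measurable_funM => //.
  exact: measurable_funD.
move=> z; rewrite /D/= in_itv/= andbT => z0.
have zb0 : 0 <= z `^ (- b) by exact: powR_ge0.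
have e0 : 0 <= expR (- z) by exact: expR_ge0.
have e1 : expR (- z) <= 1 by rewrite expR_le1 oppr_le0 ltW.
rewrite lee_fin !ger0_norm; last 2 first.
- by rewrite addr_ge0// mulr_ge0// indicE.
- by rewrite mulr_ge0// addr_ge0.
rewrite indicE; case: (boolP (z \in _)) => zI.
  by rewrite mulr1; nra.
rewrite mulr0 addr0 ler_wpM2l// -lerBrDl (_ : 2 - 1 = 1 :> R); last by ring.
have z1 : 1 < z.
  move: zI; rewrite notin_setE/= in_itv/= z0/= => /negP; by rewrite -ltNge.
rewrite powRN invf_le1 ?powR_gt0// -[leLHS](powRr0 z); apply: ler_powR; first exact: ltW.
by case/andP: b01 => /ltW.
Qed.

End singular_integral.

(** The logarithm of [q] is squeezed between [- (1 - q) / q] and [- (1 - q)]. *)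
Lemma cvg_exprn_expR (R : realType) (I : Type) (F : set_system I)
    {FF : ProperFilter F} (q : I -> R) (n : I -> nat) (c : R) :
  (\forall i \near F, 0 < q i <= 1) -> q i @[i --> F] --> (1 : R) ->
  (n i)%:R * (1 - q i) @[i --> F] --> c ->
  q i ^+ n i @[i --> F] --> expR (- c).
Proof.
move=> q01 q1 nq.
have cexp (f : I -> R) (l : R) : f i @[i --> F] --> l ->
    expR (f i) @[i --> F] --> expR l.
  by move=> fl; apply: continuous_cvg => //; exact: continuous_expR.
apply: (@squeeze_cvgr _ _ _ _ (fun i => expR (- ((n i)%:R * (1 - q i) / q i)))
                              (fun i => expR (- ((n i)%:R * (1 - q i))))).
- apply: filterS q01 => i /andP[q0 _]; apply/andP; split.
    have -> : - ((n i)%:R * (1 - q i) / q i) = (n i)%:R * (1 - (q i)^-1).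
      by field; rewrite gt_eqF.
    rewrite expRM_natl lerXn2r ?nnegrE ?expR_ge0 ?(ltW q0)//.
    rewrite -[leRHS]invrK -[1 - _]opprK expRN opprB lef_pV2 ?posrE ?expR_gt0 ?invr_gt0//.
    by have := expR_ge1Dx ((q i)^-1 - 1); rewrite addrC subrK.
  rewrite -mulrN expRM_natl lerXn2r ?nnegrE ?expR_ge0 ?(ltW q0)//.
  by have := expR_ge1Dx (- (1 - q i)); rewrite opprB addrC subrK.
- apply: cexp; apply: cvgN; rewrite -[X in _ --> X]divr1; apply: cvgM => //.
  by apply: cvgV => //; exact: oner_neq0.
- by apply: cexp; exact: cvgN.
Qed.

Section heavy_tail.
Context {R : realType} d {T : measurableType d} (P : probability T R).
Variable A : T -> R.
Hypothesis mA : measurable_fun setT A.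
Hypothesis A0 : forall w, 0 <= A w.
Local Notation G := (tailP P A).
Local Notation mu := (@lebesgue_measure R).

(** Doubling the truncation level from [x] to [2 x] adds at most [x] times the
    probability of exceeding [x], and these increments form a geometric
    series. *)
Lemma geometric_tail_mean (p x0 : R) : 1 < p -> 1 <= x0 ->
  (forall k : nat, G (2 ^+ k * x0) <= (2 `^ (- p)) ^+ k) ->
  (\int[P]_w (A w)%:E < +oo)%E.
Proof.
move=> p1 x01 geo; have x00 : 0 < x0 := lt_le_trans ltr01 x01.
pose q : R := 2 * 2 `^ (- p).
have q0 : 0 <= q by rewrite mulr_ge0// powR_ge0.
have q1 : q < 1.
  rewrite /q powRN ltr_pdivrMr ?powR_gt0// mul1r -[ltLHS]powRr1//.
  exact: ltr_powR2.
pose Ak k w := Num.min (A w) (2 ^+ k * x0).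
have lvl0 k : 0 <= 2 ^+ k * x0 by rewrite mulr_ge0 ?exprn_ge0// ltW.
have Ak0 k w : 0 <= Ak k w by rewrite le_min A0 lvl0.
have mAk k : measurable_fun setT (Ak k) by exact: measurable_minr.
have bAk k : bmf (Ak k).
  apply: (@bmf_le _ _ _ _ (2 ^+ k * x0)) => // w.
  by rewrite ger0_norm// ge_min lexx orbT.
(* [q = 2 `^ (1 - p)] is the ratio of the series of the increments *)
have step k : Ex P (Ak k.+1) <= Ex P (Ak k) + x0 * q ^+ k.
  have mI := measurable_gt_set (2 ^+ k * x0) mA.
  apply: (@le_trans _ _ (Ex P (fun w => Ak k w + 2 ^+ k * x0 * \1_[set w | 2 ^+ k * x0 < A w] w))).
    apply: Ex_le => //; first by apply: bmfD => //; apply: bmfZ; exact: bmf_indic.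
    move=> w; rewrite /Ak indicE; have [h|h] := ltP (2 ^+ k * x0) (A w).
      rewrite mem_set// mulr1 exprS -mulrA.
      by rewrite ge_min; apply/orP; right; rewrite mulr_natl mulr2n.
    rewrite memNset/= ?mulr0 ?addr0; last by apply/negP; rewrite -leNgt.
    by rewrite ge_min lexx.
  rewrite ExD//; last by apply: bmfZ; exact: bmf_indic.
  rewrite lerD2l ExZ; last exact: bmf_indic.
  rewrite Ex_indic// -/(G _) (le_trans (ler_wpM2l (lvl0 k) (geo k)))//.
  by rewrite /q exprMn [leRHS]mulrC mulrAC.
have q1' : 0 < 1 - q by rewrite subr_gt0.
have bound k : Ex P (Ak k) <= x0 + x0 / (1 - q).
  apply: (@le_trans _ _ (x0 + x0 * \sum_(j < k) q ^+ j)).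
    elim: k => [|k IH].
      rewrite big_ord0 mulr0 addr0 -[leRHS](Ex_cst P); apply: Ex_le => //.
        exact: bmf_cst.
      by move=> w; rewrite /Ak expr0 mul1r ge_min lexx orbT.
    by rewrite (le_trans (step k))// big_ord_recr/= mulrDr addrA lerD2r.
  rewrite lerD2l ler_pM2l// -[leRHS]mul1r ler_pdivlMr//.
  have -> : (\sum_(j < k) q ^+ j) * (1 - q) = 1 - q ^+ k.
    by have := subrX1 q k; lra.
  by rewrite lerBlDr lerDl exprn_ge0.
have mono : (\int[P]_w (Ak k w)%:E @[k --> \oo] --> \int[P]_w (lim ((Ak k w)%:E @[k --> \oo])))%E.
  apply: cvg_monotone_convergence => //.
  - by move=> k; exact/measurable_EFinP.
  - by move=> k w _; rewrite lee_fin.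
  - move=> w _; apply/nondecreasing_seqP => k; rewrite lee_fin /Ak.
    rewrite le_min ge_min lexx/= ge_min; apply/orP; right.
    by rewrite ler_pM2r// exprS ler_peMl ?exprn_ge0// ler1n.
have limA w : lim ((Ak k w)%:E @[k --> \oo]) = (A w)%:E.
  apply/cvg_lim => //; apply: cvg_near_cst; near=> k.
  congr EFin; apply: min_l; rewrite -ler_pdivrMr//.
  apply: (@le_trans _ _ k%:R); first by near: k; exact: nbhs_infty_ger.
  by rewrite -natrX ler_nat ltnW// ltn_expl.
move: mono; under eq_integral do rewrite limA.
move=> mono; apply: (@le_lt_trans _ _ (x0 + x0 / (1 - q))%:E); last exact: ltry.
rewrite -(cvg_lim _ mono)//; apply: lime_le.
  by apply/cvg_ex; eexists; exact: mono.
by apply: nearW => k; rewrite -EFin_Ex// lee_fin.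
Unshelve. all: by end_near. Qed.

(** The integrands [n * (1 - exp (- r A / n))] are dominated by their limit
    [r A]. *)
Lemma laplace_mean (r : R) : P.-integrable setT (EFin \o A) -> 0 <= r ->
  n%:R * (1 - laplace P A (r / n%:R)) @[n --> \oo] --> r * \int[P]_w A w.
Proof.
move=> iA r0; rewrite -(cvg_shiftS (fun n : nat => n%:R * (1 - laplace P A (r / n%:R)))).
pose f n w := n.+1%:R * (1 - expR (- (r / n.+1%:R * A w))).
have rn0 n : 0 <= r / n.+1%:R by rewrite divr_ge0.
have bl n : bmf (fun w => expR (- (r / n.+1%:R * A w))) by exact: bmf_laplace.
have bf n : bmf (f n) by apply: bmfZ; apply: bmfB => //; exact: bmf_cst.
have fE n : n.+1%:R * (1 - laplace P A (r / n.+1%:R)) = Ex P (f n).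
  rewrite ExZ; last by apply: bmfB => //; exact: bmf_cst.
  by rewrite ExB ?Ex_cst//; exact: bmf_cst.
under eq_fun do rewrite fE.
(* [x / (1 + x) <= 1 - exp (- x) <= x] at [x = r * A w / (n + 1)] *)
have fbound n w : r * A w / (1 + r * A w / n.+1%:R) <= f n w <= r * A w.
  have n0 : 0 < n.+1%:R :> R by rewrite ltr0n.
  set x := r / n.+1%:R * A w.
  have x0 : 0 <= x by rewrite mulr_ge0.
  have e : r * A w = n.+1%:R * x by rewrite /x mulrA mulrCA divff ?mulr1// gt_eqF.
  rewrite e /f -/x; apply/andP; split; last first.
    by rewrite ler_pM2l//; have := expR_ge1Dx (- x); lra.
  have -> : n.+1%:R * x / n.+1%:R = x by rewrite mulrC mulKf// gt_eqF.
  rewrite -mulrA ler_pM2l// ler_pdivrMr; last by lra.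
  have h := expR_ge1Dx x; have h0 := expR_gt0 (- x).
  have h1 := expRxMexpNx_1 x.
  have : expR (- x) * (1 + x) <= 1.
    by rewrite -[leRHS]h1 mulrC ler_pM2r.
  by lra.
have irA : P.-integrable setT (fun w => (r * A w)%:E).
  have h := integrableZl measurableT r iA.
  by apply: eq_integrable h => // w _; rewrite /= EFinM.
have [||||| _ _] := @dominated_convergence _ T R P setT measurableT
  (fun n => EFin \o f n) (fun w => (r * A w)%:E) (fun w => (r * A w)%:E).
- by move=> n; apply/measurable_EFinP; case: (bf n).
- by apply/measurable_EFinP; exact: measurable_funM.
- apply: aeW => w _; apply: cvg_EFin; first exact: nearW.
  apply: (@squeeze_cvgr _ _ _ _ (fun n => r * A w / (1 + r * A w / n.+1%:R)) (fun=> r * A w)).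
  + by apply: nearW => n; exact: fbound.
  + rewrite -[X in _ --> X]divr1; apply: cvgM; first exact: cvg_cst.
    apply: cvgV; first exact: oner_neq0.
    rewrite -[X in _ --> X]addr0; apply: cvgD; first exact: cvg_cst.
    rewrite -[X in _ --> X](mulr0 (r * A w)); apply: cvgM; first exact: cvg_cst.
    exact: cvg_harmonic.
  + exact: cvg_cst.
- exact: irA.
- apply: aeW => w n _; rewrite lee_fin; have /andP[h1 h2] := fbound n w.
  rewrite ger0_norm// (le_trans _ h1)// divr_ge0 ?mulr_ge0// addr_ge0//.
  by rewrite divr_ge0// mulr_ge0.
move=> h; rewrite -RintegralZl//; apply: fine_cvg.
by rewrite fineK//; exact: integrable_fin_num.
Qed.

End heavy_tail.

Section norming_laplace.
Context {R : realType} d {T : measurableType d} (P : probability T R).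
Variables (A : T -> R) (alpha : R) (a : R -> R).
Hypothesis mA : measurable_fun setT A.
Hypothesis A0 : forall w, 0 <= A w.
Local Notation G := (tailP P A).
Local Notation mu := (@lebesgue_measure R).
Hypothesis alpha02 : 0 < alpha < 2.
Hypothesis Gpos : \forall x \near +oo, 0 < G x.
Hypothesis Grv : forall c : R, 0 < c ->
  G (c * x) / G x @[x --> +oo] --> c `^ (- alpha).
Hypothesis a_oo : a t @[t --> +oo] --> +oo.
Hypothesis Ga : t * G (a t) @[t --> +oo] --> (1 : R).

(** The event [z < r * A ^ 2 / s ^ 2] is [s * sqrt (z / r) < A], so the tail
    formula for the square is expressed by the tail of [A]. *)
Lemma scaled_laplace_sqr (r s t : R) : 0 < r -> 0 < s -> 0 <= t ->
  ((t * (1 - laplace P (fun w => A w ^+ 2) (r / s ^+ 2)))%:E =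
   \int[mu]_(z in `]0%R, +oo[)
     (expR (- z) * (t * G (s * Num.sqrt (z / r))))%:E)%E.
Proof.
move=> r0 s0 t0; have s20 : 0 < s ^+ 2 by rewrite exprn_gt0.
pose B w := r / s ^+ 2 * A w ^+ 2.
have mB : measurable_fun setT B by apply: measurable_funM => //; exact: measurable_funX.
have B0 w : 0 <= B w by rewrite mulr_ge0 ?sqr_ge0// divr_ge0// ltW.
have -> : laplace P (fun w => A w ^+ 2) (r / s ^+ 2) = laplace P B 1.
  by apply: eq_Ex => w; rewrite mul1r.
rewrite EFinM laplace_tail// -ge0_integralZl_EFin//; last 2 first.
- move=> z _; rewrite lee_fin mulr_ge0 ?expR_ge0//.
  by case/andP: (tailP_ge0_le1 P z mB).
- apply/measurable_EFinP; apply: measurable_funM.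
    apply: measurable_funTS; apply: measurableT_comp => //; exact: measurableT_comp.
  by apply: measurable_tailP => //; exact: measurable_itv.
apply: eq_integral => z; rewrite inE/= in_itv/= andbT => z0.
rewrite -EFinM mulrCA; congr (_ * (_ * _))%:E.
congr (fine (P _)); apply/funext => w /=; apply/propext.
have zr0 : 0 <= z / r by rewrite divr_ge0 ?ltW.
rewrite -[X in _ <-> is_true X](@ltr_pXn2r _ 2) ?nnegrE ?mulr_ge0 ?sqrtr_ge0 ?(ltW s0)//.
rewrite exprMn sqr_sqrtr// /B -ltr_pdivrMl ?divr_gt0//.
by have -> : (r / s ^+ 2)^-1 * z = s ^+ 2 * (z / r); [field; rewrite !gt_eqF|].
Qed.

Lemma powR_sqrt (z r p : R) : 0 < z -> 0 < r ->
  Num.sqrt (z / r) `^ (- p) = r `^ (p / 2) * z `^ (- (p / 2)).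
Proof.
move=> z0 r0; have zr0 : 0 <= z / r by rewrite divr_ge0 ?ltW.
rewrite -powR12_sqrt// -powRrM powRM ?invr_ge0 ?(ltW z0) ?(ltW r0)//.
rewrite powR_inv ?(ltW r0)// mulrC; by congr (_ `^ _ * _ `^ _); field.
Qed.

Lemma integrable_Gamma (b : R) : 0 < b < 1 ->
  mu.-integrable (`]0%R, +oo[ : set R)
    (EFin \o (fun z : R => z `^ (- b) * expR (- z))).
Proof.
move=> b01; have h := integrable_powRN_expRN b01.
apply: le_integrable h => //.
  apply: measurable_funTS; apply/measurable_EFinP; apply: measurable_funM.
    exact: measurable_powR.
  by apply: measurableT_comp => //; exact: measurableT_comp.
move=> z _ /=; rewrite lee_fin !ger0_norm ?mulr_ge0 ?expR_ge0 ?addr_ge0 ?powR_ge0//.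
by rewrite mulrC ler_wpM2l ?expR_ge0// lerDr.
Qed.

(** By the tail formula the left side is the integral of [expR (- z)] against
    [t * G (a t * Num.sqrt (z / r))], which converges to [(z / r) `^ (- alpha / 2)];
    Potter's bound dominates it by a multiple of [1 + z `^ (- b)] with [b < 1]. *)
Lemma laplace_sqr_norming (r : R) : 0 < r ->
  t * (1 - laplace P (fun w => A w ^+ 2) (r / a t ^+ 2)) @[t --> +oo] -->
  r `^ (alpha / 2) * Gamma (1 - alpha / 2).
Proof.
have /andP[alpha0 alpha2] := alpha02; move=> r0.
have G01 x : 0 <= G x <= 1 by exact: tailP_ge0_le1.
have Gnincr x y : x <= y -> G y <= G x by exact: tailP_nincr.
apply/cvg_pinftyP => u u_oo.
(* any exponent strictly between [alpha] and 2 will do *)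
pose p := (alpha + 2) / 2.
have ap : alpha < p by rewrite /p; lra.
have [x0 [K [x01 K0 pot]]] := tail_potter G01 Gnincr Gpos Grv alpha0 ap.
have [n0 _ Hn0] : \forall n \near \oo,
    [/\ x0 <= a (u n), u n * G (a (u n)) <= 2 & 0 <= u n].
  have h : \forall t \near +oo, [/\ x0 <= a t, t * G (a t) <= 2 & 0 <= t].
    have h1 : \forall t \near +oo, x0 <= a t.
      by exact: a_oo (nbhs_pinfty_ge (num_real x0)).
    have h2 : \forall t \near +oo, t * G (a t) <= 2.
      by apply: cvgr_le Ga _ _; rewrite ltr1n.
    have h3 : \forall t \near +oo, (0 : R) <= t.
      by apply: nbhs_pinfty_ge; exact: num_real.
    by apply: filterS3 h1 h2 h3.
  exact: u_oo h.
rewrite -(cvg_shiftn n0); pose t n := u (n + n0)%N.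
have Ht n : [/\ x0 <= a (t n), t n * G (a (t n)) <= 2 & 0 <= t n].
  by apply: Hn0; rewrite /= leq_addl.
have t_oo : t n @[n --> \oo] --> +oo.
  by move: u_oo; rewrite -(cvg_shiftn n0).
have s0 n : 0 < a (t n).
  by have [h _ _] := Ht n; rewrite (lt_le_trans _ h)// (lt_le_trans _ x01).
have E n : (t n * (1 - laplace P (fun w => A w ^+ 2) (r / a (t n) ^+ 2)))%:E =
    (\int[mu]_(z in `]0%R, +oo[)
      (expR (- z) * (t n * G (a (t n) * Num.sqrt (z / r))))%:E)%E.
  by apply: scaled_laplace_sqr => //; have [] := Ht n.
pose b := p / 2; have b01 : 0 < b < 1 by rewrite /b /p; apply/andP; split; lra.
have be01 : 0 < alpha / 2 < 1 by apply/andP; split; lra.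
have mexp : measurable_fun (`]0%R, +oo[ : set R) (fun z : R => expR (- z)).
  by apply: measurable_funTS; apply: measurableT_comp => //; exact: measurableT_comp.
pose c : R := 2 * K * (1 + r `^ b).
have c0 : 0 <= c by rewrite !mulr_ge0 ?(ltW K0)// addr_ge0// powR_ge0.
have [||||| _ _] := @dominated_convergence _ _ R mu (`]0%R, +oo[ : set R)
  (measurable_itv _)
  (fun n z => (expR (- z) * (t n * G (a (t n) * Num.sqrt (z / r))))%:E)
  (fun z => (r `^ (alpha / 2) * (z `^ (- (alpha / 2)) * expR (- z)))%:E)
  (fun z => (c%:E * (expR (- z) * (1 + z `^ (- b)))%:E)%E).
- move=> n; apply/measurable_EFinP; apply: measurable_funM => //.
  apply: measurable_funM => //; apply: measurable_funTS.
  have mG : measurable_fun setT G by apply: measurable_tailP.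
  apply: (measurableT_comp mG); apply: measurable_funM => //.
  apply: measurableT_comp; last exact: measurable_funM.
  by apply: continuous_measurable_fun; exact: sqrt_continuous.
- apply/measurable_EFinP; apply: measurable_funM => //.
  apply: measurable_funM => //; apply: measurable_funTS; exact: measurable_powR.
- apply: aeW => z; rewrite /= in_itv/= andbT => z0.
  apply: cvg_EFin; first exact: nearW.
  have y0 : 0 < Num.sqrt (z / r) by rewrite sqrtr_gt0 divr_gt0.
  have := @norming_scale _ _ _ Gpos Grv _ a_oo Ga _ y0.
  move=> /cvg_pinftyP/(_ t t_oo); rewrite powR_sqrt// => h.
  have {}h := cvgM (cvg_cst (expR (- z))) h.
  rewrite [X in _ --> X](_ : _ = expR (- z) * (r `^ (alpha / 2) * z `^ (- (alpha / 2))));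
    last by ring.
  apply: cvg_trans (h _ _); apply: near_eq_cvg; apply: nearW => n /=.
  by rewrite [Num.sqrt _ * _]mulrC.
- exact: integrableZl (integrable_powRN_expRN b01).
- apply: aeW => z n; rewrite /= in_itv/= andbT => z0; rewrite lee_fin.
  have [x0a tG t0] := Ht n.
  have /andP[G0 _] := G01 (a (t n) * Num.sqrt (z / r)).
  rewrite ger0_norm ?mulr_ge0 ?expR_ge0//.
  rewrite [leRHS]mulrCA ler_wpM2l ?expR_ge0//.
  have y0 : 0 < Num.sqrt (z / r) by rewrite sqrtr_gt0 divr_gt0.
  have h := pot _ _ x0a y0.
  rewrite (le_trans (ler_wpM2l t0 h))// powR_sqrt// -/b.
  have zb : 0 <= z `^ (- b) := powR_ge0 _ _.
  have rb : 0 <= r `^ b := powR_ge0 _ _.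
  have -> : t n * (K * (1 + r `^ b * z `^ (- b)) * G (a (t n))) =
      K * (1 + r `^ b * z `^ (- b)) * (t n * G (a (t n))) by ring.
  apply: (@le_trans _ _ (K * (1 + r `^ b * z `^ (- b)) * 2)).
    by rewrite ler_wpM2l// mulr_ge0 ?(ltW K0)// addr_ge0// mulr_ge0.
  have -> : c * (1 + z `^ (- b)) = K * ((1 + r `^ b) * (1 + z `^ (- b))) * 2.
    by rewrite /c; ring.
  rewrite ler_pM2r// ler_wpM2l ?(ltW K0)//.
  have : 0 <= r `^ b * z `^ (- b) by rewrite mulr_ge0.
  by rewrite mulrDl mulrDr; lra.
have iG := integrable_Gamma be01.
have iG2 : mu.-integrable (`]0%R, +oo[ : set R) (EFin \o (fun z : R =>
    r `^ (alpha / 2) * (z `^ (- (alpha / 2)) * expR (- z)))).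
  have h2 : mu.-integrable (`]0%R, +oo[ : set R) (fun z : R =>
      ((r `^ (alpha / 2))%:E * (z `^ (- (alpha / 2)) * expR (- z))%:E)%E).
    exact: integrableZl iG.
  by apply: eq_integrable h2 => // z _; rewrite /= -EFinM.
have -> : (\int[mu]_(z in `]0%R, +oo[)
    (r `^ (alpha / 2) * (z `^ (- (alpha / 2)) * expR (- z)))%:E)%E =
    (r `^ (alpha / 2) * Gamma (1 - alpha / 2))%:E.
  rewrite -[LHS]fineK; last by apply: integrable_fin_num iG2; exact: measurable_itv.
  congr EFin; rewrite -[LHS]/(\int[mu]_(z in `]0%R, +oo[)
    (r `^ (alpha / 2) * (z `^ (- (alpha / 2)) * expR (- z)))) RintegralZl//.
  congr (_ * _); apply: eq_Rintegral => z _.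
  by congr (_ `^ _ * _); ring.
under eq_fun do rewrite /= -E.
by move=> h; exact: (fine_cvg h).
Qed.

End norming_laplace.

(** * Sums of independent copies *)

Section sums.
Context {R : realType} d {T : measurableType d} (P : probability T R).
Variables (X : T -> R) (Xs : nat -> T -> R).
Hypothesis mX : measurable_fun setT X.
Hypothesis mXs : forall i, measurable_fun setT (Xs i).
Hypothesis copies : forall i, same_law P P (Xs i) X.
Hypothesis indep : mutually_independent P Xs.

Lemma laplace_ge0_le1 (Y : T -> R) (r : R) : 0 <= r ->
  measurable_fun setT Y -> (forall w, 0 <= Y w) -> 0 <= laplace P Y r <= 1.
Proof.
move=> r0 mY Y0; apply/andP; split; first by apply: Ex_ge0 => w; exact: expR_ge0.
rewrite -[leRHS](Ex_cst P); apply: Ex_le; [exact: bmf_laplace|exact: bmf_cst|].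
by move=> w; rewrite expR_le1 oppr_le0 mulr_ge0.
Qed.

Lemma laplace_sum (h : R -> R) (r : R) n : 0 <= r ->
  measurable_fun setT h -> (forall x, 0 <= h x) ->
  laplace P (fun w => \sum_(i < n) h (Xs i w)) r =
  laplace P (fun w => h (X w)) r ^+ n.
Proof.
move=> r0 mh h0; pose g x := expR (- (r * h x)).
have [mg _] : bmf g by exact: bmf_laplace.
have g01 x : 0 <= g x <= 1 by rewrite expR_ge0 expR_le1 oppr_le0 mulr_ge0.
transitivity (Ex P (fun w => \prod_(i <- iota 0 n) g (Xs i w))).
  apply: eq_Ex => w; rewrite -(big_mkord xpredT (fun i => h (Xs i w))).
  by rewrite mulr_sumr -sumrN expR_sum /index_iota subn0.
rewrite Ex_prod ?iota_uniq// (eq_bigr (fun=> laplace P (fun w => h (X w)) r)).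
  by rewrite big_const_seq count_predT size_iota iter_mulr_1.
by move=> i _; apply: (@eq_Ex_law _ _ _ _ _ _ _ P P (Xs i) X g).
Qed.

(** The Laplace transform at [k] of the mean of [n] terms is the [n]-th power of
    a number [q] with [n * (1 - q)] close to [k * m], hence tends to
    [exp (- k * m)], the transform of a constant. *)
Lemma weak_lln (eta : R) : P.-integrable setT (EFin \o (fun w => `|X w|)) ->
  0 < eta ->
  fine (P [set w | `|(\sum_(i < n) `|Xs i w|) / n%:R - \int[P]_w `|X w| | < eta])
    @[n --> \oo] --> (1 : R).
Proof.
move=> iX eta0; set m : R := \int[P]_w `|X w|.
have m0 : 0 <= m by apply: Rintegral_ge0.
have maX : measurable_fun setT (fun w => `|X w|) by exact: measurableT_comp.
pose M n w := (\sum_(i < n) `|Xs i w|) / n%:R.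
have mM n : measurable_fun setT (M n).
  by apply: measurable_funM => //; apply: measurable_sum => i; exact: measurableT_comp.
have M0 n w : 0 <= M n w by rewrite divr_ge0 ?sumr_ge0.
have lapM (k : nat) : laplace P (M n) k%:R @[n --> \oo] -->
    laplace P (fun=> m : R) k%:R.
  have -> : laplace P (fun=> m : R) k%:R = expR (- (k%:R * m)) by exact: Ex_cst.
  have qn := laplace_mean maX (fun=> normr_ge0 _) iX (ler0n R k).
  pose q (n : nat) := laplace P (fun w => `|X w|) (k%:R / n%:R).
  have q01 n : 0 <= q n <= 1 by apply: laplace_ge0_le1 => //; rewrite divr_ge0.
  have q1 : q n @[n --> \oo] --> (1 : R).
    have h0 : n.+1%:R^-1 * (n.+1%:R * (1 - q n.+1)) @[n --> \oo] --> (0 : R).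
      rewrite -[X in _ --> X](mul0r (k%:R * m)); apply: cvgM; first exact: cvg_harmonic.
      by move: qn; rewrite -(cvg_shiftS (fun n : nat => n%:R * (1 - laplace P (fun w => `|X w|) (k%:R / n%:R)))).
    have h1 : 1 - n.+1%:R^-1 * (n.+1%:R * (1 - q n.+1)) @[n --> \oo] --> (1 : R).
      by rewrite -[X in _ --> X]subr0; apply: cvgB => //; exact: cvg_cst.
    rewrite -(cvg_shiftS q); apply: cvg_trans h1.
    apply: near_eq_cvg; apply: nearW => n.
    by rewrite mulKf ?pnatr_eq0// opprB addrC subrK.
  have -> : (fun n => laplace P (M n) k%:R) = (fun n => q n ^+ n).
    apply/funext => n; rewrite /q -(@laplace_sum (fun x : R => `|x|)) ?divr_ge0//.
    by apply: eq_Ex => w; congr expR; rewrite /M; ring.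
  apply: cvg_exprn_expR => //.
  have : \forall n \near \oo, 0 < q n by apply: cvgr_gt q1 _ _; exact: ltr01.
  by apply: filterS => n ->; case/andP: (q01 n).
(* a tent at [m] below the indicator of the interval of radius [eta] *)
pose g v := Num.max 0 (1 - `|v - m| / eta).
have g01 v : 0 <= g v <= 1.
  rewrite le_max lexx/= ge_max ler01/= gerBl divr_ge0// ltW//.
have eg : eventually0 g.
  split.
    move=> v; apply: (@continuous_max _ _ (fun=> 0) (fun v => 1 - `|v - m| / eta)).
      exact: cvg_cst.
    apply: cvgB; first exact: cvg_cst.
    apply: cvgM; last exact: cvg_cst.
    by apply: cvg_norm; apply: cvgB => //; exact: cvg_cst.
  exists (m + eta) => v mv; apply/max_idPl; rewrite subr_le0 ler_pdivlMr// mul1r.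
  by rewrite ger0_norm ?subr_ge0 ?lerBrDl// (le_trans _ mv)// lerDl ltW.
have mMn : \forall n \near \oo, measurable_fun setT (M n) /\ (forall w, 0 <= M n w).
  exact: nearW.
have := @laplace_cvg _ _ _ _ _ _ P M mMn _ _ P (fun=> m : R) g eg
  (measurable_cst _) (fun=> m0) lapM.
have -> : Ex P (fun=> g m) = 1.
  by rewrite Ex_cst /g subrr normr0 mul0r subr0 max_r.
have mI n : measurable [set w | `|M n w - m| < eta] by exact: measurable_dist_lt.
move=> cg; apply: (@squeeze_cvgr _ _ _ _ (fun n => Ex P (fun w => g (M n w))) (fun=> 1)).
- apply: nearW => n; apply/andP; split; last by case/andP: (fine_P01 P (mI n)).
  rewrite -[leRHS](Ex_indic P (mI n)); apply: Ex_le; [exact: bmf_eventually0|exact: bmf_indic|].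
  move=> w; have /andP[_ g1] := g01 (M n w); rewrite indicE.
  have [h|h] := ltP `|M n w - m| eta; first by rewrite mem_set.
  rewrite memNset/=; last by apply/negP; rewrite -leNgt.
  by rewrite /g ge_max lexx/= subr_le0 ler_pdivlMr// mul1r.
- exact: cg.
- exact: cvg_cst.
Qed.

End sums.

(** * Existence of a law with a given Laplace transform *)

Section ramp.
Context {R : realType}.
Implicit Types x y v : R.

(** Continuous functions that decrease, as [m] grows, to the indicator of
    [v <= x]. *)
Definition ramp x m v : R := Num.max 0 (Num.min 1 (1 - (v - x) * m.+1%:R)).

Lemma ramp01 x m v : 0 <= ramp x m v <= 1.
Proof. by rewrite /ramp le_max lexx/= ge_max ler01/= ge_min lexx. Qed.

Lemma ramp_low x m v : v <= x -> ramp x m v = 1.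
Proof.
move=> vx; rewrite /ramp min_l ?max_r// lerBrDr gerDl.
by rewrite mulr_le0_ge0// subr_le0.
Qed.

Lemma ramp_high x m v : x + m.+1%:R^-1 <= v -> ramp x m v = 0.
Proof.
move=> xv; apply/max_idPl; rewrite ge_min; apply/orP; right.
by rewrite subr_le0 -ler_pdivrMr ?ltr0n// div1r lerBrDl.
Qed.

Lemma continuous_ramp x m : continuous (ramp x m).
Proof.
move=> v; apply: (@continuous_max _ _ (fun=> 0)
  (fun v => Num.min 1 (1 - (v - x) * m.+1%:R))); first exact: cvg_cst.
apply: (@continuous_min _ _ (fun=> 1) (fun v => 1 - (v - x) * m.+1%:R)).
  exact: cvg_cst.
apply: cvgB; first exact: cvg_cst.
by apply: cvgM; [apply: cvgB => //; exact: cvg_cst|exact: cvg_cst].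
Qed.

Lemma eventually0_ramp x m : eventually0 (ramp x m).
Proof.
split; first exact: continuous_ramp.
by exists (x + m.+1%:R^-1) => v; exact: ramp_high.
Qed.

Lemma ramp_le x y m n v : x <= y -> (n <= m)%N -> ramp x m v <= ramp y n v.
Proof.
move=> xy nm; have [vx|xv] := leP v y.
  by rewrite (ramp_low n vx); case/andP: (ramp01 x m v).
have h : 1 - (v - x) * m.+1%:R <= 1 - (v - y) * n.+1%:R.
  rewrite lerD2l lerN2 ler_pM ?subr_ge0 ?(ltW xv)//; first by rewrite lerB.
  by rewrite ler_nat ltnS.
by rewrite /ramp le_max2// le_min2.
Qed.

Lemma ramp_lip x y m v : x <= y ->
  ramp y m v <= ramp x m v + (y - x) * m.+1%:R.
Proof.
move=> xy; have k0 : 0 <= (y - x) * m.+1%:R by rewrite mulr_ge0// subr_ge0.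
have /andP[r0 r1] := ramp01 x m v.
rewrite {1}/ramp ge_max; apply/andP; split; first by rewrite addr_ge0.
rewrite ge_min; have [xv|vx] := leP v x.
  by rewrite (ramp_low m xv) lerDl k0.
apply/orP; right; rewrite -lerBlDr /ramp le_max; apply/orP; right.
rewrite le_min; apply/andP; split; last by rewrite le_eqVlt; apply/orP; left; apply/eqP; ring.
have : 0 <= (v - x) * m.+1%:R by rewrite mulr_ge0// subr_ge0 ltW.
rewrite !mulrBl; lra.
Qed.

Lemma bmf_ramp d (T : measurableType d) (Y : T -> R) x m :
  measurable_fun setT Y -> bmf (fun w => ramp x m (Y w)).
Proof.
move=> mY; apply: bmf01 => [|w]; last exact: ramp01.
apply: measurableT_comp => //; apply: continuous_measurable_fun.
exact: continuous_ramp.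
Qed.

Lemma prob_le_ramp d (T : measurableType d) (P : probability T R) (Y : T -> R)
    x m : measurable_fun setT Y ->
  fine (P [set w | Y w <= x]) <= Ex P (fun w => ramp x m (Y w)).
Proof.
move=> mY; have mle := measurable_le_set x mY.
rewrite -Ex_indic//; apply: Ex_le; first exact: bmf_indic.
  exact: bmf_ramp.
move=> w; rewrite indicE; have /andP[r0 r1] := ramp01 x m (Y w).
have [h|h] := leP (Y w) x; first by rewrite mem_set// ramp_low.
by rewrite memNset//=; apply/negP; rewrite -ltNge.
Qed.

Lemma ramp_le_prob d (T : measurableType d) (P : probability T R) (Y : T -> R)
    x m : measurable_fun setT Y ->
  Ex P (fun w => ramp (x - m.+1%:R^-1) m (Y w)) <= fine (P [set w | Y w <= x]).
Proof.
move=> mY; have mle := measurable_le_set x mY.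
rewrite -Ex_indic//; apply: Ex_le; last 1 first.
- move=> w; rewrite indicE; have /andP[r0 r1] := ramp01 (x - m.+1%:R^-1) m (Y w).
  have [h|h] := leP (Y w) x; first by rewrite mem_set.
  by rewrite ramp_high// subrK ltW.
- exact: bmf_ramp.
- exact: bmf_indic.
Qed.

End ramp.

(** Gathers the estimates of the convergence of distribution functions: [p] is
    the probability at stage [n], [q1] and [q2] the averages of the ramps below
    and above, [lk] and [lz] their limits, [fk] and [fz] the values of the limiting
    distribution function. *)
Lemma sandwich (R : realType) (p q1 q2 fz fk lz lk e : R) :
  p <= q2 -> q1 <= p -> fk <= lk -> lz < fz + e / 2 -> fz - e / 2 <= fk ->
  - (e / 2) <= lz - q2 -> lk - q1 <= e / 2 -> - e <= fz - p <= e.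
Proof. by move=> *; apply/andP; split; lra. Qed.

Section continuity_theorem.
Context {R : realType} d {T : measurableType d} (P : probability T R).
Variables (Y : nat -> T -> R) (phi : R -> R).
Hypothesis mY : forall n, measurable_fun setT (Y n).
Hypothesis Y0 : forall n w, 0 <= Y n w.
Hypothesis Yphi : forall r, 0 <= r ->
  laplace P (Y n) r @[n --> \oo] --> phi r.
Hypothesis phi1 : phi x^-1 @[x --> +oo] --> (1 : R).

Let L x m : R := lim (Ex P (fun w => ramp x m (Y n w)) @[n --> \oo]).

(** The limiting distribution function; as an infimum of limits of continuous
    upper bounds it is right-continuous. *)
Let F (x : R) : R := inf (range (L x)).

Let bR x m n : bmf (fun w => ramp x m (Y n w)).
Proof. exact: bmf_ramp. Qed.

Let L_cvg x m : Ex P (fun w => ramp x m (Y n w)) @[n --> \oo] --> L x m.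
Proof.
apply: (@laplace_is_cvg _ _ _ _ _ _ P Y _ (ramp x m) (fun k => phi k%:R)).
- by apply: nearW => n; split.
- exact: eventually0_ramp.
- by move=> k; exact: Yphi.
Qed.

Let L_le x m (c : R) :
  (\forall n \near \oo, Ex P (fun w => ramp x m (Y n w)) <= c) -> L x m <= c.
Proof. by move=> h; apply: limr_le => //; apply/cvg_ex; exists (L x m); exact: L_cvg. Qed.

Let L_ge x m (c : R) :
  (\forall n \near \oo, c <= Ex P (fun w => ramp x m (Y n w))) -> c <= L x m.
Proof. by move=> h; apply: limr_ge => //; apply/cvg_ex; exists (L x m); exact: L_cvg. Qed.

Let L01 x m : 0 <= L x m <= 1.
Proof.
apply/andP; split.
  by apply: L_ge; apply: nearW => n; apply: Ex_ge0 => w; case/andP: (ramp01 x m (Y n w)).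
apply: L_le; apply: nearW => n; rewrite -[leRHS](Ex_cst P); apply: Ex_le => //.
  exact: bmf_cst.
by move=> w; case/andP: (ramp01 x m (Y n w)).
Qed.

Let L_mono x y m n (c : R) : (forall v, ramp x m v <= ramp y n v + c) ->
  L x m <= L y n + c.
Proof.
move=> h; have c1 := @L_cvg x m.
have c2 : Ex P (fun w => ramp y n (Y k w)) + c @[k --> \oo] --> L y n + c.
  exact: (cvgD (@L_cvg y n) (cvg_cst c)).
apply: ler_cvg_to c1 c2 _; apply: nearW => k.
rewrite -[X in _ + X](Ex_cst P) -ExD//; last exact: bmf_cst.
by apply: Ex_le => //; apply: bmfD => //; exact: bmf_cst.
Qed.

Let F_le x m : F x <= L x m.
Proof.
apply: ge_inf; last by exists m.
by exists 0 => _ [k _ <-]; case/andP: (L01 x k).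
Qed.

Let F_ge x (c : R) : (forall m, c <= L x m) -> c <= F x.
Proof.
move=> h; apply: lb_le_inf; first by exists (L x 0), 0%N.
by move=> _ [k _ <-].
Qed.

Let F_lt x (c : R) : F x < c -> exists m, L x m < c.
Proof.
move=> h; have ne : range (L x) !=set0 by exists (L x 0), 0%N.
by have [_ [m _ <-] mc] := inf_lt ne h; exists m.
Qed.

Let F_nd : nondecreasing F.
Proof.
move=> x y xy; apply: F_ge => m; apply: (le_trans (F_le x m)).
rewrite -[leRHS]addr0; apply: L_mono => v; rewrite addr0; exact: ramp_le.
Qed.

Let F_rc : right_continuous F.
Proof.
move=> x; apply/cvgrPdist_le => e e0.
have [m Lm] : exists m, L x m < F x + e / 2.
  by apply: F_lt; rewrite ltrDl divr_gt0.
have m0 : 0 < m.+1%:R :> R by rewrite ltr0n.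
near=> y.
have xy : x <= y by near: y; exact: nbhs_right_ge.
have yx : y <= x + e / 2 / m.+1%:R.
  by near: y; apply: nbhs_right_le; rewrite ltrDl !divr_gt0.
rewrite distrC ger0_norm ?subr_ge0 ?F_nd// lerBlDr.
have h : L y m <= L x m + (y - x) * m.+1%:R.
  by apply: L_mono => v; exact: ramp_lip.
have h2 : (y - x) * m.+1%:R <= e / 2 by rewrite -ler_pdivlMr// lerBlDl.
apply: (le_trans (F_le y m)); apply: (le_trans h).
have -> : e + F x = F x + e / 2 + e / 2 by rewrite -addrA -splitr addrC.
by rewrite lerD// ltW.
Unshelve. all: by end_near. Qed.

Let F_lt0 x : x < 0 -> F x = 0.
Proof.
move=> x0; apply/eqP; rewrite eq_le; apply/andP; split; last first.
  by apply: F_ge => m; case/andP: (L01 x m).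
pose m := Num.truncn (- x)^-1.
apply: (le_trans (F_le x m)); apply: L_le; apply: nearW => n.
rewrite -[leRHS](Ex_cst P); apply: Ex_le => //; first exact: bmf_cst.
move=> w; rewrite ramp_high// (le_trans _ (Y0 n w))//.
rewrite -lerBrDl sub0r invf_ple ?posrE ?oppr_gt0//.
by rewrite ltW// truncnS_gt.
Qed.

Let F_Ny : F @ -oo --> (0 : R).
Proof.
apply: cvg_near_cst; exists 0; split; first exact: num_real.
by move=> x x0; exact: F_lt0.
Qed.

(** Tightness: the indicator of [x < v] is at most
    [(1 - expR (- v / x)) / (1 - expR (- 1))]. *)
Let F_y : F @ +oo --> (1 : R).
Proof.
have e1 : 0 < 1 - expR (- 1) :> R by rewrite subr_gt0 expR_lt1 ltrN10.
apply: (@squeeze_cvgr _ _ _ _ (fun x => 1 - (1 - phi x^-1) / (1 - expR (- 1))) (fun=> 1)).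
- have : \forall x \near +oo, (0 : R) < x by apply: nbhs_pinfty_gt; exact: num_real.
  apply: filterS => x x0; apply/andP; split; last first.
    by apply: (le_trans (F_le x 0)); case/andP: (L01 x 0).
  apply: F_ge => m.
  have c1 : 1 - (1 - laplace P (Y n) x^-1) / (1 - expR (- 1)) @[n --> \oo] -->
      1 - (1 - phi x^-1) / (1 - expR (- 1)).
    apply: cvgB; first exact: cvg_cst.
    apply: cvgM; last exact: cvg_cst.
    by apply: cvgB; [exact: cvg_cst|apply: Yphi; rewrite invr_ge0 ltW].
  apply: ler_cvg_to c1 (@L_cvg x m) _; apply: nearW => n.
  have bl : bmf (fun w => expR (- (x^-1 * Y n w))).
    by apply: bmf_laplace => //; rewrite invr_ge0 ltW.
  have b1 : bmf ((fun=> 1) : T -> R) by exact: bmf_cst.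
  have bl1 : bmf (fun w => 1 - expR (- (x^-1 * Y n w))) by exact: bmfB.
  have -> : 1 - (1 - laplace P (Y n) x^-1) / (1 - expR (- 1)) =
      Ex P (fun w => 1 - (1 - expR (- 1))^-1 * (1 - expR (- (x^-1 * Y n w)))).
    rewrite ExB//; last exact: bmfZ.
    by rewrite ExZ// ExB// !Ex_cst mulrC.
  apply: Ex_le => //; first by apply: bmfB => //; exact: bmfZ.
  move=> w; have [vx|xv] := leP (Y n w) x.
    rewrite ramp_low// gerBl mulr_ge0 ?invr_ge0 ?(ltW e1)// subr_ge0 expR_le1.
    by rewrite oppr_le0 mulr_ge0// invr_ge0 ltW.
  have /andP[+ _] := ramp01 x m (Y n w); apply: le_trans.
  rewrite subr_le0 ler_pdivlMl// mulr1 lerB// ler_expR lerN2.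
  by rewrite mulrC ler_pdivlMr// mul1r ltW.
- rewrite -[X in _ --> X](subr0 1) -(mul0r (1 - expR (- 1))^-1) -[X in X / _](subrr 1).
  apply: cvgB; first exact: cvg_cst.
  apply: cvgM; last exact: cvg_cst.
  by apply: cvgB => //; exact: cvg_cst.
- exact: cvg_cst.
Qed.

#[local] HB.instance Definition _ := isCumulative.Build R _ R F F_nd F_rc.
#[local] HB.instance Definition _ := isCumulativeBounded.Build R 0 1 F F_Ny F_y.

Let Q : probability _ R := lebesgue_stieltjes_measure F.

Let Fcdf x : Q `]-oo, x]%classic = (F x)%:E.
Proof. exact: (cdf_lebesgue_stieltjes_id F x). Qed.

Let F_left z (e : R) : Q [set z] = 0%E -> 0 < e ->
  exists m : nat, F z - e <= F (z - m.+1%:R^-1).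
Proof.
move=> Qz e0; have Fle y : fine (Q [set v : R | v <= y]) = F y.
  rewrite -[RHS]/(fine (F y)%:E) -Fcdf; congr (fine (Q _)).
have [m] := @cdf_left _ _ _ Q idfun z e (@measurable_id _ _ setT) Qz e0.
by rewrite !Fle => h; exists m.
Qed.

(** The distribution functions converge to [F] off the atoms of the law of
    distribution function [F], so that law has the limiting transform.  The
    variable is truncated at 0 to be nonnegative everywhere. *)
Theorem laplace_limit_law :
  exists (Q : probability (measurableTypeR R) R) (S : {RV Q >-> R}),
    (forall w, 0 <= S w) /\
    (forall r, 0 <= r -> laplace Q S r = phi r).
Proof.
have mS : measurable_fun (setT : set (measurableTypeR R)) (fun v : R => Num.max v 0).
  by apply: measurable_maxr => //; exact: measurable_cst.
pose S : {RV Q >-> R} := HB.pack (fun v : R => Num.max v 0)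
  (isMeasurableFun.Build _ _ _ _ _ mS).
exists Q, S; split; first by move=> w; rewrite /= le_max lexx orbT.
move=> r r0; have c1 := Yphi r0.
suff c2 : laplace P (Y n) r @[n --> \oo] --> laplace Q S r.
  exact: (cvg_unique _ c2 c1).
apply: cdf_cvg_laplace => //; first by move=> w; rewrite /= le_max lexx orbT.
move=> z z0 Sz0.
have Qz0 : Q [set z] = 0%E.
  rewrite -Sz0; congr (Q _); apply/seteqP; split => v /=.
    by move=> ->; rewrite max_l// ltW.
  move=> h; have [v0|v0] := leP v 0; last by rewrite -h max_l// ltW.
  by move: h z0; rewrite max_r// => <-; rewrite ltxx.
have tQ : tailP Q S z = 1 - F z.
  rewrite tailPE//; congr (1 - _); rewrite -[RHS]/(fine (F z)%:E) -Fcdf.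
  congr (fine (Q _)); apply/seteqP; split => v /=; rewrite in_itv/= ge_max.
    by move=> /andP[].
  by move=> ->; rewrite ltW.
rewrite tQ; under eq_fun do rewrite tailPE//.
apply: cvgB; first exact: cvg_cst.
apply/cvgrPdist_le => e e0; have e20 : 0 < e / 2 by rewrite divr_gt0.
have [m Lm] : exists m, L z m < F z + e / 2 by apply: F_lt; rewrite ltrDl.
have [k Fk] := F_left Qz0 e20.
have /cvgrPdist_le/(_ _ e20) cm := @L_cvg z m.
have /cvgrPdist_le/(_ _ e20) ck := @L_cvg (z - k.+1%:R^-1) k.
apply: filterS2 cm ck => n; rewrite !ler_norml => /andP[cm1 _] /andP[_ ck1].
have up := prob_le_ramp P z m (mY n).
have low := ramp_le_prob P z k (mY n).
have Lk := F_le (z - k.+1%:R^-1) k.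
exact: (sandwich up low Lk Lm Fk cm1 ck1).
Qed.

End continuity_theorem.

(** * Sample sizes in a given ratio to time *)

(** Convergence along this filter means: [t] tends to infinity and [n / t] to
    [lam], jointly. *)
Definition ratio_filter (R : realType) (lam : R) : set_system (R * nat) :=
  fun U => exists e M : R, 0 < e /\
    forall t n, M < t -> `|n%:R / t - lam| < e -> U (t, n).

Section ratio_filter.
Context {R : realType}.
Implicit Types lam : R.

Lemma ratio_filter_filter lam : Filter (ratio_filter lam).
Proof.
split.
- by exists 1, 0; split.
- move=> U V [e1 [M1 [e10 h1]]] [e2 [M2 [e20 h2]]].
  exists (Num.min e1 e2), (Num.max M1 M2); split; first by rewrite lt_min e10.
  move=> t n; rewrite gt_max => /andP[t1 t2]; rewrite lt_min => /andP[n1 n2].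
  by split; [exact: h1|exact: h2].
- move=> U V UV [e [M [e0 h]]]; exists e, M; split => // t n tM ne.
  by apply: UV; exact: h.
Qed.

Lemma ratio_filter_proper lam : 0 < lam -> ProperFilter (ratio_filter lam).
Proof.
move=> lam0; apply: Build_ProperFilter_ex; last exact: ratio_filter_filter.
move=> U [e [M [e0 h]]].
pose t : R := `|M| + 1 + e^-1; pose n := Num.truncn (lam * t).
have t0 : 0 < t by rewrite /t ltr_wpDr ?invr_ge0 ?(ltW e0)// ltr_wpDl.
have lt0 : 0 <= lam * t by rewrite mulr_ge0 ?ltW.
exists (t, n); apply: h.
  rewrite (le_lt_trans (ler_norm M))// /t -addrA ltrDl.
  by rewrite ltr_wpDr// invr_ge0 ltW.
have /andP[n1 n2] := truncn_itv lt0.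
rewrite distrC ger0_norm; last by rewrite subr_ge0 ler_pdivrMr.
rewrite -(ltr_pM2r t0) mulrBl divfK ?gt_eqF//.
rewrite (@lt_le_trans _ _ 1)//; last first.
  by rewrite /t mulrDr mulfV ?gt_eqF// lerDr mulr_ge0 ?(ltW e0)// addr_ge0.
by rewrite ltrBlDr addrC natr1.
Qed.

Lemma ratio_filter_fst lam : t.1 @[t --> ratio_filter lam] --> +oo.
Proof.
move=> U [M [_ MU]]; exists 1, M; split => // t n tM _; exact: MU.
Qed.

Lemma ratio_filter_ratio lam : t.2%:R / t.1 @[t --> ratio_filter lam] --> lam.
Proof.
move=> U /nbhs_ballP[e /= e0 eU]; exists e, 0; split => // t n _ ne.
by apply: eU; rewrite /ball/= distrC.
Qed.

Lemma ratio_filter_snd lam : 0 < lam -> t.2 @[t --> ratio_filter lam] --> \oo.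
Proof.
move=> lam0 U [N _ NU]; exists (lam / 2), (2 * N%:R / lam + 1); split.
  by rewrite divr_gt0.
move=> t n tM ne; apply: NU => /=.
have t0 : 0 < t by rewrite (le_lt_trans _ tM)// addr_ge0// divr_ge0 ?mulr_ge0// ltW.
have : lam / 2 < n%:R / t.
  by move: ne; rewrite ltr_norml => /andP[+ _]; lra.
rewrite ltr_pdivlMr// => h; rewrite -(ler_nat R) ltW//.
apply: le_lt_trans h; rewrite mulrAC ler_pdivlMr// mulrC -ler_pdivrMl//.
by rewrite [leLHS]mulrC; apply: ltW; apply: lt_trans _ tM; rewrite ltrDl.
Qed.

End ratio_filter.

(** * Random sample sizes *)

Section random_size.
Context {R : realType} d {T : measurableType d} (P : probability T R).
Variables (N : R -> T -> nat).
Context d' {T' : measurableType d'} (P' : probability T' R) (Lam : {RV P' >-> R}).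
Hypothesis mN : forall t, 0 <= t -> measurable_fun setT (N t).
Hypothesis avN : averages_in_time P N P' Lam.

(** [Lam] is only almost surely positive; its positive part is a version that is
    nonnegative everywhere. *)
Let Z w := Num.max (Lam w) 0.

Let Lpos : P' [set w | 0 < Lam w] = 1%E. Proof. by case: avN. Qed.

Lemma Lam_ae_gt0 : {ae P', forall w, 0 < Lam w}.
Proof.
have mL : measurable_fun setT Lam by [].
exists (~` [set w | 0 < Lam w]); split => //.
  by apply: measurableC; exact: measurable_gt_set.
rewrite probability_setC; last exact: measurable_gt_set.
by rewrite Lpos subee.
Qed.

Let mZ : measurable_fun setT Z.
Proof. by apply: measurable_maxr => //; exact: measurable_cst. Qed.

Let mNt t : 0 <= t -> measurable_fun setT (fun w => (N t w)%:R / t : R).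
Proof.
move=> t0; apply: measurable_funM => //.
by apply: (measurableT_comp (f := fun n : nat => n%:R : R)) => //; exact: mN.
Qed.

Lemma laplace_time_average (k : nat) :
  laplace P (fun w => (N t w)%:R / t) k%:R @[t --> +oo] --> laplace P' Z k%:R.
Proof.
have mL : measurable_fun setT Lam by [].
apply/cvg_pinftyP => u u_oo.
have [n0 _ Hn0] : \forall n \near \oo, 0 < u n.
  by apply: (@u_oo (fun x => 0 < x)); apply: nbhs_pinfty_gt; exact: num_real.
rewrite -(cvg_shiftn n0); pose t n := u (n + n0)%N.
have t0 n : 0 < t n by apply: Hn0; rewrite /= leq_addl.
have t_oo : t n @[n --> \oo] --> +oo by move: u_oo; rewrite -(cvg_shiftn n0).
pose ZZ : {RV P' >-> R} := HB.pack Z (isMeasurableFun.Build _ _ _ _ _ mZ).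
apply: (@cdf_cvg_laplace _ _ _ _ _ _ _ (fun n w => (N (t n) w)%:R / t n) ZZ) => //.
- by move=> n; apply: mNt; exact: ltW.
- by move=> n w; rewrite divr_ge0// ltW.
- by move=> w; rewrite /= /Z le_max lexx orbT.
move=> z z0 Zz.
have Lz : P' (Lam @^-1` [set z]) = 0%E.
  rewrite -Zz; congr (P' _); apply/seteqP; split => w /=; rewrite /Z.
    by move=> ->; rewrite max_l// ltW.
  move=> h; have [v0|v0] := leP (Lam w) 0; last by rewrite -h max_l// ltW.
  by move: h z0; rewrite max_r// => <-; rewrite ltxx.
have tZ : tailP P' ZZ z = 1 - fine (P' [set w | Lam w <= z]).
  rewrite tailPE//; congr (1 - fine (P' _)); apply/seteqP; split => w /=; rewrite /Z ge_max.
    by move=> /andP[].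
  by move=> ->; rewrite ltW.
have tN n : tailP P (fun w => (N (t n) w)%:R / t n) z =
    1 - fine (P [set w | (N (t n) w)%:R / t n <= z]).
  by rewrite tailPE//; apply: mNt; exact: ltW.
rewrite tZ; under eq_fun do rewrite tN.
apply: cvgB; first exact: cvg_cst.
apply: fine_cvg; rewrite fineK; last first.
  by apply: fin_num_measure; exact: measurable_le_set.
have [_ h] := avN; have {}h := h z (cdf_continuous mL Lz).
exact: (cvg_comp _ _ t_oo h).
Qed.

(** The convergence of [K] along the ratio filters is a locally uniform
    convergence in the ratio [n / t], as the mapping theorem requires. *)
Lemma random_size_cvg (K : R -> nat -> R) (H : R -> R) :
  (forall t n, 0 <= K t n <= 1) -> measurable_fun setT H ->
  (forall x, 0 <= H x <= 1) -> (forall x, 0 < x -> {for x, continuous H}) ->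
  (forall lam, 0 < lam -> K p.1 p.2 @[p --> ratio_filter lam] --> H lam) ->
  Ex P (fun w => K t (N t w)) @[t --> +oo] --> Ex P' (fun w => H (Lam w)).
Proof.
move=> K01 mH H01 cH KH.
have t0 : \forall t \near +oo, (0 : R) < t.
  by apply: nbhs_pinfty_gt; exact: num_real.
have mY : \forall t \near +oo, measurable_fun setT (fun w => (N t w)%:R / t) /\
    (forall w, 0 <= (N t w)%:R / t :> R).
  apply: filterS t0 => t t1; split; first by apply: mNt; exact: ltW.
  by move=> w; rewrite divr_ge0// ltW.
have Z0 w : 0 <= Z w by rewrite /Z le_max lexx orbT.
have -> : Ex P' (fun w => H (Lam w)) = Ex P' (fun w => H (Z w)).
  apply: Ex_as.
  - by apply: bmf01 => //; exact: measurableT_comp.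
  - by apply: bmf01 => //; exact: measurableT_comp.
  - by apply: filterS Lam_ae_gt0 => w L0; rewrite /Z max_l// ltW.
(* the mapping theorem is used with a constant second sequence *)
apply: (@mapping_cvg _ _ _ _ _ _ P (fun t w => (N t w)%:R / t) _ _ _ P' Z H 0
  (fun _ _ => 0) 0 setT) => //.
- by apply: filterS Lam_ae_gt0 => w L0; rewrite /Z max_l// ltW.
- by move=> g eg; apply: laplace_cvg => // k; exact: laplace_time_average.
- apply: filterS t0 => t t1; split => //.
  by apply: (measurableT_comp (f := K t)) => //; apply: mN; exact: ltW.
- exact: measurableT_comp.
- by rewrite probability_setT.
- exact: nearW.
- move=> eta eta0; apply: cvg_near_cst; apply: nearW => t.
  rewrite (_ : [set w | _] = setT) ?probability_setT//.
  by apply/seteqP; split => // w _ /=; rewrite subrr normr0.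
move=> e lam e0 lam0; have e20 : 0 < e / 2 by rewrite divr_gt0.
have FF := ratio_filter_proper lam0.
have /cvgrPdist_le/(_ _ e20) := KH _ lam0.
move=> [e1 [M [e10 hK]]].
have hH : \forall l \near lam, `|H lam - H l| <= e / 2.
  by have /cvgrPdist_le := cH _ lam0; apply.
have hb : \forall l \near lam, `|l - lam| < e1.
  by apply/nbhs_ballP; exists e1 => //= l; rewrite /ball/= distrC.
have hM : \forall t \near +oo, M < t by apply: nbhs_pinfty_gt; exact: num_real.
exists ([set l | `|H lam - H l| <= e / 2 /\ `|l - lam| < e1], [set j | M < j.2]).
  split => /=; first exact: filterI.
  exists (setT, [set t | M < t]); first by split => //; exact: filterT.
  by move=> [u v] /= [].
move=> [l [w1 t]] /= [[h1 h2] Mt] w _ _ Nl.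
have := hK t (N t w) Mt; rewrite Nl => /(_ h2) /= h3.
rewrite [e]splitr (le_trans (ler_distD (H lam) _ _))// lerD//.
by rewrite distrC.
Qed.

End random_size.

(** * Product laws and limits in law *)

Lemma Ex01 (R : realType) d (T : measurableType d) (P : probability T R)
    (f : T -> R) : measurable_fun setT f -> (forall x, 0 <= f x <= 1) ->
  0 <= Ex P f <= 1.
Proof.
move=> mf f01; apply/andP; split; first by apply: Ex_ge0 => x; case/andP: (f01 x).
rewrite -[leRHS](Ex_cst P); apply: Ex_le; [exact: bmf01|exact: bmf_cst|].
by move=> x; case/andP: (f01 x).
Qed.

Section product.
Context {R : realType} d1 d2 {T1 : measurableType d1} {T2 : measurableType d2}.
Variables (P1 : probability T1 R) (P2 : probability T2 R) (h : T1 * T2 -> R).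
Hypothesis mh : measurable_fun setT h.
Hypothesis h01 : forall z, 0 <= h z <= 1.

Let h0 z : (0 <= (EFin \o h) z)%E.
Proof. by rewrite lee_fin; case/andP: (h01 z). Qed.

Let mEh : measurable_fun setT (EFin \o h).
Proof. exact/measurable_EFinP. Qed.

Let bh x : bmf (fun y => h (x, y)).
Proof. by apply: bmf01 => //; apply: (measurableT_comp mh); exact: measurable_pair1. Qed.

Lemma measurable_Ex : measurable_fun setT (fun x => Ex P2 (fun y => h (x, y))).
Proof.
apply/measurable_EFinP.
have := @measurable_fun_fubini_tonelli_F _ _ _ _ _ P2 _ mEh h0.
by apply: eq_measurable_fun => x _; rewrite /fubini_F /= EFin_Ex.
Qed.

Lemma Ex_product : Ex (P1 \x P2)%E h = Ex P1 (fun x => Ex P2 (fun y => h (x, y))).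
Proof.
apply: EFin_inj; rewrite !EFin_Ex//; last 2 first.
- apply: bmf01; first exact: measurable_Ex.
  by move=> x; apply: Ex01 => //; case: (bh x).
- exact: bmf01.
rewrite (@fubini_tonelli1 _ _ _ _ _ P1 P2 (EFin \o h) mEh h0).
by apply: eq_integral => x _; rewrite /fubini_F /= EFin_Ex.
Qed.

End product.

Lemma continuous_powRl (R : realType) (p x : R) : 0 < x ->
  {for x, continuous (fun y : R => y `^ p)}.
Proof.
have E (y : R) : 0 < y -> y `^ p = expR (p * ln y).
  by move=> y0; rewrite /powR gt_eqF.
move=> x0; rewrite /prop_for /continuous_at [X in _ --> X]E//.
have h : expR (p * ln y) @[y --> x] --> expR (p * ln x).
  apply: continuous_cvg; first exact: continuous_expR.
  by apply: cvgM; [exact: cvg_cst|exact: continuous_ln].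
apply: cvg_trans h; apply: near_eq_cvg.
have : \forall y \near x, 0 < y by exact: (lt_nbhsr x0).
by apply: filterS => y y0; rewrite E.
Qed.

(** Quantities squeezed between two shifted distribution functions, like the
    averages of the ramps, are enough to identify a limit in law. *)
Lemma cvg_in_law_squeeze (R : realType) d d' (T : measurableType d)
    (T' : measurableType d') (P : probability T R) (Q : probability T' R)
    (Y : R -> T -> R) (Z : T' -> R) (E : R -> nat -> R -> R) :
  measurable_fun setT Z ->
  (forall x, \forall t \near +oo, measurable [set w | Y t w <= x]) ->
  (forall x k, E x k t @[t --> +oo] --> Ex Q (fun w => ramp x k (Z w))) ->
  (forall x k, \forall t \near +oo, fine (P [set w | Y t w <= x]) <= E x k t) ->
  (forall x k, \forall t \near +oo,
     E (x - k.+1%:R^-1) k t <= fine (P [set w | Y t w <= x])) ->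
  cvg_in_law P Y Q Z.
Proof.
move=> mZ mY EZ YE EY x cx.
have mPZ y : measurable [set w | Z w <= y] by exact: measurable_le_set.
have finZ y : Q [set w | Z w <= y] \is a fin_num by exact: fin_num_measure.
rewrite -(fineK (finZ x)); apply: cvg_EFin.
  by apply: filterS (mY x) => t mt; exact: fin_num_measure.
apply/cvgrPdist_le => e e0; have e20 : 0 < e / 2 by rewrite divr_gt0.
have {}cx : fine (Q [set w | Z w <= y]) @[y --> x] --> fine (Q [set w | Z w <= x]).
  by apply: fine_cvg; rewrite fineK//; exact: cx.
have /cvgrPdist_le/(_ _ e20)/nbhs_ballP[del /= del0 hdel] := cx.
pose k := Num.truncn del^-1.
have kdel : k.+1%:R^-1 < del.
  by rewrite invf_plt ?posrE ?ltr0n// truncnS_gt.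
have k0 : 0 < k.+1%:R^-1 :> R by rewrite invr_gt0 ltr0n.
have hup := hdel (x + k.+1%:R^-1).
have hlow := hdel (x - k.+1%:R^-1).
rewrite /ball/= in hup hlow.
have cup := EZ x k; have clow := EZ (x - k.+1%:R^-1) k.
move/cvgrPdist_le/(_ _ e20) : cup => cup; move/cvgrPdist_le/(_ _ e20) : clow => clow.
apply: filterS2 (filterI (YE x k) (EY x k)) (filterI cup clow) => t [hp2 hp1] [].
rewrite !ler_norml => /andP[up1 _] /andP[_ low1].
have hz2 := ramp_le_prob Q (x + k.+1%:R^-1) k mZ; rewrite addrK in hz2.
have hz1 := prob_le_ramp Q (x - k.+1%:R^-1) k mZ.
move: hup; rewrite opprD addrA subrr sub0r normrN (gtr0_norm k0) => /(_ kdel).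
rewrite ler_norml => /andP[hup _].
move: hlow; rewrite opprB addrC subrK (gtr0_norm k0) => /(_ kdel).
rewrite ler_norml => /andP[_ hlow].
apply/andP; split; lra.
Qed.

(** * The sample coefficient of variation *)

Section sample.
Context {R : realType}.

(** The variance is the mean of the squares minus the square of the mean.  The
    time [t] is inserted so that each factor of the second term has a limit; with
    absolute values the mean is nonnegative on the whole probability space. *)
Lemma CoVar_scaled (x : nat -> R) (n : nat) (s t : R) : (0 < n)%N -> 0 < s ->
  0 < t -> (forall i, 0 < x i) ->
  Num.sqrt n%:R / s * sample_CoVar x n =
  Num.sqrt ((\sum_(i < n) x i ^+ 2) / s ^+ 2 -
            n%:R / t * (t / s ^+ 2) * ((\sum_(i < n) `|x i|) / n%:R) ^+ 2) /
  ((\sum_(i < n) `|x i|) / n%:R).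
Proof.
move=> n0 s0 t0 x0; have nR0 : n%:R != 0 :> R by rewrite pnatr_eq0 -lt0n.
have nRp : 0 < n%:R :> R by rewrite ltr0n.
have -> : \sum_(i < n) `|x i| = \sum_(i < n) x i.
  by apply: eq_bigr => i _; rewrite gtr0_norm.
rewrite /sample_CoVar mulrA -/(sample_mean x n); congr (_ / _).
set m := sample_mean x n.
have sx : \sum_(i < n) x i = n%:R * m by rewrite /m /sample_mean mulrC divfK.
have varE : sample_variance x n = (\sum_(i < n) x i ^+ 2) / n%:R - m ^+ 2.
  rewrite /sample_variance -/m.
  under eq_bigr do rewrite sqrrB.
  rewrite big_split/= sumrB sumrMnl -mulr_suml sx sumr_const card_ord.
  by rewrite -[_ *+ n]mulr_natl -[_ *+ 2]mulr_natl; field.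
have s20 : 0 <= s^-1 ^+ 2 by rewrite sqr_ge0.
have -> : Num.sqrt n%:R / s = Num.sqrt (n%:R * s^-1 ^+ 2).
  by rewrite sqrtrM ?ler0n// sqrtr_sqr ger0_norm// invr_ge0 ltW.
have np : 0 <= n%:R * s^-1 ^+ 2 :> R by rewrite mulr_ge0.
rewrite -sqrtrM// varE; apply: f_equal.
by field; rewrite !gt_eqF.
Qed.

End sample.

Section CoVar_limit.
Context {R : realType} d {T : measurableType d} (P : probability T R).
Variables (X : T -> R) (Xs : nat -> T -> R) (alpha : R) (a : R -> R).
Hypothesis mX : measurable_fun setT X.
Hypothesis mXs : forall i, measurable_fun setT (Xs i).
Hypothesis copies : forall i, same_law P P (Xs i) X.
Hypothesis indep : mutually_independent P Xs.
Hypothesis Xpos : P [set w | 0 < X w] = 1%E.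
Hypothesis alpha02 : 0 < alpha < 2.
Local Notation G := (tailP P (fun w => `|X w|)).
Hypothesis Gpos : \forall x \near +oo, 0 < G x.
Hypothesis Grv : forall c : R, 0 < c ->
  G (c * x) / G x @[x --> +oo] --> c `^ (- alpha).
Hypothesis a_oo : a t @[t --> +oo] --> +oo.
Hypothesis Ga : t * G (a t) @[t --> +oo] --> (1 : R).
Hypothesis iX : P.-integrable setT (EFin \o (fun w => `|X w|)).
Local Notation beta := (alpha / 2).
Local Notation m := (\int[P]_w `|X w|).
Hypothesis m0 : 0 < m.

Let q (r : R) (t : R) := laplace P (fun w => X w ^+ 2) (r / a t ^+ 2).

Let q_norming (r : R) : 0 < r ->
  t * (1 - q r t) @[t --> +oo] --> r `^ beta * Gamma (1 - beta).
Proof.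
move=> r0; have maX : measurable_fun setT (fun w => `|X w|) by exact: measurableT_comp.
have := @laplace_sqr_norming R d T P (fun w => `|X w|) alpha a maX
  (fun=> normr_ge0 _) alpha02 Gpos Grv a_oo Ga r r0.
have e : (fun w => `|X w| ^+ 2) = (fun w => X w ^+ 2).
  by apply/funext => w; rewrite real_normK ?num_real.
by rewrite e.
Qed.

Definition sqsum (p : R * nat) (w : T) : R :=
  (\sum_(i < p.2) Xs i w ^+ 2) / a p.1 ^+ 2.

Lemma measurable_sqsum p : measurable_fun setT (sqsum p).
Proof.
by apply: measurable_funM => //; apply: measurable_sum => i; exact: measurable_funX.
Qed.

Lemma sqsum_ge0 p w : 0 <= sqsum p w.
Proof. by rewrite divr_ge0 ?sqr_ge0// sumr_ge0// => i _; rewrite sqr_ge0. Qed.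

Lemma laplace_sqsum p (r : R) : 0 <= r -> laplace P (sqsum p) r = q r p.1 ^+ p.2.
Proof.
move=> r0; have rs0 : 0 <= r / a p.1 ^+ 2 by rewrite divr_ge0// sqr_ge0.
rewrite /q -(@laplace_sum _ _ _ P X Xs mX mXs copies indep (fun x => x ^+ 2))//; last first.
  by move=> x; rewrite sqr_ge0.
by apply: eq_Ex => w; congr expR; rewrite /sqsum; ring.
Qed.

Let q01 (r t : R) : 0 <= r -> 0 <= q r t <= 1.
Proof.
move=> r0; apply: laplace_ge0_le1.
- by rewrite divr_ge0// sqr_ge0.
- exact: measurable_funX.
- by move=> w; rewrite sqr_ge0.
Qed.

Lemma cvg_inv_pinfty : x^-1 @[x --> +oo] --> (0 : R).
Proof.
have := @cvg_powRN_pinfty R 1 ltr01; apply: cvg_trans; apply: near_eq_cvg.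
have : \forall x \near +oo, (0 : R) <= x by apply: nbhs_pinfty_ge; exact: num_real.
by apply: filterS => x x0; rewrite powR_inv1.
Qed.

(** The [n]-th power of [q] with [n * (1 - q)], that is [n / t] times
    [t * (1 - q)], converging. *)
Lemma laplace_sqsum_cvg (lam r : R) : 0 < lam -> 0 <= r ->
  laplace P (sqsum p) r @[p --> ratio_filter lam] -->
  expR (- (lam * (r `^ beta * Gamma (1 - beta)))).
Proof.
move=> lam0 r0; have FF := ratio_filter_proper lam0.
have be0 : beta != 0 by rewrite gt_eqF// divr_gt0//; case/andP: alpha02.
under eq_fun do rewrite laplace_sqsum//.
move: r0; rewrite le_eqVlt => /predU1P[<-|r0].
  rewrite powR0// mul0r mulr0 oppr0 expR0; apply: cvg_near_cst; apply: nearW => p.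
  rewrite /q mul0r (_ : laplace _ _ _ = 1) ?expr1n//.
  by rewrite /laplace -[RHS](Ex_cst P); apply: eq_Ex => w; rewrite mul0r oppr0 expR0.
have qF : p.1 * (1 - q r p.1) @[p --> ratio_filter lam] -->
    r `^ beta * Gamma (1 - beta).
  exact: (cvg_comp _ _ (@ratio_filter_fst _ lam) (q_norming r0)).
have t0 : \forall p \near ratio_filter lam, 0 < p.1.
  by apply: (@ratio_filter_fst _ lam (fun x => 0 < x)); apply: nbhs_pinfty_gt; exact: num_real.
have q1 : q r p.1 @[p --> ratio_filter lam] --> (1 : R).
  have i0 : p.1^-1 @[p --> ratio_filter lam] --> (0 : R).
    exact: (cvg_comp _ _ (@ratio_filter_fst _ lam) cvg_inv_pinfty).
  have h : 1 - p.1^-1 * (p.1 * (1 - q r p.1)) @[p --> ratio_filter lam] --> (1 : R).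
    rewrite -[X in _ --> X]subr0 -(mul0r (r `^ beta * Gamma (1 - beta))).
    by apply: cvgB; [exact: cvg_cst|exact: cvgM].
  apply: cvg_trans h; apply: near_eq_cvg; apply: filterS t0 => p p0.
  by rewrite mulKf ?gt_eqF// opprB addrC subrK.
apply: cvg_exprn_expR => //.
- have : \forall p \near ratio_filter lam, 0 < q r p.1.
    by apply: cvgr_gt q1 _ _; exact: ltr01.
  by apply: filterS => p ->; have /andP[] := q01 p.1 (ltW r0).
- have h := cvgM (@ratio_filter_ratio _ lam) qF.
  apply: cvg_trans (h _); apply: near_eq_cvg; apply: filterS t0 => p p0 /=.
  by field; rewrite gt_eqF.
Qed.

(** A sample of size [n] taken at time [n] shows that the limiting transform is
    the transform of a law. *)
Lemma stable_law : exists (Q : probability (measurableTypeR R) R) (S : {RV Q >-> R}),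
  (forall w, 0 <= S w) /\
  (forall r, 0 <= r -> laplace Q S r = expR (- (r `^ beta * Gamma (1 - beta)))).
Proof.
have be0 : 0 < beta by rewrite divr_gt0//; case/andP: alpha02.
apply: (@laplace_limit_law _ _ _ P (fun n => sqsum (n%:R, n))
  (fun r => expR (- (r `^ beta * Gamma (1 - beta))))).
- by move=> n; exact: measurable_sqsum.
- by move=> n w; exact: sqsum_ge0.
- move=> r r0; have := laplace_sqsum_cvg ltr01 r0; rewrite mul1r => h.
  have nF : (n%:R : R, n) @[n --> \oo] --> ratio_filter (1 : R).
    move=> B [e [M [e0 hB]]]; exists (Num.truncn M).+1 => // n /= Mn.
    have n0 : (0 < n)%N by rewrite (leq_trans _ Mn).
    apply: hB; first by rewrite (lt_le_trans (truncnS_gt M))// ler_nat.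
    by rewrite divff ?pnatr_eq0 -?lt0n// subrr normr0.
  exact: (cvg_comp _ _ nF h).
rewrite -[X in _ --> X]expR0; apply: continuous_cvg; first exact: continuous_expR.
rewrite -[X in _ --> X]oppr0; apply: cvgN; rewrite -[X in _ --> X](mul0r (Gamma (1 - beta))).
apply: cvgM; last exact: cvg_cst.
apply: cvg_trans (cvg_powRN_pinfty be0); apply: near_eq_cvg.
have : \forall x \near +oo, (0 : R) <= x by apply: nbhs_pinfty_ge; exact: num_real.
by apply: filterS => x x0; rewrite -(powR_inv1 x0) -powRrM mulN1r.
Qed.

(** The event on which the formula for the scaled statistic is valid. *)
Let pos := \bigcap_i [set w | 0 < Xs i w].

Let mpos : measurable pos.
Proof. by apply: bigcap_measurable => // i _; exact: measurable_gt_set. Qed.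

Let Ppos : P pos = 1%E.
Proof.
have PC : P (~` pos) = 0%E.
  rewrite /pos setC_bigcap; apply/negligibleP.
    by apply: bigcup_measurable => i _; apply: measurableC; exact: measurable_gt_set.
  apply: negligible_bigcup => i; apply/negligibleP.
    by apply: measurableC; exact: measurable_gt_set.
  rewrite [LHS]probability_setC; last exact: measurable_gt_set.
  have -> : P [set w | 0 < Xs i w] = 1%E.
    rewrite -Xpos -[[set w | 0 < Xs i w]]/(Xs i @^-1` [set x | 0 < x]).
    rewrite copies// (_ : [set x | 0 < x] = `]0, +oo[%classic)//.
    by apply/seteqP; split => x /=; rewrite in_itv/= andbT.
  by rewrite subee.
by rewrite -[pos]setCK probability_setC ?PC ?sube0//; exact: measurableC.
Qed.

Variables (d' : measure_display) (T' : measurableType d').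
Variables (Q : probability T' R) (S : T' -> R).
Hypothesis mS : measurable_fun setT S.
Hypothesis S0 : forall w, 0 <= S w.
Hypothesis lapS : forall r, 0 <= r ->
  laplace Q S r = expR (- (r `^ beta * Gamma (1 - beta))).

Let CoVar t n w := Num.sqrt n%:R / a t * sample_CoVar (fun i => Xs i w) n.

(** The scaled sample coefficient of variation is a function of the normalized
    sum of squares, which converges to a stable law by its Laplace transform,
    and of the sample mean, which converges to [m]. *)
Lemma fixed_size_cvg (f kappa : R -> R) (lam : R) : 0 < lam ->
  continuous f -> (forall x, 0 <= f x <= 1) -> {for lam, continuous kappa} ->
  Ex P (fun w => f (kappa (p.2%:R / p.1) * CoVar p.1 p.2 w))
    @[p --> ratio_filter lam] -->
  Ex Q (fun w => f (kappa lam * (Num.sqrt (lam `^ beta^-1 * S w) / m))).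
Proof.
move=> lam0 cf f01 ck; have FF := ratio_filter_proper lam0.
have be0 : 0 < beta by rewrite divr_gt0//; case/andP: alpha02.
have csqrt : continuous (@Num.sqrt R) by exact: sqrt_continuous.
pose c := lam `^ beta^-1; have c0 : 0 <= c := powR_ge0 _ _.
pose psi y := f (kappa lam * (Num.sqrt y / m)).
have cpsi : continuous psi.
  move=> y; apply: (@continuous_comp _ _ _ (fun y => kappa lam * (Num.sqrt y / m)) f);
    last exact: cf.
  apply: cvgM; first exact: cvg_cst.
  by apply: cvgM; [exact: csqrt|exact: cvg_cst].
have t0 : \forall p \near ratio_filter lam, 0 < p.1.
  by apply: (@ratio_filter_fst _ lam (fun x => 0 < x)); apply: nbhs_pinfty_gt; exact: num_real.
have n0 : \forall p \near ratio_filter lam, (0 < p.2)%N.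
  exact: (@ratio_filter_snd _ _ lam0 (fun n => (0 < n)%N) (nbhs_infty_gt 0)).
have a0 : \forall p \near ratio_filter lam, 0 < a p.1.
  have h : \forall t \near +oo, 0 < a t.
    by apply: (@a_oo (fun x => 0 < x)); apply: nbhs_pinfty_gt; exact: num_real.
  exact: (@ratio_filter_fst _ lam (fun t => 0 < a t) h).
pose M (p : R * nat) w := (\sum_(i < p.2) `|Xs i w|) / p.2%:R.
have mM p : measurable_fun setT (M p).
  by apply: measurable_funM => //; apply: measurable_sum => i; exact: measurableT_comp.
have mcS : measurable_fun setT (fun w => c * S w) by exact: measurable_funM.
have cS0 w : 0 <= c * S w by exact: mulr_ge0.
(* [psi] is continuous everywhere, so the level only has to lie below the
   nonnegative limit *)
apply: (@mapping_cvg _ _ _ FF _ _ P sqsum _ _ _ Q (fun w => c * S w) psi (- 1) M m pos) => //.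
- by apply: nearW => p; split; [exact: measurable_sqsum|exact: sqsum_ge0].
- by apply: aeW => w; rewrite (lt_le_trans _ (cS0 w))// ltrN10.
- move=> g eg; apply: laplace_cvg => //.
    by apply: nearW => p; split; [exact: measurable_sqsum|exact: sqsum_ge0].
  move=> k; have -> : laplace Q (fun w => c * S w) k%:R =
      expR (- (lam * (k%:R `^ beta * Gamma (1 - beta)))).
    transitivity (laplace Q S (k%:R * c)).
      by apply: eq_Ex => w; congr expR; ring.
    rewrite lapS ?mulr_ge0//; congr (expR (- _)).
    rewrite powRM// /c -powRrM mulVf ?gt_eqF// powRr1 ?(ltW lam0)//; ring.
  exact: laplace_sqsum_cvg.
- apply: nearW => p; split; last by move=> w; exact: f01.
  apply: measurableT_comp; first exact: continuous_measurable_fun.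
  apply: measurable_funM => //; apply: measurable_funM => //.
  exact: measurable_sample_CoVar.
- apply: measurableT_comp => //; exact: continuous_measurable_fun.
- by move=> y; exact: f01.
- by move=> y _; exact: cpsi.
- exact: nearW.
- move=> eta eta0; have := @weak_lln _ _ _ P X Xs mX mXs copies indep eta iX eta0.
  by move=> h; exact: (cvg_comp _ _ (ratio_filter_snd lam0) h).
move=> e y e0 _; pose FP := filter_prod (nbhs y) (filter_prod (nbhs m) (ratio_filter lam)).
have FFP : ProperFilter FP by exact: filter_prod_proper.
have z1 : z.1 @[z --> FP] --> y by exact: cvg_fst.
have z2 : z.2 @[z --> FP] --> filter_prod (nbhs m) (ratio_filter lam) by exact: cvg_snd.
have zw : z.2.1 @[z --> FP] --> m.
  by apply: (cvg_comp _ _ z2); exact: cvg_fst.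
have zp : z.2.2 @[z --> FP] --> ratio_filter lam.
  by apply: (cvg_comp _ _ z2); exact: cvg_snd.
have zr : z.2.2.2%:R / z.2.2.1 @[z --> FP] --> lam.
  exact: (cvg_comp _ _ zp (@ratio_filter_ratio _ lam)).
have zt : z.2.2.1 @[z --> FP] --> +oo.
  exact: (cvg_comp _ _ zp (@ratio_filter_fst _ lam)).
(* the correction by the squared mean is negligible *)
have za : z.2.2.1 / a z.2.2.1 ^+ 2 @[z --> FP] --> (0 : R).
  have /andP[alpha0 alpha2] := alpha02.
  have maX : measurable_fun setT (fun w => `|X w|) by exact: measurableT_comp.
  have h := @norming_sqr R G alpha (fun x => tailP_ge0_le1 P x maX)
    (fun x y => @tailP_nincr _ _ _ P _ x y maX) Gpos Grv alpha0 a a_oo Ga alpha2.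
  exact: (cvg_comp _ _ zt h).
have mne0 : m != 0 by rewrite gt_eqF.
have H : kappa (z.2.2.2%:R / z.2.2.1) * (Num.sqrt (z.1 -
    z.2.2.2%:R / z.2.2.1 * (z.2.2.1 / a z.2.2.1 ^+ 2) * z.2.1 ^+ 2) / z.2.1)
    @[z --> FP] --> kappa lam * (Num.sqrt y / m).
  apply: cvgM; first by apply: continuous_cvg zr; exact: ck.
  apply: cvgM; last by apply: cvgV.
  apply: continuous_cvg; first exact: csqrt.
  rewrite -[X in _ --> X]subr0 -(mul0r (m ^+ 2)) -[X in X * _](mulr0 lam).
  by apply: cvgB => //; apply: cvgM; [exact: cvgM|exact: (cvgM zw zw)].
have ccvg (h : R -> R) (g : R * (R * (R * nat)) -> R) (l : R) : continuous h ->
    g z @[z --> FP] --> l -> h (g z) @[z --> FP] --> h l.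
  by move=> ch gl; apply: continuous_cvg gl; exact: ch.
have {}H := ccvg _ _ _ cf H.
have Hpsi : psi z.1 @[z --> FP] --> psi y by exact: ccvg cpsi z1.
have e20 : 0 < e / 2 by rewrite divr_gt0.
move/cvgrPdist_le/(_ _ e20) : H => H; move/cvgrPdist_le/(_ _ e20) : Hpsi => Hpsi.
have ztp : \forall z \near FP, 0 < z.2.2.1 by exact: (@zp (fun p => 0 < p.1) t0).
have znp : \forall z \near FP, (0 < z.2.2.2)%N by exact: (@zp (fun p => (0 < p.2)%N) n0).
have zap : \forall z \near FP, 0 < a z.2.2.1 by exact: (@zp (fun p => 0 < a p.1) a0).
have : \forall z \near FP, forall w, pos w -> M z.2.2 w = z.2.1 ->
    sqsum z.2.2 w = z.1 ->
    `|f (kappa (z.2.2.2%:R / z.2.2.1) * CoVar z.2.2.1 z.2.2.2 w) - psi z.1| <= e.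
  apply: filterS3 (filterI H Hpsi) (filterI ztp znp) zap.
  move=> [y' [w1 [t n]]] /= [h1 h2] [t1 n1] a1 w pw Mw Vw.
  rewrite /CoVar (@CoVar_scaled _ _ _ _ t)//; last by move=> i; exact: pw.
  rewrite -[(\sum_(i < n) Xs i w ^+ 2) / _]/(sqsum (t, n) w) Vw.
  rewrite -[(\sum_(i < n) `|Xs i w|) / _]/(M (t, n) w) Mw.
  rewrite [e]splitr; apply: le_trans (ler_distD (psi y) _ _) _.
  by rewrite lerD// distrC.
by [].
Qed.

Variables (N : R -> T -> nat).
Hypothesis mN : forall t, 0 <= t -> measurable_fun setT (N t).
Hypothesis indNX : independent_systems P
  (generated_sigma_algebra [set t : R | 0 <= t] N)
  (generated_sigma_algebra [set: nat] Xs).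
Context d2 {T2 : measurableType d2} (P' : probability T2 R) (Lam : {RV P' >-> R}).
Hypothesis avN : averages_in_time P N P' Lam.
(** A factor depending on [n / t]: constant for the first limit theorem, the
    inverse for the second one. *)
Variable kappa : R -> R.
Hypothesis mkappa : measurable_fun setT kappa.
Hypothesis ckappa : forall x, 0 < x -> {for x, continuous kappa}.

Local Notation PQ := (P' \x Q)%E.
Let D t n w := kappa (n%:R / t) * CoVar t n w.
Let Z (z : T2 * T') :=
  kappa (Lam z.1) * (Num.sqrt (Lam z.1 `^ beta^-1 * S z.2) / m).

Let mCoVar n : measurable_fun setT (fun w => sample_CoVar (fun i => Xs i w) n).
Proof. exact: measurable_sample_CoVar. Qed.

Let mD t n : measurable_fun setT (D t n).
Proof.
apply: measurable_funM => //; apply: measurable_funM => //.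
Qed.

Let mZ : measurable_fun setT Z.
Proof.
have mL : measurable_fun (setT : set (T2 * T')) (fun z => Lam z.1).
  by apply: measurableT_comp => //; exact: measurable_fst.
apply: measurable_funM; first exact: measurableT_comp.
apply: measurable_funM => //; apply: measurableT_comp.
  by apply: continuous_measurable_fun; exact: sqrt_continuous.
apply: measurable_funM.
  exact: (measurableT_comp (measurable_powR beta^-1) mL).
by apply: measurableT_comp => //; exact: measurable_snd.
Qed.

(** The limit at a fixed ratio [lam] is integrated over [S] only; it depends
    continuously on [lam > 0]. *)
Let test_cvg (f : R -> R) : continuous f -> (forall x, 0 <= f x <= 1) ->
  Ex P (fun w => Ex P (fun v => f (D t (N t w) v))) @[t --> +oo] -->
  Ex PQ (fun z => f (Z z)).
Proof.
move=> cf f01; have mf : measurable_fun setT f by exact: continuous_measurable_fun.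
pose h (y : R * T') :=
  f (kappa y.1 * (Num.sqrt (y.1 `^ beta^-1 * S y.2) / m)).
have mh : measurable_fun setT h.
  have m1 : measurable_fun (setT : set (R * T')) fst by exact: measurable_fst.
  apply: measurableT_comp => //.
  apply: measurable_funM; first exact: measurableT_comp.
  apply: measurable_funM => //; apply: measurableT_comp.
    by apply: continuous_measurable_fun; exact: sqrt_continuous.
  apply: measurable_funM.
    exact: (measurableT_comp (measurable_powR beta^-1) m1).
  by apply: measurableT_comp => //; exact: measurable_snd.
have mhx x : measurable_fun setT (fun s => h (x, s)).
  by apply: (measurableT_comp mh); exact: measurable_pair1.
have bhx x : bmf (fun s => h (x, s)) by apply: bmf01 => // s; exact: f01.
pose H x := Ex Q (fun s => h (x, s)).
have mZf : measurable_fun setT (fun z => f (Z z)) by exact: measurableT_comp.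
rewrite (Ex_product P' Q mZf (fun z => f01 (Z z))).
have mH : measurable_fun setT H := measurable_Ex Q mh (fun=> f01 _).
apply: (random_size_cvg mN avN (K := fun t n => Ex P (fun v => f (D t n v))) (H := H)) => //.
- by move=> t n; apply: Ex01 => //; exact: measurableT_comp.
- by move=> x; apply: Ex01 => // s; exact: f01.
- move=> x x0; apply/continuous_withinNx; apply: (cvgr_dnbhsP H x (H x)).2 => u [_ ux].
  apply: (@Ex_cvg _ _ _ Q (fun n s => h (u n, s)) _ 1) => //.
    by move=> n s; have /andP[h0 h1] := f01 (kappa (u n) * (Num.sqrt (u n `^ beta^-1 * S s) / m)); rewrite ger0_norm.
  apply: aeW => s; apply: continuous_cvg; first exact: cf.
  apply: cvgM; first by apply: continuous_cvg ux; exact: ckappa.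
  apply: cvgM; last exact: cvg_cst.
  apply: continuous_cvg; first exact: sqrt_continuous.
  rewrite /=; apply: cvgM; last exact: cvg_cst.
  by apply: (@continuous_cvg _ _ _ \oo _ u (fun y => y `^ beta^-1)) => //; exact: continuous_powRl.
- by move=> lam lam0; exact: (fixed_size_cvg lam0 cf f01 (ckappa lam0)).
Qed.

(** Given [N t = n] the statistic has the law of [D t n], by independence, so its
    distribution function is an average of those of the [D t n]. *)
Lemma random_size_cvg_in_law :
  cvg_in_law P (fun t w => D t (N t w) w) (P' \x Q)%E Z.
Proof.
pose p x t n := fine (P [set w | D t n w <= x]).
pose E x k t n := Ex P (fun v => ramp x k (D t n v)).
have t0 : \forall t \near +oo, (0 : R) < t by apply: nbhs_pinfty_gt; exact: num_real.
have pE x t : 0 < t -> measurable [set w | D t (N t w) w <= x] /\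
    fine (P [set w | D t (N t w) w <= x]) = Ex P (fun w => p x t (N t w)).
  move=> t1; apply: (@prob_random_index _ _ _ P (N t) (fun n => [set w | D t n w <= x])).
  - by apply: mN; exact: ltW.
  - by move=> n; exact: measurable_le_set.
  - move=> n; pose B := [set v | kappa (n%:R / t) * (Num.sqrt n%:R / a t * v) <= x].
    apply: (indep_CoVar n (B := B) indNX (ltW t1)).
    by apply: (measurable_le_set (Y := fun v => kappa (n%:R / t) * (Num.sqrt n%:R / a t * v)));
      do 2 apply: measurable_funM => //.
have E01 x k t n : 0 <= E x k t n <= 1.
  by apply: Ex01 => [|v]; [case: (bmf_ramp x k (mD t n))|exact: ramp01].
have p01 x t n : 0 <= p x t n <= 1 by apply: fine_P01; exact: measurable_le_set.
have bN (g : nat -> R) t : 0 < t -> (forall n, 0 <= g n <= 1) ->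
    bmf (fun w => g (N t w)).
  move=> t1 g01; apply: bmf01 => //.
  by apply: (measurableT_comp (f := g)) => //; apply: mN; exact: ltW.
apply: (@cvg_in_law_squeeze _ _ _ _ _ _ _ _ _
  (fun x k t => Ex P (fun w => E x k t (N t w)))) => //.
- by move=> x; apply: filterS t0 => t t1; case: (pE x t t1).
- move=> x k; apply: test_cvg; first exact: continuous_ramp.
  by move=> v; exact: ramp01.
- move=> x k; apply: filterS t0 => t t1; rewrite (pE x t t1).2.
  apply: Ex_le; [exact: bN|exact: (bN (E x k t))|].
  by move=> w; exact: prob_le_ramp.
- move=> x k; apply: filterS t0 => t t1; rewrite (pE x t t1).2.
  apply: Ex_le; [exact: (bN (E (x - k.+1%:R^-1) k t))|exact: bN|].
  by move=> w; exact: ramp_le_prob.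
Qed.

End CoVar_limit.

(** * Laplace transforms determine laws *)

Lemma Ex_weighted_integral (R : realType) d d' (T : measurableType d)
    (S : measurableType d') (P : probability T R) (G : T -> R) (Y : T -> S)
    (A : set S) : measurable_fun setT G -> (forall w, 0 <= G w <= 1) ->
  measurable_fun setT Y -> measurable A ->
  (Ex P (fun w => G w * \1_A (Y w)))%:E = (\int[P]_(w in Y @^-1` A) (G w)%:E)%E.
Proof.
move=> mG G01 mY mA.
rewrite EFin_Ex; last first.
  by apply: bmfM; [exact: bmf01|apply: bmf_comp => //; exact: bmf_indic].
rewrite [RHS]integral_mkcond epatch_indic; apply: eq_integral => w _ /=.
by rewrite EFinM.
Qed.

Section weighted_laws.
Context {R : realType} d1 d2 {T1 : measurableType d1} {T2 : measurableType d2}.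
Variables (P1 : probability T1 R) (P2 : probability T2 R).
Variables (G1 : T1 -> R) (G2 : T2 -> R).
Hypothesis mG1 : measurable_fun setT G1.
Hypothesis mG2 : measurable_fun setT G2.
Hypothesis G101 : forall w, 0 <= G1 w <= 1.
Hypothesis G201 : forall w, 0 <= G2 w <= 1.

(** The sets on which the two finite measures agree form a Dynkin system. *)
Lemma weighted_laws_pi_system d (S : measurableType d) (C : set (set S))
    (Y1 : T1 -> S) (Y2 : T2 -> S) :
  measurable_fun setT Y1 -> measurable_fun setT Y2 ->
  @measurable _ S = <<s C >> -> setI_closed C -> Ex P1 G1 = Ex P2 G2 ->
  (forall A, C A -> Ex P1 (fun w => G1 w * \1_A (Y1 w)) =
                    Ex P2 (fun w => G2 w * \1_A (Y2 w))) ->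
  forall A, measurable A -> Ex P1 (fun w => G1 w * \1_A (Y1 w)) =
                            Ex P2 (fun w => G2 w * \1_A (Y2 w)).
Proof.
move=> mY1 mY2 mC CI eqT eqC A mA.
have bI d' (T : measurableType d') (Y : T -> S) B : measurable_fun setT Y ->
    measurable B -> bmf (fun w => \1_B (Y w) : R).
  by move=> mY mB; apply: bmf_comp => //; exact: bmf_indic.
have ExC d' (T : measurableType d') (P : probability T R) (G : T -> R)
    (Y : T -> S) B : measurable_fun setT G -> (forall w, 0 <= G w <= 1) ->
    measurable_fun setT Y -> measurable B ->
    Ex P (fun w => G w * \1_(~` B) (Y w)) =
    Ex P G - Ex P (fun w => G w * \1_B (Y w)).
  move=> mG G01 mY mB; have bG : bmf G by exact: bmf01.
  rewrite -ExB//; last by apply: bmfM => //; exact: bI.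
  apply: eq_Ex => w; rewrite indicC indicE.
  by case: (Y w \in B); rewrite /= ?mulr0 ?mulr1 ?subrr ?subr0.
apply: (@dynkin_induction _ S C
  (fun A => Ex P1 (fun w => G1 w * \1_A (Y1 w)) =
            Ex P2 (fun w => G2 w * \1_A (Y2 w))) mC CI); last by rewrite -mC.
- transitivity (Ex P1 G1); first by apply: eq_Ex => w; rewrite indicT mulr1.
  by rewrite eqT; apply: eq_Ex => w; rewrite indicT mulr1.
- exact: eqC.
- by move=> B mB eqB; rewrite !ExC// eqB eqT.
move=> F mF tF eqF; apply: EFin_inj.
have mU : measurable (\bigcup_k F k) by exact: bigcup_measurable.
have tP (T : Type) (Y : T -> S) : trivIset setT (fun k => Y @^-1` F k).
  apply/trivIsetP => i j _ _ ij; apply/seteqP; split => // w /= [Fi Fj].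
  move/trivIsetP : tF => /(_ i j Logic.I Logic.I ij) F0.
  by rewrite -[False]/(set0 (Y w)) -F0.
rewrite !Ex_weighted_integral// !preimage_bigcup.
have mP d' (T : measurableType d') (Y : T -> S) k : measurable_fun setT Y ->
    measurable (Y @^-1` F k).
  by move=> mY; rewrite -[X in measurable X]setTI; exact: mY.
rewrite ge0_integral_bigcup//; last 3 first.
- by move=> k; exact: mP.
- by apply/measurable_EFinP; exact: measurable_funTS.
- by move=> w _; rewrite lee_fin; case/andP: (G101 w).
rewrite ge0_integral_bigcup//; last 3 first.
- by move=> k; exact: mP.
- by apply/measurable_EFinP; exact: measurable_funTS.
- by move=> w _; rewrite lee_fin; case/andP: (G201 w).
by apply: eq_eseriesr => k _; rewrite -!Ex_weighted_integral// eqF.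
Qed.

(** By the Weierstrass approximation theorem the transforms at the integers
    determine the integrals of the ramps, hence the measures of the half-lines. *)
Lemma weighted_laplace_unique (Y1 : T1 -> R) (Y2 : T2 -> R) :
  measurable_fun setT Y1 -> measurable_fun setT Y2 ->
  (forall w, 0 <= Y1 w) -> (forall w, 0 <= Y2 w) ->
  (forall k : nat, Ex P1 (fun w => G1 w * expR (- (k%:R * Y1 w))) =
                   Ex P2 (fun w => G2 w * expR (- (k%:R * Y2 w)))) ->
  forall A, measurable A -> Ex P1 (fun w => G1 w * \1_A (Y1 w)) =
                            Ex P2 (fun w => G2 w * \1_A (Y2 w)).
Proof.
move=> mY1 mY2 Y10 Y20 eqk.
have eqT : Ex P1 G1 = Ex P2 G2.
  have := eqk 0; under eq_Ex do rewrite mul0r oppr0 expR0 mulr1.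
  by move=> ->; apply: eq_Ex => w; rewrite mul0r oppr0 expR0 mulr1.
have eqg g : eventually0 g ->
    Ex P1 (fun w => G1 w * g (Y1 w)) = Ex P2 (fun w => G2 w * g (Y2 w)).
  move=> eg; apply/eqP; rewrite -subr_eq0 -normr_le0; apply/ler_addgt0Pl => e e0.
  rewrite addr0; have e20 : 0 < e / 2 by rewrite divr_gt0.
  have [p gp] := eventually0_weighted_approx eg e20.
  have h1 := gp _ _ P1 G1 Y1 mG1 G101 mY1 Y10.
  have := gp _ _ P2 G2 Y2 mG2 G201 mY2 Y20.
  under eq_bigr do rewrite -eqk.
  rewrite distrC => h2; rewrite (splitr e).
  by rewrite (le_trans (ler_distD _ _ _) (lerD h1 h2)).
apply: (weighted_laws_pi_system mY1 mY2 (RGenOInfty.measurableE R)) => //.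
  move=> _ _ [x ->] [y ->]; exists (Num.max x y).
  by apply/seteqP; split => v /=; rewrite !in_itv/= !andbT gt_max => /andP.
move=> _ [x ->].
have half d (T : measurableType d) (P : probability T R) (G Y : T -> R) :
    measurable_fun setT G -> (forall w, 0 <= G w <= 1) ->
    measurable_fun setT Y ->
    Ex P G - Ex P (fun w => G w * ramp x n (Y w)) @[n --> \oo] -->
    Ex P (fun w => G w * \1_(`]x, +oo[%classic) (Y w)).
  move=> mG G01 mY; have bG : bmf G by exact: bmf01.
  have br n : bmf (fun w => ramp x n (Y w)) by exact: bmf_ramp.
  have E n : Ex P G - Ex P (fun w => G w * ramp x n (Y w)) =
      Ex P (fun w => G w * (1 - ramp x n (Y w))).
    rewrite -ExB//; last exact: bmfM.
    by apply: eq_Ex => w; rewrite mulrBr mulr1.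
  under eq_fun do rewrite E.
  have b1r n : bmf (fun w => 1 - ramp x n (Y w)) by apply: bmfB => //; exact: bmf_cst.
  apply: (@Ex_cvg _ _ _ P (fun n w => G w * (1 - ramp x n (Y w))) _ 1).
  - by move=> n; case: (bmfM bG (b1r n)).
  - by apply: measurable_funM => //; apply: measurableT_comp => //; exact: measurable_indic.
  - move=> n w; have /andP[g0 g1] := G01 w; have /andP[r0 r1] := ramp01 x n (Y w).
    rewrite normrM (ger0_norm g0) ger0_norm ?subr_ge0// -[leRHS]mul1r ler_pM ?subr_ge0//.
    by rewrite gerBl.
  apply: aeW => w; apply: cvgM; first exact: cvg_cst.
  rewrite indicE; have [Yx|xY] := leP (Y w) x.
    rewrite memNset; last by rewrite /= in_itv/= andbT => /(le_lt_trans Yx); rewrite ltxx.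
    by apply: cvg_near_cst; apply: nearW => n; rewrite ramp_low// subrr.
  rewrite mem_set; last by rewrite /= in_itv/= andbT.
  have d0 : 0 < Y w - x by rewrite subr_gt0.
  apply: cvg_near_cst; exists (Num.truncn (Y w - x)^-1) => // n /= hn.
  rewrite ramp_high ?subr0// -lerBrDl invf_ple ?posrE ?ltr0n// ltW//.
  by rewrite (lt_le_trans (truncnS_gt _))// ler_nat ltnS.
have := half _ _ P1 G1 Y1 mG1 G101 mY1.
have := half _ _ P2 G2 Y2 mG2 G201 mY2.
have -> : (fun n => Ex P2 G2 - Ex P2 (fun w => G2 w * ramp x n (Y2 w))) =
    (fun n => Ex P1 G1 - Ex P1 (fun w => G1 w * ramp x n (Y1 w))).
  by apply/funext => n; rewrite eqT (eqg _ (eventually0_ramp x n)).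
by move=> h2 h1; exact: (cvg_unique _ h1 h2).
Qed.

End weighted_laws.

Lemma ae_law_eq (R : realType) d d' (T : measurableType d) (S : measurableType d')
    (P : probability T R) (Y Y' : T -> S) (A : set S) :
  measurable_fun setT Y -> measurable_fun setT Y' ->
  {ae P, forall w, Y w = Y' w} -> measurable A ->
  P (Y @^-1` A) = P (Y' @^-1` A).
Proof.
move=> mY mY' YY' mA.
have mP (Z : T -> S) : measurable_fun setT Z -> measurable (Z @^-1` A).
  by move=> mZ; rewrite -[X in measurable X]setTI; exact: mZ.
rewrite -(fineK (fin_num_measure P _ (mP _ mY))) -(fineK (fin_num_measure P _ (mP _ mY'))).
rewrite -!Ex_indic_comp//; congr EFin.
apply: Ex_as.
- by apply: bmf_comp => //; exact: bmf_indic.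
- by apply: bmf_comp => //; exact: bmf_indic.
- by apply: filterS YY' => w ->.
Qed.

(** On the event that [V <= - 1 / (n + 1)] and [W <= n] the integrand is at least
    [exp (r / (n + 1) - n)], which tends to infinity with [r]. *)
Lemma bounded_transform_ge0 (R : realType) d (T : measurableType d)
    (P : probability T R) (W V : T -> R) :
  measurable_fun setT W -> measurable_fun setT V ->
  (forall r, 0 < r -> ('E_P [(fun w => expR (- W w - r * V w))%R] <= 1)%E) ->
  {ae P, forall w, 0 <= V w}.
Proof.
move=> mW mV EWV.
pose A (n : nat) := [set w | V w <= - n.+1%:R^-1] `&` [set w | W w <= n%:R].
have mA n : measurable (A n) by apply: measurableI; exact: measurable_le_set.
have A0 n : P (A n) = 0%E.
  have h r : 0 < r -> fine (P (A n)) <= expR (n%:R - r / n.+1%:R).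
    move=> r0; rewrite -lee_fin fineK ?fin_num_measure//.
    have : ((expR (r / n.+1%:R - n%:R))%:E * P (A n) <= 1)%E.
      apply: le_trans (EWV r r0).
      rewrite unlock -(setIT (A n)) -integral_indic// -ge0_integralZl//=; last first.
        by apply/measurable_EFinP; exact: measurable_indic.
      apply: ge0_le_integral => //=.
      - by apply: measurable_funeM; apply/measurable_EFinP; exact: measurable_indic.
      - apply/measurable_EFinP; apply: measurableT_comp => //.
        by apply: measurable_funB; [exact: measurableT_comp|exact: measurable_funM].
      move=> w _; rewrite indicE; have [|_] := boolP (w \in A n); last first.
        by rewrite mule0 lee_fin expR_ge0.
      rewrite inE => -[/= Vw Ww]; rewrite mule1 lee_fin ler_expR.
      have : r * V w <= r * - n.+1%:R^-1 by rewrite ler_pM2l.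
      rewrite mulrN => rV; have {}Ww : W w <= n%:R := Ww.
      by rewrite addrC lerD ?lerN2// lerNr.
    move=> h; rewrite -(@lee_pmul2l _ (expR (r / n.+1%:R - n%:R))%:E) ?lte_fin ?expR_gt0//.
    by rewrite (le_trans h)// -EFinM -expRD addrC addrA subrK subrr expR0.
  apply/eqP; rewrite -fine_eq0 ?fin_num_measure// eq_le.
  have /andP[-> _] := fine_P01 P (mA n); rewrite andbT.
  apply/ler_addgt0Pl => e e0; rewrite addr0.
  pose r := n.+1%:R * Num.max 1 (n%:R - ln e).
  have r0 : 0 < r by rewrite mulr_gt0 ?ltr0n// lt_max ltr01.
  rewrite (le_trans (h r r0))// -[leRHS]lnK ?posrE// ler_expR.
  rewrite /r mulrC mulKf ?pnatr_eq0// lerBlDl -lerBlDr le_max lexx orbT//.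
have : P.-negligible (\bigcup_n A n).
  apply: negligible_bigcup => n; apply/negligibleP; [exact: mA|exact: A0].
apply: negligibleS => w /= /negP; rewrite -ltNge => Vw.
have Vw0 : 0 < - V w by rewrite oppr_gt0.
pose n := maxn (Num.truncn (- V w)^-1) (Num.truncn (W w)).+1.
exists n => //; split => /=.
  rewrite lerNr invf_ple ?posrE ?ltr0n// ltW// (lt_le_trans (truncnS_gt _))//.
  by rewrite ler_nat ltnS leq_maxl.
by rewrite ltW// (lt_le_trans (truncnS_gt _))// ler_nat leq_maxr.
Qed.

Section joint_law.
Context {R : realType} d {T : measurableType d} (P : probability T R).
Variables (U V : T -> R) (phi : R -> R -> R).
Hypothesis mU : measurable_fun setT U.
Hypothesis mV : measurable_fun setT V.
Hypothesis phi1 : forall r s, 0 < r -> 0 <= s -> phi r s <= 1.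
Hypothesis EUV : forall r s, 0 < r -> 0 <= s ->
  ('E_P [(fun w => expR (- (r * U w) - s * V w))%R] = (phi r s)%:E)%E.

(** Versions of [U] and [V] to which the theory of bounded functions applies. *)
Let U' w := Num.max 0 (U w).
Let V' w := Num.max 0 (V w).

Let mU' : measurable_fun setT U'. Proof. exact: measurable_maxr. Qed.
Let mV' : measurable_fun setT V'. Proof. exact: measurable_maxr. Qed.
Let U0 w : 0 <= U' w. Proof. by rewrite le_max lexx. Qed.
Let V0 w : 0 <= V' w. Proof. by rewrite le_max lexx. Qed.

Lemma joint_transform_ge0 :
  {ae P, forall w, U w = U' w} /\ {ae P, forall w, V w = V' w}.
Proof.
have ae0 (W : T -> R) : {ae P, forall w, 0 <= W w} ->
    {ae P, forall w, W w = Num.max 0 (W w)}.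
  by apply: filterS => w W0; rewrite max_r.
split; apply: ae0.
  apply: (@bounded_transform_ge0 _ _ _ P (fun=> 0) U) => // r r0.
  rewrite (_ : (fun w => _) = (fun w => expR (- (r * U w) - 0 * V w))).
    by rewrite EUV// lee_fin phi1.
  by apply/funext => w; rewrite mul0r subr0 oppr0 add0r.
apply: (@bounded_transform_ge0 _ _ _ P (fun w => 1 * U w) V) => // [|s s0].
  exact: measurable_funM.
by have s0' := ltW s0; rewrite EUV// lee_fin phi1.
Qed.

Lemma joint_transform_max r s : 0 < r -> 0 <= s ->
  Ex P (fun w => expR (- (r * U' w)) * expR (- (s * V' w))) = phi r s.
Proof.
move=> r0 s0; have [aeU aeV] := joint_transform_ge0.
apply: EFin_inj; rewrite -EUV// EFin_Ex; last first.
  by apply: bmfM; apply: bmf_laplace => //; exact: ltW.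
rewrite unlock; apply: ge0_ae_eq_integral => //.
- by apply/measurable_EFinP; apply: measurable_funM; do 2 apply: measurableT_comp => //;
    exact: measurable_funM.
- apply/measurable_EFinP; apply: measurableT_comp => //.
  by apply: measurable_funB; [apply: measurableT_comp => //; exact: measurable_funM|exact: measurable_funM].
- by apply: filterS2 aeU aeV => w <- <- _ /=; rewrite -expRD.
Qed.

(** The transform is only given for [r > 0]; its limit at 0 is the transform of
    [V] alone. *)
Lemma joint_transform_max0 s : 0 <= s ->
  phi n.+1%:R^-1 s @[n --> \oo] --> Ex P (fun w => expR (- (s * V' w))).
Proof.
move=> s0.
have i0 n : 0 < n.+1%:R^-1 :> R by rewrite invr_gt0 ltr0n.
have E n : phi n.+1%:R^-1 s =
    Ex P (fun w => expR (- (n.+1%:R^-1 * U' w)) * expR (- (s * V' w))).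
  by rewrite joint_transform_max.
under eq_fun do rewrite E.
apply: (@Ex_cvg _ _ _ P (fun n w => expR (- (n.+1%:R^-1 * U' w)) * expR (- (s * V' w))) _ 1).
- move=> n; apply: measurable_funM; do 2 apply: measurableT_comp => //;
    exact: measurable_funM.
- by do 2 apply: measurableT_comp => //; exact: measurable_funM.
- move=> n w; rewrite ger0_norm ?mulr_ge0 ?expR_ge0// -[leRHS]mul1r.
  by rewrite ler_pM ?expR_ge0// expR_le1 oppr_le0 mulr_ge0// ltW.
apply: aeW => w; rewrite -[X in _ --> X]mul1r; apply: cvgM; last exact: cvg_cst.
rewrite -[X in _ --> X]expR0; apply: continuous_cvg; first exact: continuous_expR.
rewrite -[X in _ --> X]oppr0; apply: cvgN; rewrite -[X in _ --> X](mul0r (U' w)).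
by apply: cvgM; [exact: cvg_harmonic|exact: cvg_cst].
Qed.

End joint_law.

(** Freezing first [exp (- s V)] and then the event [U \in A] as weights reduces
    the joint law to two applications of the one-dimensional uniqueness. *)
Theorem joint_transform_unique (R : realType) d1 d2 (T1 : measurableType d1)
    (T2 : measurableType d2) (P1 : probability T1 R) (P2 : probability T2 R)
    (U1 V1 : T1 -> R) (U2 V2 : T2 -> R) (phi : R -> R -> R) :
  measurable_fun setT U1 -> measurable_fun setT V1 ->
  measurable_fun setT U2 -> measurable_fun setT V2 ->
  (forall r s, 0 < r -> 0 <= s -> phi r s <= 1) ->
  (forall r s, 0 < r -> 0 <= s ->
     ('E_P1 [(fun w => expR (- (r * U1 w) - s * V1 w))%R] = (phi r s)%:E)%E) ->
  (forall r s, 0 < r -> 0 <= s ->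
     ('E_P2 [(fun w => expR (- (r * U2 w) - s * V2 w))%R] = (phi r s)%:E)%E) ->
  same_law P1 P2 (fun w => (U1 w, V1 w)) (fun w => (U2 w, V2 w)).
Proof.
move=> mU1 mV1 mU2 mV2 phi1 E1 E2 A mA.
have aemax d (T : measurableType d) (P : probability T R) (U V : T -> R) :
    measurable_fun setT U -> measurable_fun setT V ->
    (forall r s, 0 < r -> 0 <= s ->
      ('E_P [(fun w => expR (- (r * U w) - s * V w))%R] = (phi r s)%:E)%E) ->
    P ((fun w => (U w, V w)) @^-1` A) =
    P ((fun w => (Num.max 0 (U w), Num.max 0 (V w))) @^-1` A).
  move=> mU mV E; have [aeU aeV] := joint_transform_ge0 mU mV phi1 E.
  apply: ae_law_eq => //.
  - exact: measurable_fun_pair.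
  - by apply: measurable_fun_pair; exact: measurable_maxr.
  - by apply: filterS2 aeU aeV => w <- <-.
rewrite (aemax _ _ P1)// (aemax _ _ P2)//.
pose pU1 w := Num.max 0 (U1 w); pose pV1 w := Num.max 0 (V1 w).
pose pU2 w := Num.max 0 (U2 w); pose pV2 w := Num.max 0 (V2 w).
have mp d (T : measurableType d) (Y : T -> R) : measurable_fun setT Y ->
    measurable_fun setT (fun w => Num.max 0 (Y w)).
  by move=> mY; exact: measurable_maxr.
have p0 (v : R) : 0 <= Num.max 0 v by rewrite le_max lexx.
have pU10 w : 0 <= pU1 w := p0 _. have pV10 w : 0 <= pV1 w := p0 _.
have pU20 w : 0 <= pU2 w := p0 _. have pV20 w : 0 <= pV2 w := p0 _.
have [mpU1 mpV1 mpU2 mpV2] := And4 (mp _ _ _ mU1) (mp _ _ _ mV1) (mp _ _ _ mU2) (mp _ _ _ mV2).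
have m_exp d (T : measurableType d) (Y : T -> R) (k : nat) :
    measurable_fun setT Y -> measurable_fun setT (fun w => expR (- (k%:R * Y w))).
  by move=> mY; do 2 apply: measurableT_comp => //; exact: measurable_funM.
have exp01 (v : R) (k : nat) : 0 <= v -> 0 <= expR (- (k%:R * v)) <= 1.
  by move=> v0; rewrite expR_ge0 expR_le1 oppr_le0 mulr_ge0.
have step1 B (k : nat) : measurable B ->
    Ex P1 (fun w => expR (- (k%:R * pV1 w)) * \1_B (pU1 w)) =
    Ex P2 (fun w => expR (- (k%:R * pV2 w)) * \1_B (pU2 w)).
  apply: weighted_laplace_unique => //; [exact: m_exp|exact: m_exp| | |].
  - by move=> w; exact: exp01.
  - by move=> w; exact: exp01.
  move=> [|j].
    have l1 := joint_transform_max0 mU1 mV1 phi1 E1 (ler0n R k).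
    have l2 := joint_transform_max0 mU2 mV2 phi1 E2 (ler0n R k).
    have e0 d (T : measurableType d) (P : probability T R) (Y Y' : T -> R) :
        Ex P (fun w => Y w * expR (- (0%:R * Y' w))) = Ex P Y.
      by apply: eq_Ex => w; rewrite mul0r oppr0 expR0 mulr1.
    by rewrite !e0; exact: (cvg_unique _ l1 l2).
  have j0 : 0 < j.+1%:R :> R by rewrite ltr0n.
  have C d (T : measurableType d) (P : probability T R) (Y Y' : T -> R) :
      Ex P (fun w => Y w * Y' w) = Ex P (fun w => Y' w * Y w).
    by apply: eq_Ex => w; rewrite mulrC.
  rewrite C (joint_transform_max mU1 mV1 phi1 E1 j0 (ler0n R k)).
  by rewrite C (joint_transform_max mU2 mV2 phi1 E2 j0 (ler0n R k)).
have m_ind d (T : measurableType d) (Y : T -> R) (B : set R) :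
    measurable B -> measurable_fun setT Y -> measurable_fun setT (fun w => \1_B (Y w) : R).
  by move=> mB mY; apply: measurableT_comp => //; exact: measurable_indic.
have ind01 d (T : measurableType d) (Y : T -> R) (B : set R) (w : T) :
    0 <= (\1_B (Y w) : R) <= 1.
  by rewrite indicE ler0n lern1 leq_b1.
have step2 B C : measurable B -> measurable C ->
    Ex P1 (fun w => \1_B (pU1 w) * \1_C (pV1 w)) =
    Ex P2 (fun w => \1_B (pU2 w) * \1_C (pV2 w)).
  move=> mB; move: C; apply: weighted_laplace_unique => //.
  - exact: m_ind.
  - exact: m_ind.
  move=> k; have := step1 B k mB.
  under eq_Ex do rewrite mulrC.
  by move=> ->; apply: eq_Ex => w; rewrite mulrC.
have mp1 : measurable_fun setT (fun w => (pU1 w, pV1 w)) by exact: measurable_fun_pair.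
have mp2 : measurable_fun setT (fun w => (pU2 w, pV2 w)) by exact: measurable_fun_pair.
have mP d (T : measurableType d) (Y : T -> R * R) : measurable_fun setT Y ->
    measurable (Y @^-1` A).
  by move=> mY; rewrite -[X in measurable X]setTI; exact: mY.
rewrite -[LHS]fineK ?fin_num_measure//; last exact: (mP _ _ _ mp1).
rewrite -[RHS]fineK ?fin_num_measure//; last exact: (mP _ _ _ mp2).
rewrite -!Ex_indic_comp//; congr EFin.
rewrite -[LHS]Ex_mul1 -[RHS]Ex_mul1.
apply: (@weighted_laws_pi_system _ _ _ _ _ P1 P2 (fun=> 1) (fun=> 1) _ _ _ _ _ _ [set B `*` C | B in measurable & C in measurable]) => //.
- by move=> w; rewrite ler01 lexx.
- by move=> w; rewrite ler01 lexx.
- exact: measurable_prod_measurableType.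
- move=> _ _ [B mB [C mC <-]] [B' mB' [C' mC' <-]].
  exists (B `&` B'); first exact: measurableI.
  by exists (C `&` C'); [exact: measurableI|rewrite setXI].
- by rewrite !Ex_cst.
move=> _ [B mB [C mC <-]].
have X d (T : measurableType d) (P : probability T R) (u v : T -> R) :
    Ex P (fun w => 1 * \1_(B `*` C) (u w, v w)) = Ex P (fun w => \1_B (u w) * \1_C (v w)).
  apply: eq_Ex => w; rewrite mul1r !indicE -natrM mulnb; congr (nat_of_bool _)%:R.
  by apply/idP/andP => [|[]]; rewrite !inE.
by rewrite !X step2.
Qed.

(** * Pareto-type variables *)

Section pareto.
Context {R : realType} d {T : measurableType d} (P : probability T R).
Variables (X : {RV P >-> R}) (alpha : R) (ell : R -> R).
Hypothesis Xpos : P [set w | 0 < X w] = 1%E.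
Hypothesis pareto : pareto_type X alpha ell.
Local Notation G := (tailP P (fun w => `|X w|)).

Let mX : measurable_fun setT X. Proof. by []. Qed.

Let maX : measurable_fun setT (fun w => `|X w|).
Proof. exact: measurableT_comp. Qed.

Lemma ae_abs_positive : {ae P, forall w, 0 < X w /\ `|X w| = X w}.
Proof.
exists (~` [set w | 0 < X w]); split.
- by apply: measurableC; exact: measurable_gt_set.
- rewrite [LHS]probability_setC; last exact: measurable_gt_set.
  by rewrite Xpos subee.
- by apply: subsetC => w /= X0; split => //; exact: gtr0_norm.
Qed.

Let ratio x := G x / (x `^ (- alpha) * ell x).

Let G_ratio : ratio x @[x --> +oo] --> (1 : R).
Proof.
have [_] := pareto; suff -> : (fun x => (1 - fine (cdf X x)) / (x `^ (- alpha) * ell x)) = ratio by [].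
apply/funext => x; congr (_ / _).
rewrite tailPE//; congr (1 - fine _).
have -> : [set w | `|X w| <= x] = (fun w => `|X w|) @^-1` `]-oo, x]%classic.
  by apply/seteqP; split => w /=; rewrite in_itv.
have -> : cdf X x = P (X @^-1` `]-oo, x]%classic) by [].
by apply: ae_law_eq => //; apply: filterS ae_abs_positive => w [_ ->].
Qed.

Let ell_gt0 : \forall x \near +oo, 0 < ell x.
Proof.
have [[[A [Apos _]] _] _] := pareto.
have : \forall x \near +oo, A <= x by apply: nbhs_pinfty_ge; exact: num_real.
by apply: filterS => x; exact: Apos.
Qed.

Let x_gt0 : \forall x \near +oo, (0 : R) < x.
Proof. by apply: nbhs_pinfty_gt; exact: num_real. Qed.

Let scale_gt0 : \forall x \near +oo, 0 < x `^ (- alpha) * ell x.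
Proof. by apply: filterS2 x_gt0 ell_gt0 => x x0 l0; rewrite mulr_gt0// powR_gt0. Qed.

Lemma pareto_tail_gt0 : \forall x \near +oo, 0 < G x.
Proof.
have r0 : \forall x \near +oo, 0 < ratio x by apply: cvgr_gt G_ratio _ _; exact: ltr01.
apply: filterS2 r0 scale_gt0 => x r0 s0.
by move: r0; rewrite /ratio pmulr_lgt0// invr_gt0.
Qed.

(** [ell] cancels by slow variation, leaving the ratio of the powers. *)
Lemma pareto_tail_rv (c : R) : 0 < c ->
  G (c * x) / G x @[x --> +oo] --> c `^ (- alpha).
Proof.
move=> c0; have [[_ slow] _] := pareto.
have c_oo : c * x @[x --> +oo] --> +oo.
  by apply: gt0_cvgMry => //; exact: cvg_id.
have r1 : ratio (c * x) @[x --> +oo] --> (1 : R) by exact: (cvg_comp _ _ c_oo G_ratio).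
have h : c `^ (- alpha) * (ratio (c * x) * (ell (c * x) / ell x) / ratio x)
    @[x --> +oo] --> c `^ (- alpha).
  rewrite -[X in _ --> X]mulr1; apply: cvgM; first exact: cvg_cst.
  rewrite -[X in _ --> X]mulr1 -[X in X * _]mulr1; apply: cvgM.
    by apply: cvgM => //; exact: slow.
  by rewrite -[X in _ --> X]invr1; apply: cvgV => //; exact: oner_neq0.
apply: cvg_trans h; apply: near_eq_cvg.
have sc : \forall x \near +oo, 0 < ell (c * x) by exact: (c_oo (fun y => 0 < ell y) ell_gt0).
apply: filterS3 (filterI x_gt0 sc) ell_gt0 pareto_tail_gt0 => x [x0 lc0] l0 g0.
rewrite /ratio powRM ?ltW//; field.
by rewrite !gt_eqF// powR_gt0.
Qed.

(** The ratio of the tail to [x `^ (- alpha) * ell x] tends to 1 along [a]. *)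
Lemma pareto_norming (a : R -> R) : a t @[t --> +oo] --> +oo ->
  t * a t `^ (- alpha) * ell (a t) @[t --> +oo] --> (1 : R) ->
  t * G (a t) @[t --> +oo] --> (1 : R).
Proof.
move=> a_oo na.
have r1 : ratio (a t) @[t --> +oo] --> (1 : R) by exact: (cvg_comp _ _ a_oo G_ratio).
have h : ratio (a t) * (t * a t `^ (- alpha) * ell (a t)) @[t --> +oo] --> (1 : R).
  by rewrite -[X in _ --> X]mulr1; exact: cvgM.
apply: cvg_trans h; apply: near_eq_cvg.
have s0 : \forall t \near +oo, 0 < a t `^ (- alpha) * ell (a t).
  exact: (a_oo (fun y => 0 < y `^ (- alpha) * ell y) scale_gt0).
apply: filterS s0 => t s0 /=.
by rewrite /ratio -[t * _ * _]mulrA mulrCA -mulrA mulVf ?mulr1// gt_eqF.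
Qed.

Lemma expectation_abs : ('E_P [X] = \int[P]_w (`|X w|)%:E)%E.
Proof.
rewrite unlock; apply: ae_eq_integral => //.
- exact/measurable_EFinP.
- exact/measurable_EFinP.
- by apply: filterS ae_abs_positive => w [_ /= ->].
Qed.

Lemma pareto_integrable : 1 < alpha < 2 \/ (alpha = 1 /\ ('E_P [X] < +oo)%E) ->
  P.-integrable setT (EFin \o (fun w => `|X w|)).
Proof.
move=> ha; apply/integrableP; split; first exact/measurable_EFinP.
rewrite (eq_integral (fun w => (`|X w|)%:E)); last by move=> w _; rewrite /= normr_id.
case: ha => [/andP[a1 a2]|[_]]; last by rewrite expectation_abs.
(* an exponent strictly between 1 and [alpha] *)
have p1 : 1 < (1 + alpha) / 2 by lra.
have p2 : (1 + alpha) / 2 < alpha by lra.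
have [x0 x01 geo] := tail_geometric (fun x => tailP_ge0_le1 P x maX) pareto_tail_gt0
    pareto_tail_rv p2.
exact: (geometric_tail_mean maX (fun=> normr_ge0 _) p1 x01 geo).
Qed.

Lemma mean_abs_gt0 : P.-integrable setT (EFin \o (fun w => `|X w|)) ->
  0 < \int[P]_w `|X w|.
Proof.
move=> iX; rewrite lt_neqAle Rintegral_ge0 ?andbT//; apply/eqP => m0.
have I0 : (\int[P]_w `|(`|X w|)%:E| = 0)%E.
  rewrite (eq_integral (fun w => (`|X w|)%:E)); last by move=> w _; rewrite /= normr_id.
  by rewrite -(fineK (integrable_fin_num measurableT iX)) -[fine _]m0.
have mE : measurable_fun setT (fun w => (`|X w|)%:E) by exact/measurable_EFinP.
have aeX0 := (ae_eq_integral_abs P measurableT mE).1 I0.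
have [N [mN N0 NX]] : {ae P, forall w : T, False}.
  apply: filterS2 aeX0 ae_abs_positive => w /(_ Logic.I)[Xw0] [X0 Xw].
  by move: X0; rewrite -Xw Xw0 ltxx.
have : P setT = 0%E.
  by rewrite -N0; congr (P _); apply/seteqP; split => // w _; apply: NX => /=.
by rewrite probability_setT => /eqP; rewrite onee_eq0.
Qed.

End pareto.

(** * Mixtures of stable laws *)

Section mixture.
Context {R : realType} d {T : measurableType d} (P : probability T R).
Context d' {T' : measurableType d'} (Q : probability T' R).
Variables (Lam : {RV P >-> R}) (S : {RV Q >-> R}) (beta c : R).
Hypothesis Lam0 : {ae P, forall w, 0 < Lam w}.
Hypothesis S0 : forall w, 0 <= S w.
Hypothesis beta0 : 0 < beta.
Hypothesis c0 : 0 <= c.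
Hypothesis lapS : forall r, 0 <= r -> laplace Q S r = expR (- (r `^ beta * c)).

(** Given [Lam], this has the law of the value at time [Lam] of a stable
    subordinator whose value at time 1 has the law of [S]. *)
Definition mixture (z : T * T') : R := Lam z.1 `^ beta^-1 * S z.2.

Lemma measurable_mixture : measurable_fun setT mixture.
Proof.
apply: measurable_funM.
  apply: (measurableT_comp (measurable_powR beta^-1)).
  by apply: measurableT_comp => //; exact: measurable_fst.
by apply: measurableT_comp => //; exact: measurable_snd.
Qed.

(** Integrate first over [S], with [Lam] frozen: [(Lam `^ beta^-1) `^ beta] is
    [Lam]. *)
Lemma mixture_transform (r s : R) : 0 <= r ->
  ('E_(P \x Q)%E [(fun z => expR (- (r * mixture z) - s * Lam z.1))%R] =
   'E_P [(fun w => expR (- (r `^ beta * c * Lam w) - s * Lam w))%R])%E.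
Proof.
move=> r0; have mmix := measurable_mixture.
have mL1 : measurable_fun setT (fun z : T * T' => Lam z.1).
  by apply: measurableT_comp => //; exact: measurable_fst.
have mf : measurable_fun setT
    (fun z : T * T' => (expR (- (r * mixture z) - s * Lam z.1))%:E).
  apply/measurable_EFinP; apply: measurableT_comp => //.
  by apply: measurable_funB; [apply: measurableT_comp => //; exact: measurable_funM|exact: measurable_funM].
have f0 (z : T * T') : (0 <= (expR (- (r * mixture z) - s * Lam z.1))%:E)%E.
  by rewrite lee_fin expR_ge0.
rewrite unlock (@fubini_tonelli1 _ _ _ _ _ P Q
  (fun z => (expR (- (r * mixture z) - s * Lam z.1))%:E) mf f0); apply: ge0_ae_eq_integral => //.
- exact: measurable_fun_fubini_tonelli_F.
- apply/measurable_EFinP; apply: measurableT_comp => //.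
  by apply: measurable_funB; [apply: measurableT_comp => //; exact: measurable_funM|exact: measurable_funM].
- by move=> w _; apply: integral_ge0 => z _; exact: f0.
apply: filterS Lam0 => w L0 _; rewrite /fubini_F.
have q0 : 0 <= r * Lam w `^ beta^-1 by rewrite mulr_ge0// powR_ge0.
have bl : bmf (fun y => expR (- (r * Lam w `^ beta^-1 * S y))) by exact: bmf_laplace.
rewrite -EFin_Ex; last first.
  rewrite (_ : (fun y => _) = (fun y => expR (- s * Lam w) * expR (- (r * Lam w `^ beta^-1 * S y)))).
    exact: bmfZ.
  by apply/funext => y; rewrite -expRD /mixture; congr expR; ring.
congr EFin.
transitivity (Ex Q (fun y => expR (- s * Lam w) * expR (- (r * Lam w `^ beta^-1 * S y)))).
  by apply: eq_Ex => y; rewrite -expRD /mixture; congr expR; ring.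
rewrite ExZ// -[Ex Q _]/(laplace Q S (r * Lam w `^ beta^-1)) lapS// -expRD; congr expR.
rewrite powRM ?powR_ge0// -powRrM mulVf ?gt_eqF// powRr1 ?(ltW L0)//; ring.
Qed.

Lemma mixture_transform_le1 (r s : R) : 0 <= s ->
  ('E_P [(fun w => expR (- (r `^ beta * c * Lam w) - s * Lam w))%R] <= 1)%E.
Proof.
move=> s0; have one : (\int[P]_w 1 = 1)%E by rewrite integral_cst// mul1e; exact: probability_setT.
rewrite unlock -[leRHS]one.
apply: ae_ge0_le_integral => //.
- apply/measurable_EFinP; apply: measurableT_comp => //.
  by apply: measurable_funB; [apply: measurableT_comp => //; exact: measurable_funM|exact: measurable_funM].
apply: filterS Lam0 => w L0 _; rewrite lee_fin expR_le1.
have h : 0 <= r `^ beta * c by rewrite mulr_ge0// powR_ge0.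
by rewrite -opprD oppr_le0 addr_ge0// mulr_ge0// ltW.
Qed.

End mixture.

Theorem mainTheorem9 (R : realType)
    (d : measure_display) (T : measurableType d) (P : probability T R)
    (X : {RV P >-> R}) (Xs : nat -> {RV P >-> R}) (N : R -> T -> nat)
    (d' : measure_display) (T' : measurableType d') (P' : probability T' R)
    (Lambda : {RV P' >-> R})
    (alpha : R) (ell : R -> R) (a : R -> R)
    (X_positive : P [set w | 0 < X w] = 1%E)
    (Xs_copies : forall i, same_law P P (Xs i) X)
    (Xs_independent : mutually_independent P (fun i => Xs i : T -> R))
    (N_counting : counting_process N)
    (N_Xs_independent : independent_systems P
       (generated_sigma_algebra [set t : R | 0 <= t] N)
       (generated_sigma_algebra [set: nat] (fun i => Xs i : T -> R)))
    (alpha_range : 1 < alpha < 2 \/ (alpha = 1 /\ ('E_P [X] < +oo)%E))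
    (X_pareto : pareto_type X alpha ell)
    (N_averages : averages_in_time P N P' Lambda)
    (a_to_infinity : a t @[t --> +oo] --> +oo)
    (a_norming : t * a t `^ (- alpha) * ell (a t) @[t --> +oo] --> (1 : R)) :
  let mu1 := fine ('E_P [X])%E in
  let CoVar t w := sample_CoVar (fun i => Xs i w) (N t w) in
  exists (d0 : measure_display) (T0 : measurableType d0)
         (Q : probability T0 R) (U L : {RV Q >-> R}),
    [/\ same_law Q P' L Lambda,
        has_U_transform alpha P' Lambda Q U,
        has_joint_transform alpha mu1 P' Lambda Q U (fun w => mu1 * L w),
        cvg_in_law P (fun t w => Num.sqrt (N t w)%:R / a t * CoVar t w)
                   Q (fun w => mu1^-1 * Num.sqrt (U w)) &
        cvg_in_law P (fun t w => t / a t * (CoVar t w / Num.sqrt (N t w)%:R))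
                   Q (fun w => mu1^-1 * (Num.sqrt (U w) / L w))] /\
    (* the transforms determine the laws of U and of (U, mu1 * L) *)
    (forall (d1 : measure_display) (T1 : measurableType d1)
            (Q1 : probability T1 R) (U1 V1 : {RV Q1 >-> R}),
       (has_U_transform alpha P' Lambda Q1 U1 -> same_law Q1 Q U1 U) /\
       (has_joint_transform alpha mu1 P' Lambda Q1 U1 V1 ->
        same_law Q1 Q (fun w => (U1 w, V1 w)) (fun w => (U w, mu1 * L w)))).
Proof.
move=> mu1 CoVar.
have mX : measurable_fun setT X by [].
have mXs i : measurable_fun setT (Xs i) by [].
have alpha02 : 0 < alpha < 2.
  case: alpha_range => [/andP[a1 a2]|[-> _]]; last by rewrite ltr01 ltr1n.
  by rewrite (lt_trans ltr01 a1).
have Gpos := pareto_tail_gt0 X_positive X_pareto.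
have Grv := pareto_tail_rv X_positive X_pareto.
have Ga := pareto_norming X_positive X_pareto a_to_infinity a_norming.
have iX := pareto_integrable X_positive X_pareto alpha_range.
have m0 := mean_abs_gt0 X_positive iX.
have mu1E : mu1 = \int[P]_w `|X w| by rewrite /mu1 (expectation_abs X_positive).
pose beta := alpha / 2; pose c := Gamma (1 - beta).
have beta0 : 0 < beta by rewrite divr_gt0//; case/andP: alpha02.
have c0 : 0 <= c.
  by apply: Rintegral_ge0 => x _; rewrite mulr_ge0 ?powR_ge0 ?expR_ge0.
have [Qs [S [S0 lapS]]] := stable_law mX mXs Xs_copies Xs_independent alpha02
  Gpos Grv a_to_infinity Ga.
have Lam0 := Lam_ae_gt0 N_averages.
have mmix : measurable_fun setT (mixture Lambda S beta) by exact: measurable_mixture.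
(* a stable variable independent of [Lambda] *)
pose Q : probability _ R := (P' \x Qs)%E.
pose U : {RV Q >-> R} := HB.pack (mixture Lambda S beta)
  (isMeasurableFun.Build _ _ _ _ _ mmix).
have mL : measurable_fun setT (fun z : T' * measurableTypeR R => Lambda z.1).
  by apply: measurableT_comp => //; exact: measurable_fst.
pose L : {RV Q >-> R} := HB.pack (fun z : T' * measurableTypeR R => Lambda z.1)
  (isMeasurableFun.Build _ _ _ _ _ mL).
have mixE r s : 0 <= r -> 0 <= s ->
    ('E_Q [(fun z => expR (- (r * U z) - s * (mu1 * L z)))%R] =
     'E_P' [(fun w => expR (- (r `^ beta * c * Lambda w) - s * (mu1 * Lambda w)))%R])%E.
  move=> r0 s0.
  have -> : (fun z => expR (- (r * U z) - s * (mu1 * L z))) =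
      (fun z => expR (- (r * mixture Lambda S beta z) - s * mu1 * Lambda z.1)).
    by apply/funext => z; rewrite -[s * mu1 * _]mulrA.
  have -> : (fun w => expR (- (r `^ beta * c * Lambda w) - s * (mu1 * Lambda w))) =
      (fun w => expR (- (r `^ beta * c * Lambda w) - s * mu1 * Lambda w)).
    by apply/funext => w; rewrite -[s * mu1 * _]mulrA.
  exact: (mixture_transform Lam0 S0 beta0 lapS (s * mu1) r0).
have UT : has_U_transform alpha P' Lambda Q U.
  move=> r r0; have := mixE r 0 r0 (lexx 0).
  have -> : (fun z => expR (- (r * U z) - 0 * (mu1 * L z))) =
      (fun z => expR (- (r * U z))) by apply/funext => z; rewrite mul0r subr0.
  by move=> ->; congr expectation; apply/funext => w; rewrite mul0r subr0.
have JT : has_joint_transform alpha mu1 P' Lambda Q U (fun w => mu1 * L w).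
  by move=> r s r0 s0; exact: (mixE r s (ltW r0) s0).
pose phi r s := fine ('E_P' [(fun w =>
  expR (- (r `^ beta * c * Lambda w) - s * (mu1 * Lambda w)))%R])%E.
have phi1 r s : 0 <= s -> phi r s <= 1 /\ ('E_P' [(fun w =>
    expR (- (r `^ beta * c * Lambda w) - s * (mu1 * Lambda w)))%R] = (phi r s)%:E)%E.
  move=> s0; have sm0 : 0 <= s * mu1 by rewrite mu1E mulr_ge0// ltW.
  have := mixture_transform_le1 beta Lam0 c0 r sm0.
  rewrite (_ : (fun w => _) = (fun w =>
    expR (- (r `^ beta * c * Lambda w) - s * (mu1 * Lambda w)))); last first.
    by apply/funext => w; rewrite -[s * mu1 * _]mulrA.
  move=> le1.
  have fE : ('E_P' [(fun w => expR (- (r `^ beta * c * Lambda w) - s * (mu1 * Lambda w)))%R])%E \is a fin_num.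
    rewrite ge0_fin_numE ?(le_lt_trans le1) ?ltry//.
    by apply: expectation_ge0 => w; rewrite expR_ge0.
  by rewrite /phi fineK// -lee_fin fineK.
have mmuL : measurable_fun setT (fun z => mu1 * L z) by exact: measurable_funM.
have [mN _] := N_counting.
have mS : measurable_fun setT S by [].
have limit (kappa : R -> R) : measurable_fun setT kappa ->
    (forall x, 0 < x -> {for x, continuous kappa}) ->
    cvg_in_law P (fun t w => kappa ((N t w)%:R / t) *
        (Num.sqrt (N t w)%:R / a t * CoVar t w))
      Q (fun z => kappa (L z) * (Num.sqrt (U z) / mu1)).
  move=> mk ck; rewrite mu1E.
  exact: (random_size_cvg_in_law mX mXs Xs_copies Xs_independent X_positive
    alpha02 Gpos Grv a_to_infinity Ga iX m0 mS S0 lapS mN N_Xs_independent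
    N_averages mk ck).
exists _, _, Q, U, L; split; first split => //.
- move=> A mA; have -> : L @^-1` A = (Lambda @^-1` A) `*` setT.
    by apply/seteqP; split => z //= [].
  have mLA : measurable (Lambda @^-1` A) by rewrite -[X in measurable X]setTI; exact: (measurable_funPT Lambda).
  rewrite [LHS]product_measure1E//.
  by rewrite -[RHS]mule1 -(probability_setT Qs).
- have -> : (fun t w => Num.sqrt (N t w)%:R / a t * CoVar t w) =
      (fun t w => 1 * (Num.sqrt (N t w)%:R / a t * CoVar t w)).
    by apply/funext => t; apply/funext => w; rewrite mul1r.
  have -> : (fun z => mu1^-1 * Num.sqrt (U z)) =
      (fun z => 1 * (Num.sqrt (U z) / mu1)).
    by apply/funext => z; rewrite mul1r mulrC.
  by apply: (limit (fun=> 1)) => // x _; exact: cvg_cst.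
- (* for an empty sample both sides are 0 *)
  have -> : (fun t w => t / a t * (CoVar t w / Num.sqrt (N t w)%:R)) =
      (fun t w => ((N t w)%:R / t)^-1 * (Num.sqrt (N t w)%:R / a t * CoVar t w)).
    apply/funext => t; apply/funext => w; rewrite invf_div.
    have [->|n0] := eqVneq (N t w) 0%N; first by rewrite sqrtr0 invr0 !(mulr0, mul0r).
    have := sqr_sqrtr (ler0n R (N t w)).
    have s0 : Num.sqrt (N t w)%:R != 0 :> R by rewrite gt_eqF// sqrtr_gt0 ltr0n lt0n.
    move: (Num.sqrt _) s0 (a t)^-1 => q q0 b <-.
    by field.
  have -> : (fun z => mu1^-1 * (Num.sqrt (U z) / L z)) =
      (fun z => (L z)^-1 * (Num.sqrt (U z) / mu1)).
    by apply/funext => z; rewrite mulrA [RHS]mulrC mulrC mulrA; ring.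
  apply: (limit (@GRing.inv R)); first exact: measurable_inv.
  by move=> x x0; apply: inv_continuous; rewrite gt_eqF.
move=> d1 T1 Q1 U1 V1.
have mU1 : measurable_fun setT U1 by [].
have mV1 : measurable_fun setT V1 by [].
have mU : measurable_fun setT U by [].
split => h; last first.
  apply: (@joint_transform_unique _ _ _ _ _ Q1 Q U1 V1 U (fun z => mu1 * L z) phi) => //.
  - by move=> r s _ s0; exact: (phi1 r s s0).1.
  - by move=> r s r0 s0; rewrite h// (phi1 r s s0).2.
  - by move=> r s r0 s0; rewrite JT// (phi1 r s s0).2.
(* the law of one variable is read off from its joint law with 0 *)
have sl : same_law Q1 Q (fun w => (U1 w, 0 : R)) (fun z => (U z, 0 : R)).
  apply: (@joint_transform_unique _ _ _ _ _ Q1 Q U1 (fun=> 0) U (fun=> 0) (fun r _ => phi r 0)) => //.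
  - by move=> r s _ _; exact: (phi1 r 0 (lexx 0)).1.
  - move=> r s r0 s0; under eq_fun do rewrite mulr0 subr0.
    rewrite h ?ltW// -(phi1 r 0 (lexx 0)).2.
    by congr expectation; apply/funext => w; rewrite mul0r subr0.
  - move=> r s r0 s0; under eq_fun do rewrite mulr0 subr0.
    rewrite UT ?ltW// -(phi1 r 0 (lexx 0)).2.
    by congr expectation; apply/funext => w; rewrite mul0r subr0.
move=> A mA; have := sl (A `*` setT) (measurableX mA measurableT).
have E T2 (f : T2 -> R) : (fun w => (f w, 0 : R)) @^-1` (A `*` setT) = f @^-1` A.
  by apply/seteqP; split => w //= [].
by rewrite !E.
Qed.
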